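(* The power set axiom $\forall x\,\exists y\,\forall z\,(z\in y\leftrightarrow z\subseteq x)$ is not OTM-realizable, not even if one assumes $V=L$. Moreover, the subset collection scheme from CZF, $$\forall a\,\forall b\,\exists c\,\forall u\,\bigl(\forall x\in a\,\exists y\in b\,\phi(x,y,u)\rightarrow\exists d\in c\,(\forall x\in a\,\exists y\in d\,\phi(x,y,u)\wedge\forall y\in d\,\exists x\in a\,\phi(x,y,u))\bigr),$$ has instantiations (by $\in$-formulas $\phi$) that are not OTM-realizable.
   Context: OTM means Koepke's ordinal Turing machine (a Turing machine with tape of length $\mathrm{On}$ running for ordinal time); OTMs process sets of ordinals, and programs may use ordinal parameters. An $\in$-formula is a first-order formula in the language of set theory (with $\in$ and $=$). Bounded quantifiers and $z\subseteq x$ are the usual abbreviations. In the subset collection scheme, $c$ and $d$ are not free in $\phi$. Codes. Given a set $x$, let $\mathrm{tc}(x)$ be its transitive closure, pick a suitable ordinal $\alpha$ and a bijection $f:\alpha\rightarrow \mathrm{tc}(x)\cup\{x\}$ with $f(0)=x$, and let $c_f(x)=\{p(\iota,\xi):\iota,\xi<\alpha\wedge f(\iota)\in f(\xi)\}$, where $p$ is Cantor's pairing function on ordinals. Any such $c_f(x)$ is a code for $x$, written $c(x)$. OTMs compute on sets by receiving codes as input and producing codes as output. OTM-realizability. Let $\phi,\psi$ be $\in$-formulas, $P$ an OTM-program, $\alpha$ an ordinal, $a_0,\dots,a_n,b_0,\dots,b_m$ sets with codes $c(a_0),\dots,c(a_n),c(b_0),\dots,c(b_m)$, and $R,R'$ finite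 tuples. 1. If $\phi$ is quantifier-free, $(P,\alpha)$ realizes $\phi(a_0,\dots,a_n)$ iff $\phi(a_0,\dots,a_n)$ is true (in any transitive set containing $a_0,\dots,a_n$). 2. $(R,R')$ realizes $\phi(a_0,\dots,a_n)\wedge\psi(b_0,\dots,b_m)$ iff $R$ realizes $\phi(a_0,\dots,a_n)$ and $R'$ realizes $\psi(b_0,\dots,b_m)$. 3. $(i,R)$ realizes $\phi(a_0,\dots,a_n)\vee\psi(b_0,\dots,b_m)$ iff $i=0$ and $R$ realizes $\phi(a_0,\dots,a_n)$, or $i=1$ and $R$ realizes $\psi(b_0,\dots,b_m)$. 4. $(P,\alpha)$ realizes $A\rightarrow B$ iff, whenever a (code for a) realizer $R$ for $A$ is given as input, $P(R,\alpha)$ computes a realizer $R'$ for $B$. 5. A realizer for $\neg\phi$ is a realizer for $\phi\rightarrow 1=0$ (where $1=0$ is a false atomic statement). 6. $(P,\alpha)$ realizes $\exists x\,\phi(x,a_0,\dots,a_n)$ iff $P(\alpha,c(a_0),\dots,c(a_n))$ halts with output $(c(b),R)$ where $c(b)$ codes a set $b$ such that $R$ realizes $\phi(b,a_0,\dots,a_n)$. 7. $(P,\alpha)$ realizes $\forall x\,\phi(x,a_0,\dots,a_n)$ iff, for every code $c(a)$ for a set $a$, $P(\alpha,c(a),c(a_0),\dots,c(a_n))$ halts with output $R$ such that $R$ realizes $\phi(a,a_0,\dots,a_n)$. 8. If $\phi$ has free variables $x_1,\dots,x_n$, then $R$ realizes $\phi$ iff $R$ realizes $\forall x_1,\dots,x_n\,\phi$.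 A formula $\phi$ is OTM-realizable if some $R$ realizes it. *)

(* Defs.v *)
From mathcomp Require Import all_boot.
From Stdlib Require Import Relation_Operators.

Set Implicit Arguments.
Unset Strict Implicit.
Unset Printing Implicit Defensive.

Inductive formula : Type :=
| fMem of nat & nat
| fEq of nat & nat
| fAnd of formula & formula
| fOr of formula & formula
| fImp of formula & formula
| fNot of formula
| fAll of nat & formula
| fEx of nat & formula.

Definition fIff (A B : formula) : formula := fAnd (fImp A B) (fImp B A).

Definition fAllIn (x a : nat) (A : formula) : formula :=
  fAll x (fImp (fMem x a) A).

Definition fExIn (x a : nat) (A : formula) : formula :=
  fEx x (fAnd (fMem x a) A).

(* z is a subset of x; w must differ from z and x. *)
Definition fSub (w z x : nat) : formula := fAllIn w z (fMem w x).

Fixpoint qfree (A : formula) : bool :=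
  match A with
  | fMem _ _ | fEq _ _ => true
  | fAnd B C | fOr B C | fImp B C => qfree B && qfree C
  | fNot B => qfree B
  | fAll _ _ | fEx _ _ => false
  end.

Fixpoint fv_raw (A : formula) : seq nat :=
  match A with
  | fMem i j | fEq i j => [:: i; j]
  | fAnd B C | fOr B C | fImp B C => fv_raw B ++ fv_raw C
  | fNot B => fv_raw B
  | fAll x B | fEx x B => [seq v <- fv_raw B | v != x]
  end.

(* The order of this list fixes the order in which the codes of the parameters
   of a formula are given to a program. *)
Definition fv (A : formula) : seq nat := sort leq (undup (fv_raw A)).

Definition universal_closure (A : formula) : formula := foldr fAll A (fv A).

(* The variables 0, 1, 2, 3 are x, y, z and the bound variable of the subset
   abbreviation. *)
Definition powerset_axiom : formula :=
  fAll 0 (fEx 1 (fAll 2 (fIff (fMem 2 1) (fSub 3 2 0)))).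

Definition var_x := 0.
Definition var_y := 1.
Definition var_u := 2.
Definition var_a := 3.
Definition var_b := 4.
Definition var_c := 5.
Definition var_d := 6.

Definition subset_collection (phi : formula) : formula :=
  fAll var_a (fAll var_b (fEx var_c (fAll var_u
    (fImp
      (fAllIn var_x var_a (fExIn var_y var_b phi))
      (fExIn var_d var_c
        (fAnd
          (fAllIn var_x var_a (fExIn var_y var_d phi))
          (fAllIn var_y var_d (fExIn var_x var_a phi)))))))).

(* A universe of sets satisfying ZFC.  Classes are arbitrary predicates on the
   carrier, and Foundation is stated as induction on membership.  Separation
   and the empty set follow from Replacement (of partial class functions) and
   Infinity. *)
Record zfc_universe : Type := ZFCUniverse {
  carrier :> Type;
  El : carrier -> carrier -> Prop;
  extensionality_ax : forall x y,
    (forall z, El z x <-> El z y) -> x = y;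
  foundation_ax : well_founded El;
  pairing_ax : forall x y, exists p, forall z, El z p <-> z = x \/ z = y;
  union_ax : forall x, exists s, forall z,
    El z s <-> exists y, El y x /\ El z y;
  power_ax : forall x, exists p, forall z,
    El z p <-> (forall w, El w z -> El w x);
  infinity_ax : exists w,
    (exists e, El e w /\ forall z, ~ El z e) /\
    (forall x, El x w ->
       exists y, El y w /\ forall z, El z y <-> El z x \/ z = x);
  replacement_ax : forall (F : carrier -> carrier -> Prop) (a : carrier),
    (forall x y y', El x a -> F x y -> F x y' -> y = y') ->
    exists b, forall y, El y b <-> exists x, El x a /\ F x y;
  choice_ax : forall a,
    (forall x, El x a -> exists y, El y x) ->
    (forall x y z, El x a -> El y a -> El z x -> El z y -> x = y) ->
    exists c, forall x, El x a -> exists! y, El y x /\ El y c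
}.

Arguments El {_} _ _.
Notation "x ∈ y" := (El x y) (at level 70, no associativity).

Definition update (T : Type) (e : nat -> T) (x : nat) (a : T) : nat -> T :=
  fun v => if v == x then a else e v.

Section Universe.

Variable U : zfc_universe.
Implicit Types (x y z : U).

(* Tarskian truth in the structure whose domain is the class D. *)
Fixpoint sat (D : U -> Prop) (A : formula) (r : nat -> U) : Prop :=
  match A with
  | fMem i j => r i ∈ r j
  | fEq i j => r i = r j
  | fAnd B C => sat D B r /\ sat D C r
  | fOr B C => sat D B r \/ sat D C r
  | fImp B C => sat D B r -> sat D C r
  | fNot B => ~ sat D B r
  | fAll v B => forall a, D a -> sat D B (update r v a)
  | fEx v B => exists2 a, D a & sat D B (update r v a)
  end.

Definition transitive_set x := forall y z, z ∈ y -> y ∈ x -> z ∈ x.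

Definition is_ordinal x :=
  transitive_set x /\ forall y, y ∈ x -> transitive_set y.

Record ord : Type := Ord { oval :> U; ovalP : is_ordinal oval }.

Implicit Types (xi eta zeta lam : ord).

Definition olt xi eta : Prop := oval xi ∈ oval eta.
Definition ole xi eta : Prop := olt xi eta \/ xi = eta.

Definition is_zero xi := forall eta, ~ olt eta xi.
(* eta = xi + 1 *)
Definition osucc xi eta := forall zeta, olt zeta eta <-> ole zeta xi.
Definition is_successor eta := exists xi, osucc xi eta.
Definition is_limit xi := ~ is_zero xi /\ ~ is_successor xi.

(* eta = xi + n *)
Fixpoint oadd_nat xi (n : nat) eta : Prop :=
  match n with
  | 0 => eta = xi
  | m.+1 => exists2 zeta, oadd_nat xi m zeta & osucc zeta eta
  end.

(* The canonical well-order of pairs of ordinals: by maximum, then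
   lexicographically. *)
Definition max_lt xi eta xi' eta' :=
  (olt xi xi' \/ olt xi eta') /\ (olt eta xi' \/ olt eta eta').

Definition pair_lt xi eta xi' eta' :=
  max_lt xi eta xi' eta' \/
  (~ max_lt xi' eta' xi eta /\ (olt xi xi' \/ (xi = xi' /\ olt eta eta'))).

(* There is exactly one pairing function: the order isomorphism between pairs
   of ordinals and ordinals. *)
Definition is_pairing (p : ord -> ord -> ord) :=
  (forall xi eta xi' eta',
     olt (p xi eta) (p xi' eta') <-> pair_lt xi eta xi' eta') /\
  (forall zeta, exists xi eta, p xi eta = zeta).

(* x is a subset of the class D definable over (D, membership) with parameters
   from D; the value r n is irrelevant. *)
Definition definable_over (D : U -> Prop) x :=
  exists (A : formula) (n : nat) (r : nat -> U),
    (forall v, v \in fv A -> v != n -> D (r v)) /\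
    (forall z, z ∈ x <-> D z /\ sat D A (update r n z)).

(* For an ordinal alpha, L_stage alpha is the level L_alpha, obtained as the
   union of the definable power sets of the L_beta with beta < alpha. *)
Definition L_stage : U -> U -> Prop :=
  Fix (@foundation_ax U) (fun _ => U -> Prop)
    (fun alpha stage x =>
       exists (beta : U) (lt : beta ∈ alpha), definable_over (stage beta lt) x).

Definition V_eq_L := forall x, exists alpha : ord, L_stage alpha x.

(* A command (s, c, c', m, s'): in state s, reading the symbol c, write c',
   move right if m = 1 and left if m = 0, and enter state s'. *)
Definition command : Type := (nat * bool * bool * bool * nat)%type.

Definition cmd_state (k : command) : nat := let: (s, _, _, _, _) := k in s.
Definition cmd_read (k : command) : bool := let: (_, c, _, _, _) := k in c.
Definition cmd_write (k : command) : bool := let: (_, _, c, _, _) := k in c.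
Definition cmd_right (k : command) : bool := let: (_, _, _, m, _) := k in m.
Definition cmd_next (k : command) : nat := let: (_, _, _, _, s) := k in s.

(* A state of the program reacts to both symbols, and deterministically. *)
Definition is_program (P : seq command) : bool :=
  all (fun k => has (fun k' => (cmd_state k' == cmd_state k) &&
                               (cmd_read k' != cmd_read k)) P) P &&
  all (fun k => all (fun k' => ((cmd_state k' == cmd_state k) &&
                                (cmd_read k' == cmd_read k)) ==> (k' == k)) P) P.

Definition program : Type := {P : seq command | is_program P}.

Definition program_states (P : program) : seq nat := map cmd_state (val P).

Record config : Type := Config {
  state : nat;
  head_pos : ord;
  tape : ord -> bool
}.

Definition move_head (right : bool) xi eta : Prop :=
  if right then osucc xi eta
  else osucc eta xi \/ (~ is_successor xi /\ is_zero eta).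

Definition step (P : program) (C C' : config) : Prop :=
  exists k : command,
    [/\ k \in val P, cmd_state k = state C & cmd_read k = tape C (head_pos C)] /\
    [/\ state C' = cmd_next k,
        move_head (cmd_right k) (head_pos C) (head_pos C'),
        tape C' (head_pos C) = cmd_write k &
        forall xi, xi <> head_pos C -> tape C' xi = tape C xi].

Section LimInf.

Variables (T : Type) (le : T -> T -> Prop).

Definition is_min (A : T -> Prop) (m : T) : Prop :=
  A m /\ forall a, A a -> le m a.

Definition is_lub (A : T -> Prop) (l : T) : Prop :=
  (forall a, A a -> le a l) /\ (forall u, (forall a, A a -> le a u) -> le l u).

(* l is the limit inferior of f s as s tends to t through the set S. *)
Definition is_liminf (t : ord) (S : ord -> Prop) (f : ord -> T) (l : T) : Prop :=
  is_lub
    (fun m => exists2 r, olt r t &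
       is_min (fun v => exists s, [/\ ole r s, olt s t, S s & f s = v]) m) l.

End LimInf.

Definition limit_config (C : ord -> config) (t : ord) : Prop :=
  [/\ is_liminf (fun m n : nat => m <= n) t (fun _ => True)
        (fun s => state (C s)) (state (C t)),
      is_liminf ole t (fun s => state (C s) = state (C t))
        (fun s => head_pos (C s)) (head_pos (C t)) &
      forall xi, is_liminf (fun c d : bool => c ==> d) t (fun _ => True)
        (fun s => tape (C s) xi) (tape (C t) xi)].

(* A class of ordinals, viewed as a tape content. *)
Definition oset : Type := ord -> Prop.

Definition tape_is (C : config) (X : oset) : Prop :=
  forall xi, tape C xi <-> X xi.

(* P, started on the tape content X0, stops; C gives its configurations up to
   the halting time t1. *)
Definition halting_computation
    (P : program) (X0 : oset) (t1 : ord) (C : ord -> config) : Prop :=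
  [/\ forall t, is_zero t ->
        [/\ state (C t) = 0, is_zero (head_pos (C t)) & tape_is (C t) X0],
      forall t t', olt t t1 -> osucc t t' -> step P (C t) (C t'),
      forall t, ole t t1 -> is_limit t -> limit_config C t &
      state (C t1) \notin program_states P].

Definition oempty : oset := fun _ => False.
Definition osingle (alpha : ord) : oset := fun xi => xi = alpha.
Definition osingle_nat (n : nat) : oset :=
  fun xi => exists2 zeta, is_zero zeta & oadd_nat zeta n xi.

(* A tuple X_0, ..., X_(k-1) is laid out on k tracks: for lambda zero or a
   limit, the cell lambda + (k n + i) holds the bit lambda + n of X_i. *)
Definition interleave (Xs : seq oset) : oset :=
  fun zeta => exists lam xi (n i : nat),
    [/\ ~ is_successor lam, oadd_nat lam n xi, i < size Xs,
        oadd_nat lam (size Xs * n + i) zeta & nth oempty Xs i xi].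

(* The tape has an input track, a work track and an output track.  At the
   start the last two are blank; at halting time the output is exactly the
   content of the output track. *)
Definition computes (P : program) (X Y : oset) : Prop :=
  exists t1 C,
    halting_computation P (interleave [:: X; oempty; oempty]) t1 C /\
    exists X' W : oset, tape_is (C t1) (interleave [:: X'; W; Y]).

(* Membership in tc(x) together with x itself. *)
Definition tc_with x y := clos_refl_trans U (@El U) y x.

(* f is a bijection from alpha onto tc(x) with x adjoined, and f(0) = x. *)
Definition enumerates_tc x (alpha : ord) (f : ord -> U) : Prop :=
  [/\ forall xi, olt xi alpha -> tc_with x (f xi),
      forall xi eta, olt xi alpha -> olt eta alpha -> f xi = f eta -> xi = eta,
      forall y, tc_with x y -> exists2 xi, olt xi alpha & f xi = y &
      forall xi, is_zero xi -> f xi = x].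

(* The set c_f(x), for the pairing function p. *)
Definition membership_code
    (p : ord -> ord -> ord) (alpha : ord) (f : ord -> U) : oset :=
  fun zeta => exists xi eta,
    [/\ olt xi alpha, olt eta alpha, f xi ∈ f eta & p xi eta = zeta].

(* A code of x is presented to the machine together with the length alpha of
   the enumeration: a tape of class length has no end-of-input marker, so
   without alpha a machine could not tell where c_f(x) ends and not even a
   copy of the input could be produced by a halting computation. *)
Definition is_code (c : oset) x : Prop :=
  exists p alpha f,
    [/\ is_pairing p, enumerates_tc x alpha f &
        forall zeta, c zeta <->
          interleave [:: osingle alpha; membership_code p alpha f] zeta].

Inductive realizer : Type :=
| RProg of program & ord
| RPair of realizer & realizer
| RInj of bool & realizer.

(* Programs are numbered by the countable-type encoding. *)
Fixpoint rcode (R : realizer) : oset :=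
  match R with
  | RProg P alpha => interleave [:: osingle_nat (pickle (val P)); osingle alpha]
  | RPair R1 R2 => interleave [:: rcode R1; rcode R2]
  | RInj i R1 => interleave [:: osingle_nat i; rcode R1]
  end.

Record coded_set : Type := CodedSet {
  cset : U;
  ccode : oset;
  ccodeP : is_code ccode cset
}.

Definition env : Type := nat -> coded_set.

Definition codes (e : env) (vs : seq nat) : seq oset :=
  [seq ccode (e v) | v <- vs].

(* The realizers of an implication between statements whose realizers are
   given by RA and RB. *)
Definition realizes_imp (RA RB : realizer -> Prop) (R : realizer) : Prop :=
  exists P alpha, R = RProg P alpha /\
    forall R1, RA R1 -> exists R2,
      computes P (interleave [:: rcode R1; osingle alpha]) (rcode R2) /\ RB R2.

(* The clause for quantifier-free formulas takes precedence over the others.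
   Nothing realizes the false atomic statement in the clause for negation. *)
Fixpoint realizes (A : formula) (e : env) (R : realizer) : Prop :=
  if qfree A then
    (exists P alpha, R = RProg P alpha) /\
    sat (fun _ => True) A (fun v => cset (e v))
  else
  match A with
  | fMem _ _ | fEq _ _ => False (* unreachable *)
  | fAnd B C => exists R1 R2,
      [/\ R = RPair R1 R2, realizes B e R1 & realizes C e R2]
  | fOr B C => exists i R1, R = RInj i R1 /\
      if i then realizes C e R1 else realizes B e R1
  | fImp B C => realizes_imp (realizes B e) (realizes C e) R
  | fNot B => realizes_imp (realizes B e) (fun _ => False) R
  | fEx x B => exists P alpha, R = RProg P alpha /\
      exists (b : coded_set) R1,
        computes P (interleave (osingle alpha :: codes e (fv A)))
          (interleave [:: ccode b; rcode R1]) /\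
        realizes B (update e x b) R1
  | fAll x B => exists P alpha, R = RProg P alpha /\
      forall a : coded_set, exists R1,
        computes P (interleave (osingle alpha :: ccode a :: codes e (fv A)))
          (rcode R1) /\
        realizes B (update e x a) R1
  end.

(* The universal closure has no free variables, so the environment is
   irrelevant here. *)
Definition OTM_realizable (A : formula) : Prop :=
  exists R, forall e : env, realizes (universal_closure A) e R.

End Universe.

(* Main.v *)
Require Import Defs.
From mathcomp Require Import all_boot zify.
From mathcomp Require Import boolp.
From Stdlib Require Import Relation_Operators.

Set Implicit Arguments.
Unset Strict Implicit.
Unset Printing Implicit Defensive.

(* A halting computation on an input bounded by small ordinals, where smallness means being enumerated by a
   suitable ordinal [lam], has only small ordinals on its final tape: collapse a small hull of the computation
   that contains the input and the halting time. Hence a code of a set computed from codes of small sets and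
   from parameters below [lam] has small length, and the coded set has at most [lam] elements.

   For the power set axiom this contradicts Cantor's theorem at the ordinal [lam], because "z is a subset of
   x" has a trivial realizer whenever it is true.

   For subset collection, take for phi the formula "y in u and y not in x", and for u the branches
   of a tree of height [lam] with only [lam] nodes but more than [lam] branches. The nodes are arranged so that
   the membership codes of the nodes on a branch are initial segments of that of the branch. The premise is then
   realized by a program that copies the code of u up to a suitable place beyond the length of the
   given code of x; the sets x in a are chosen such that every code of x is long enough to bound x. Any d as in
   the conclusion determines the branch, so c has more than [lam] elements. *)
(** * Sets and ordinals *)

(** No cardinal arithmetic is used. Smallness is an enumeration by the ordinals below [lam], and
    what is asked of [lam] is closure: under pairing, which makes the terms naming a hull codable
    below [lam], and under a bound for the lengths of codes of the sets x in a. Each cardinality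
    contradiction is an instance of Cantor's diagonal argument. The halting time is put into the
    hull because its collapse then also carries a halting state, hence is the halting time itself;
    so every visited cell is the collapse of a hull element. In subset collection, an implication
    with unrealized premise has a trivial realizer, so truth of the premise is not enough: a machine
    must find some y in u outside x from an arbitrary code of x. The program does not decode x but
    reads only the length of its code, and takes y to be a node with larger index. At a limit place
    it can inspect only finitely many cells, so the place to stop must be visible locally; this is
    why a branch records which limits are closed under pairing, where an initial segment of its code
    is again a code. *)

Section Ordinals.

Variable U : zfc_universe.

Definition setlike (K : U -> Prop) : Prop := exists s : U, forall y, K y -> y ∈ s.

(** Separation, obtained from Replacement for the identity restricted to [K]. *)
Lemma setlikeP (K : U -> Prop) : setlike K -> exists s : U, forall y, y ∈ s <-> K y.
Proof.
move=> [s Ks].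
have [|b bP] := @replacement_ax U (fun x y => K x /\ y = x) s.
  by move=> x y y' _ [_ ->] [_ ->].
exists b => y; rewrite bP; split; first by move=> [x [_ [Kx ->]]].
by move=> Ky; exists y; split; [exact: Ks|].
Qed.

Lemma setlike_sub (K L : U -> Prop) : setlike K -> (forall y, L y -> K y) -> setlike L.
Proof. by move=> [s sP] LK; exists s => y /LK/sP. Qed.

Lemma setlike_mem (s : U) : setlike (fun y => y ∈ s).
Proof. by exists s. Qed.

Lemma setlike_image (K : U -> Prop) (h : U -> U) :
  setlike K -> setlike (fun y => exists2 x, K x & y = h x).
Proof.
move=> [s Ks].
have [|b bP] := @replacement_ax U (fun x y => y = h x) s.
  by move=> x y y' _ -> ->.
by exists b => y [x /Ks xs ->]; apply/bP; exists x.
Qed.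

Lemma setlike_bigcup (K : U -> Prop) (L : U -> U -> Prop) :
  setlike K -> (forall x, K x -> setlike (L x)) ->
  setlike (fun y => exists2 x, K x & L x y).
Proof.
move=> setK setL.
have /choice [h hP] : forall x, exists s, K x -> forall y, L x y -> y ∈ s.
  move=> x; have [Kx|nKx] := EM (K x); last by exists x => /nKx.
  by have [s sP] := setL x Kx; exists s.
have [s sP] := setlike_image h setK.
have [t tP] := @union_ax U s.
exists t => y [x Kx Lxy]; apply/tP; exists (h x); split; last exact: (hP x Kx).
by apply: sP; exists x.
Qed.

Lemma setlike_or (K L : U -> Prop) : setlike K -> setlike L -> setlike (fun y => K y \/ L y).
Proof.
move=> [s sP] [t tP].
have [p pP] := @pairing_ax U s t; have [v vP] := @union_ax U p.
exists v => y [/sP ys|/tP yt]; apply/vP; [exists s|exists t]; split=> //; apply/pP.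
  by left.
by right.
Qed.

Lemma setlike1 (x : U) : setlike (fun y => y = x).
Proof. by have [p pP] := @pairing_ax U x x; exists p => y ->; apply/pP; left. Qed.

Lemma setlike_subsets (K : U -> Prop) :
  setlike K -> setlike (fun z => forall y, y ∈ z -> K y).
Proof.
move=> /setlikeP [s sP]; have [p pP] := @power_ax U s.
by exists p => z zK; apply/pP => w /zK /sP.
Qed.

Lemma memxx (x : U) : ~ x ∈ x.
Proof.
by elim/(well_founded_ind (@foundation_ax U)): x => x IH xx; exact: (IH x xx xx).
Qed.

Local Notation ord := (ord U).
Implicit Types (xi eta zeta lam : ord).

Lemma oval_inj xi eta : oval xi = oval eta -> xi = eta.
Proof.
case: xi eta => [x px] [y py] /= xy; case: _ / xy py => py.
by rewrite (Prop_irrelevance px py).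
Qed.

Lemma mem_ordinal (x y : U) : is_ordinal x -> y ∈ x -> is_ordinal y.
Proof.
move=> [tx ty] yx; split; first exact: ty.
by move=> z zy; apply: ty; apply: tx zy yx.
Qed.

Lemma ord_mem (y : U) xi : y ∈ oval xi -> exists2 eta, oval eta = y & olt eta xi.
Proof. by move=> yx; exists (Ord (mem_ordinal (ovalP xi) yx)). Qed.

Lemma olt_wf : well_founded (@olt U).
Proof.
move=> xi; have [x xE] : exists x, x = oval xi by exists (oval xi).
elim/(well_founded_ind (@foundation_ax U)): x xi xE => x IH xi xE.
by constructor=> eta lt; apply: (IH (oval eta)) => //; rewrite xE.
Qed.

Lemma oltxx xi : ~ olt xi xi.
Proof. exact: memxx. Qed.

Lemma olt_trans eta xi zeta : olt xi eta -> olt eta zeta -> olt xi zeta.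
Proof. by move=> a b; have [t _] := ovalP zeta; apply: t a b. Qed.

Lemma ord_ext xi eta : (forall zeta, olt zeta xi <-> olt zeta eta) -> xi = eta.
Proof.
move=> H; apply: oval_inj; apply: extensionality_ax => z; split.
  by move=> /ord_mem [zeta <- /H].
by move=> /ord_mem [zeta <- /H].
Qed.

Lemma olt_total xi eta : [\/ olt xi eta, xi = eta | olt eta xi].
Proof.
elim/(well_founded_ind olt_wf): xi eta => xi IHxi eta.
elim/(well_founded_ind olt_wf): eta => eta IHeta.
have [[eta' lt' le']|H1] := EM (exists2 eta', olt eta' eta & ole xi eta').
  by apply: Or31; case: le' => [h|->] //; exact: olt_trans h lt'.
have [[xi' lt' le']|H2] := EM (exists2 xi', olt xi' xi & ole eta xi').
  by apply: Or33; case: le' => [h|->] //; exact: olt_trans h lt'.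
apply: Or32; apply: ord_ext => zeta; split=> h.
  case: (IHxi zeta h eta) => // H; first by case: H2; exists zeta => //; right.
  by case: H2; exists zeta => //; left.
case: (IHeta zeta h) => // H; first by case: H1; exists zeta => //; left.
by case: H1; exists zeta => //; right.
Qed.

Lemma olexx xi : ole xi xi. Proof. by right. Qed.
Lemma oltW xi eta : olt xi eta -> ole xi eta. Proof. by left. Qed.

Lemma ole_lt_trans eta xi zeta : ole xi eta -> olt eta zeta -> olt xi zeta.
Proof. by case=> [|->] //; exact: olt_trans. Qed.

Lemma olt_le_trans eta xi zeta : olt xi eta -> ole eta zeta -> olt xi zeta.
Proof. by move=> h; case=> [|<-] //; exact: olt_trans. Qed.

Lemma ole_trans eta xi zeta : ole xi eta -> ole eta zeta -> ole xi zeta.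
Proof. by move=> h; case=> [l|<-] //; left; exact: ole_lt_trans l. Qed.

Lemma oltNge xi eta : olt xi eta <-> ~ ole eta xi.
Proof.
split; first by move=> h h'; exact: oltxx (olt_le_trans h h').
move=> h; case: (olt_total xi eta) => // h'; case: h; [right|left] => //.
Qed.

Lemma oleNgt xi eta : ole xi eta <-> ~ olt eta xi.
Proof.
split; first by move=> h h'; exact: oltxx (olt_le_trans h' h).
by move=> h; case: (olt_total xi eta) => h'; [left|right|case: h].
Qed.

Lemma ole_anti xi eta : ole xi eta -> ole eta xi -> xi = eta.
Proof. by case=> // h h'; case: (@oltxx xi); exact: olt_le_trans h h'. Qed.

Lemma ole_or_lt xi eta : ole xi eta \/ olt eta xi.
Proof. by case: (olt_total xi eta) => h; [left; left|left; right|right]. Qed.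

Lemma olt_least (K : ord -> Prop) :
  (exists xi, K xi) -> exists2 xi, K xi & forall eta, K eta -> ole xi eta.
Proof.
move=> [xi]; elim/(well_founded_ind olt_wf): xi => xi IH Kxi.
have [[eta lt Keta]|H] := EM (exists2 eta, olt eta xi & K eta); first exact: (IH eta).
exists xi => // eta Keta; apply/oleNgt => lt; apply: H; by exists eta.
Qed.

Definition osetlike (K : ord -> Prop) : Prop :=
  exists s : U, forall xi, K xi -> oval xi ∈ s.

(** The ordinals constructed later arise from this lemma: successors, suprema and values of a
    collapse are given by describing their members. *)
Lemma ord_of_class (D : ord -> Prop) :
  osetlike D -> (forall xi eta, olt xi eta -> D eta -> D xi) ->
  exists alpha, forall xi, olt xi alpha <-> D xi.
Proof.
move=> [s sP] Ddown.
have [|a aP] := @setlikeP (fun y => exists2 xi, D xi & y = oval xi).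
  by exists s => y [xi /sP h ->].
have ao : is_ordinal a.
  split.
    move=> y z zy /aP [xi Dxi yE]; move: zy; rewrite yE => /ord_mem [eta <- lt].
    by apply/aP; exists eta => //; apply: Ddown lt Dxi.
  by move=> y /aP [xi _ ->]; case: (ovalP xi).
exists (Ord ao) => xi; rewrite /olt /=; split; last by move=> h; apply/aP; exists xi.
by move/aP => [eta Deta /oval_inj ->].
Qed.

Lemma osetlike_lt alpha : osetlike (fun xi => olt xi alpha).
Proof. by exists (oval alpha). Qed.

Lemma osetlike_sub (K L : ord -> Prop) :
  osetlike K -> (forall xi, L xi -> K xi) -> osetlike L.
Proof. by move=> [s sP] LK; exists s => xi /LK /sP. Qed.

Lemma osetlike_or (K L : ord -> Prop) :
  osetlike K -> osetlike L -> osetlike (fun xi => K xi \/ L xi).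
Proof.
move=> [s sP] [t tP]; have [v vP] := setlike_or (setlike_mem s) (setlike_mem t).
by exists v => xi [/sP h|/tP h]; apply: vP; [left|right].
Qed.

Lemma osetlike1 xi : osetlike (fun eta => eta = xi).
Proof. by have [s sP] := setlike1 (oval xi); exists s => eta ->; apply: sP. Qed.

Lemma osetlike_le alpha : osetlike (fun xi => ole xi alpha).
Proof. exact: osetlike_or (osetlike_lt alpha) (osetlike1 alpha). Qed.

Lemma osetlike_bigcup (K : U -> Prop) (L : U -> ord -> Prop) :
  setlike K -> (forall x, K x -> osetlike (L x)) ->
  osetlike (fun xi => exists2 x, K x & L x xi).
Proof.
move=> setK setL.
have [|s sP] := @setlike_bigcup K (fun x y => exists2 xi, L x xi & y = oval xi) setK.
  by move=> x /setL [s sP]; exists s => y [xi /sP h ->].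
by exists s => xi [x Kx Lx]; apply: sP; exists x => //; exists xi.
Qed.

Lemma osup_set (K : U -> Prop) (h : U -> ord -> Prop) :
  setlike K -> (forall x, K x -> osetlike (h x)) ->
  exists alpha, forall xi, olt xi alpha <-> exists x eta, [/\ K x, h x eta & ole xi eta].
Proof.
move=> setK seth; apply: ord_of_class.
  have [|s sP] := @osetlike_bigcup K (fun x xi => exists2 eta, h x eta & ole xi eta) setK.
    move=> x Kx; have [t tP] := seth x Kx.
    have [| |s sP] := @osetlike_bigcup (fun y => y ∈ t) (fun y xi => exists2 eta, oval eta = y & ole xi eta).
    - exact: setlike_mem.
    - move=> y yt; have [[eta <-]|H] := EM (exists eta : ord, oval eta = y).
        have [s sP] := osetlike_le eta; exists s => xi [eta' /oval_inj ->]; exact: sP.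
      by exists t => xi [eta E _]; case: H; exists eta.
    - exists s => xi [eta heta le]; apply: sP; exists (oval eta); first exact: tP.
      by exists eta.
  by exists s => xi [x [eta [Kx hx le]]]; apply: sP; exists x => //; exists eta.
move=> xi eta lt [x [zeta [Kx hx le]]]; exists x, zeta; split=> //.
by left; exact: olt_le_trans lt le.
Qed.

Lemma olub_class (K : ord -> Prop) :
  osetlike K -> exists alpha, forall xi, olt xi alpha <-> exists2 eta, K eta & ole xi eta.
Proof.
move=> setK; have [s sP] := setK.
have [|alpha aP] := @osup_set (fun y => y ∈ s) (fun y xi => oval xi = y /\ K xi) (setlike_mem s).
  by move=> y ys; apply: osetlike_sub setK _ => xi [].
exists alpha => xi; rewrite aP; split.
  by move=> [x [eta [_ [_ Keta] le]]]; exists eta.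
by move=> [eta Keta le]; exists (oval eta), eta; split=> //; exact: sP.
Qed.

Lemma osetlike_image (h : ord -> ord) kappa :
  osetlike (fun xi => exists2 eta, olt eta kappa & xi = h eta).
Proof.
have [|s sP] := @osetlike_bigcup (fun y => y ∈ oval kappa)
    (fun y xi => exists2 eta, oval eta = y & xi = h eta) (setlike_mem _).
  move=> y /ord_mem [eta <- _]; have [s sP] := osetlike1 (h eta).
  by exists s => xi [eta' /oval_inj -> ->]; apply: sP.
exists s => xi [eta lt ->]; apply: sP; exists (oval eta) => //.
by exists eta.
Qed.

Lemma ozero_ex : exists xi : ord, is_zero xi.
Proof.
have [| |xi xP] := @ord_of_class (fun _ => False); last by exists xi => eta /xP.
  by have [w _] := @infinity_ax U; exists w.
by [].
Qed.

Definition ozero : ord := sval (cid ozero_ex).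

Lemma olt0 xi : ~ olt xi ozero.
Proof. rewrite /ozero; case: (cid ozero_ex) => z /= zP; exact: zP. Qed.

Lemma ole0x xi : ole ozero xi.
Proof. by apply/oleNgt; exact: olt0. Qed.

Lemma is_zeroE xi : is_zero xi <-> xi = ozero.
Proof.
split=> [z|-> eta]; last exact: olt0.
by apply: ord_ext => zeta; split=> [/z|/olt0].
Qed.

Lemma osuc_ex xi : exists eta, osucc xi eta.
Proof.
apply: ord_of_class; first exact: osetlike_le.
by move=> a b lt le; left; exact: olt_le_trans lt le.
Qed.

Definition osuc xi : ord := sval (cid (osuc_ex xi)).

Lemma olt_suc xi zeta : olt zeta (osuc xi) <-> ole zeta xi.
Proof. rewrite /osuc; case: (cid (osuc_ex xi)) => z /= zP; exact: zP. Qed.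

Lemma osuccE xi eta : osucc xi eta <-> eta = osuc xi.
Proof.
split=> [h|-> zeta]; last exact: olt_suc.
by apply: ord_ext => zeta; rewrite h olt_suc.
Qed.

Lemma osucc_suc xi : osucc xi (osuc xi). Proof. by apply/osuccE. Qed.

Lemma olt_sucx xi : olt xi (osuc xi). Proof. by apply/olt_suc; right. Qed.

Lemma ole_suc xi eta : ole (osuc xi) eta <-> olt xi eta.
Proof.
split=> [h|h]; first exact: olt_le_trans (olt_sucx xi) h.
by apply/oleNgt => /olt_suc /oleNgt nlt; exact: nlt.
Qed.

Lemma olt_suc2 xi eta : olt (osuc xi) (osuc eta) <-> olt xi eta.
Proof. by rewrite olt_suc ole_suc. Qed.

Lemma osuc_inj : injective osuc.
Proof.
move=> xi eta E; apply: ole_anti; apply/olt_suc; [rewrite -E|rewrite E]; exact: olt_sucx.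
Qed.

Lemma is_successorE xi : is_successor xi <-> exists eta, xi = osuc eta.
Proof. by split=> [[eta /osuccE h]|[eta h]]; exists eta => //; apply/osuccE. Qed.

Lemma succ_suc xi : is_successor (osuc xi).
Proof. by apply/is_successorE; exists xi. Qed.

Lemma nsucc_lt lam xi : ~ is_successor lam -> olt xi lam -> olt (osuc xi) lam.
Proof.
move=> ns lt; have /ole_suc [|E] // := lt.
by case: ns; rewrite -E; exact: succ_suc.
Qed.

Lemma ozero_nsucc : ~ is_successor ozero.
Proof.
by move=> /is_successorE [xi E]; apply: (@olt0 xi); rewrite E; exact: olt_sucx.
Qed.

Definition oadd xi (n : nat) : ord := iter n osuc xi.
Local Infix "+o" := oadd (at level 50, left associativity).

Lemma oadd_natE xi n eta : oadd_nat xi n eta <-> eta = xi +o n.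
Proof.
elim: n eta => [|n IH] eta //=; split.
  by move=> [zeta /IH -> /osuccE].
by move=> E; exists (xi +o n); [exact/IH|apply/osuccE].
Qed.

Lemma oadd_natI xi n : oadd_nat xi n (xi +o n). Proof. exact/oadd_natE. Qed.

Lemma oaddS xi n : xi +o n.+1 = osuc (xi +o n). Proof. by []. Qed.

Lemma oadd0 xi : xi +o 0 = xi. Proof. by []. Qed.

Lemma oaddSr xi n : osuc xi +o n = xi +o n.+1.
Proof. by rewrite /oadd iterSr. Qed.

Lemma oaddA xi m n : xi +o m +o n = xi +o (m + n).
Proof. by rewrite /oadd addnC iterD. Qed.

Lemma oadd_inj n : injective (oadd^~ n).
Proof. by elim: n => [|n IH] x y //= /osuc_inj; apply: IH. Qed.

Lemma ole_addr xi n : ole xi (xi +o n).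
Proof.
elim: n => [|n IH]; first exact: olexx.
by left; apply/olt_suc.
Qed.

Lemma ole_add2l xi m n : m <= n -> ole (xi +o m) (xi +o n).
Proof. by move=> /subnKC <-; rewrite -oaddA; exact: ole_addr. Qed.

Lemma olt_add2l xi m n : m < n -> olt (xi +o m) (xi +o n).
Proof. by move=> lt; apply/ole_suc; rewrite -oaddS; exact: ole_add2l. Qed.

Lemma oadd_injl xi m n : xi +o m = xi +o n -> m = n.
Proof.
move=> E; case: (ltngtP m n) => // /(olt_add2l xi); rewrite E => /oltxx //.
Qed.

Lemma olt_add2l_inv xi m n : olt (xi +o m) (xi +o n) -> m < n.
Proof.
by move=> lt; rewrite ltnNge; apply/negP => /(ole_add2l xi) /oleNgt.
Qed.

Lemma olt_addn xi eta n : olt xi eta -> olt (xi +o n) (eta +o n).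
Proof. by move=> lt; elim: n => [|n IH] //=; apply/olt_suc2. Qed.

Lemma ole_addn xi eta n : ole xi eta -> ole (xi +o n) (eta +o n).
Proof. by case=> [/olt_addn|->]; [left|right]. Qed.

Lemma nsucc_add lam xi n : ~ is_successor lam -> olt xi lam -> olt (xi +o n) lam.
Proof. by move=> ns lt; elim: n => [|n IH] //=; exact: nsucc_lt. Qed.

(** Together with [oadd_uniq] this splits the ordinals into blocks of type omega, each starting at a
    [lam] that is zero or a limit. As [interleave] acts inside each block, tapes are described block
    by block. *)
Lemma oadd_decomp xi : exists lam n, ~ is_successor lam /\ xi = lam +o n.
Proof.
elim/(well_founded_ind olt_wf): xi => xi IH.
have [/is_successorE [eta E]|ns] := EM (is_successor xi); last by exists xi, 0.
have [|lam [n [ns etaE]]] := IH eta; first by rewrite E; exact: olt_sucx.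
by exists lam, n.+1; rewrite E etaE.
Qed.

Lemma oadd_uniq lam m lam' n :
  ~ is_successor lam -> ~ is_successor lam' -> lam +o m = lam' +o n ->
  lam = lam' /\ m = n.
Proof.
move=> nl nl' E.
have lamE : lam = lam'.
  have aux : forall l l' m' n', ~ is_successor l' -> l +o m' = l' +o n' -> ~ olt l l'.
    move=> l l' m' n' ns E' /(nsucc_add m' ns); rewrite E' => lt.
    exact: oltxx (ole_lt_trans (ole_addr l' n') lt).
  case: (olt_total lam lam') => // h; first by case: (aux _ _ _ _ nl' E h).
  by case: (aux _ _ _ _ nl (esym E) h).
by split=> //; rewrite lamE in E; exact: oadd_injl E.
Qed.

Lemma nsucc_lt_add lam lam' m n :
  ~ is_successor lam -> ~ is_successor lam' ->
  olt (lam +o m) (lam' +o n) <-> olt lam lam' \/ (lam = lam' /\ m < n).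
Proof.
move=> ns ns'; split.
  move=> lt; case: (olt_total lam lam') => h; [by left| |].
    by right; split=> //; move: lt; rewrite h; exact: olt_add2l_inv.
  have := nsucc_add n ns h; move=> h'.
  by case: (@oltxx lam); exact: ole_lt_trans (ole_addr lam m) (olt_trans lt h').
move=> [lt|[-> lt]]; last exact: olt_add2l.
exact: olt_le_trans (nsucc_add m ns' lt) (ole_addr _ _).
Qed.

(** [lam] is the supremum of the iterates of [S] at [alpha], where [S mu] exceeds [mu] and all
    [F xi] with [xi] up to [mu]; so [F] may fail to be monotone. *)
Lemma closure_point (F : ord -> ord) alpha :
  exists lam, [/\ olt alpha lam, forall xi, olt xi lam -> olt (F xi) lam
               & ~ is_successor lam].
Proof.
have bnd mu : exists nu, [/\ olt mu nu & forall xi, ole xi mu -> olt (F xi) nu].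
  have [nu nuP] := olub_class (osetlike_or (osetlike1 mu) (osetlike_image F (osuc mu))).
  exists nu; split; first by apply/nuP; exists mu; [left|right].
  move=> xi le; apply/nuP; exists (F xi); last exact: olexx.
  by right; exists xi => //; apply/olt_suc.
have [S SP] := choice bnd.
pose s n := iter n S alpha.
have [w [[e [ew e0]] wS]] := @infinity_ax U.
have ws n : oval (ozero +o n) ∈ w.
  elim: n => [|n IH] /=.
    suff <- : e = oval ozero by [].
    by apply: extensionality_ax => z; split=> [/e0|] // /ord_mem [eta _ /olt0].
  have [y [yw yP]] := wS _ IH; suff <- : y = oval (osuc (ozero +o n)) by [].
  apply: extensionality_ax => z; rewrite yP; split.
    move=> [|->]; last exact: olt_sucx.
    move=> /ord_mem [eta <- lt]; apply/olt_suc; by left.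
  move=> /ord_mem [eta <-] /olt_suc [h|->]; [by left|by right].
have [|lam lamP] := @osup_set (fun y => y ∈ w)
    (fun y xi => exists n, y = oval (ozero +o n) /\ xi = s n) (setlike_mem _).
  move=> y _; have [[n ->]|H] := EM (exists n, y = oval (ozero +o n)).
    have [t tP] := osetlike1 (s n); exists t => xi [m [/oval_inj/oadd_injl <- ->]].
    exact: tP.
  by exists y => xi [n [E _]]; case: H; exists n.
have lamE xi : olt xi lam <-> exists n, ole xi (s n).
  rewrite lamP; split; first by move=> [x [eta [_ [n [_ ->]] le]]]; exists n.
  by move=> [n le]; exists (oval (ozero +o n)), (s n); split=> //; exists n.
exists lam; split.
- by apply/lamE; exists 0; exact: olexx.
- move=> xi /lamE [n le]; apply/lamE; exists n.+1; left.
  by have [_] := SP (s n); apply.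
- move=> /is_successorE [eta E].
  have /lamE [n le] : olt eta lam by rewrite E; exact: olt_sucx.
  have /lamP : olt (osuc eta) lam.
    apply/lamE; exists n.+1; apply/ole_suc; apply: (ole_lt_trans le).
    by have [] := SP (s n).
  by rewrite -lamP -E => /oltxx.
Qed.

End Ordinals.

Arguments ozero {U}.
Infix "+o" := oadd (at level 50, left associativity).

(** * Collapse, enumeration, pairing and hulls *)

(** The default [t0] makes the choice total, so that a recursion can be written down before its
    specification is shown to be satisfiable. *)
Definition pick_or (T : Type) (t0 : T) (Q : T -> Prop) : T :=
  if pselect (exists x, Q x) is left e then sval (cid e) else t0.

Lemma pick_orP (T : Type) (t0 : T) (Q : T -> Prop) : (exists x, Q x) -> Q (pick_or t0 Q).
Proof. by rewrite /pick_or => e; case: pselect => // e'; case: (cid e'). Qed.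

Lemma wf_recursion (T V : Type) (R : T -> T -> Prop)
    (F : forall t, (forall s, R s t -> V) -> V) :
  well_founded R -> exists f : T -> V, forall t, f t = F t (fun s _ => f s).
Proof.
move=> wfR; exists (Fix wfR (fun _ => V) F) => t.
apply: Fix_eq => x f g fg; congr (F x).
by apply: functional_extensionality_dep => y; apply: functional_extensionality_dep => r.
Qed.

(** [R a S] is read as: [a] codes the restriction of [S] to [K]. A relation allows codes to be given
    through witnesses, and some [a] may code nothing. The diagonal class consists of the [b] that
    belong to no class coded by [b]. *)
Lemma cantor (T : Type) (K : T -> Prop) (R : T -> (T -> Prop) -> Prop) :
  (forall a S S', K a -> R a S -> R a S' -> forall b, K b -> (S b <-> S' b)) ->
  (forall S, exists2 a, K a & R a S) -> False.
Proof.
move=> uniq surj.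
have [a Ka Ra] := surj (fun b => forall S, R b S -> ~ S b).
have [H|H] := EM (forall S, R a S -> ~ S a); first exact: (H _ Ra).
apply: (H) => S RS; have := uniq _ _ _ Ka Ra RS a Ka; tauto.
Qed.

Section Collapse.

Variable U : zfc_universe.
Local Notation ord := (ord U).
Implicit Types (xi eta zeta : ord).

(** Mostowski's collapse; transitivity of [R] makes the values ordinals. As [T] is any type, that
    initial segments are sets is stated for their images. Applied to pairs it yields the pairing
    function, applied to a hull the collapse of a computation. *)
Lemma collapse (T : Type) (R : T -> T -> Prop) :
  well_founded R -> (forall a b c, R a b -> R b c -> R a c) ->
  (forall t (h : T -> ord), osetlike (fun xi => exists2 s, R s t & xi = h s)) ->
  exists pi : T -> ord, forall t xi, olt xi (pi t) <-> exists2 s, R s t & xi = pi s.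
Proof.
move=> wfR trR setR.
have [pi piE] := @wf_recursion T ord R (fun t h => pick_or ozero
   (fun alpha => forall xi, olt xi alpha <-> exists s (r : R s t), xi = h s r)) wfR.
exists pi; elim/(well_founded_ind wfR) => t IH.
suff: exists alpha, forall xi, olt xi alpha <-> exists s (r : R s t), xi = pi s.
  move=> /(pick_orP ozero); rewrite -piE => H xi; rewrite H.
  by split=> [[s [r ->]]|[s r ->]]; exists s => //; exists r.
apply: ord_of_class.
  by apply: (osetlike_sub (setR t pi)) => xi [s [r ->]]; exists s.
move=> xi eta lt [s [r E]]; move: lt; rewrite E => /(IH s r) [s' r' ->].
by exists s'; exists (trR _ _ _ r' r).
Qed.

(** The well-ordering theorem: [f] takes a fresh element of [K] at each stage until none is left,
    which happens since otherwise [f] would inject all ordinals into a set. The element [x0] comes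
    first because a code of a set starts with the set itself. *)
Lemma enumeration (K : U -> Prop) (x0 : U) :
  setlike K -> K x0 -> exists alpha (f : ord -> U),
  [/\ forall xi, olt xi alpha -> K (f xi),
      forall xi eta, olt xi alpha -> olt eta alpha -> f xi = f eta -> xi = eta,
      forall y, K y -> exists2 xi, olt xi alpha & f xi = y,
      f ozero = x0 & olt ozero alpha].
Proof.
move=> setK Kx0.
have [f fE] := @wf_recursion ord U (@olt U) (fun xi h =>
  if pselect (xi = ozero) then x0
  else pick_or x0 (fun y => K y /\ forall eta (r : olt eta xi), h eta r <> y)) (@olt_wf U).
have f0 : f ozero = x0 by rewrite fE; case: pselect.
pose full xi := forall y, K y -> exists2 eta, olt eta xi & f eta = y.
have fresh xi : ~ full xi -> K (f xi) /\ forall eta, olt eta xi -> f eta <> f xi.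
  have [->|nz] := EM (xi = ozero); first by rewrite f0; split=> // eta /olt0.
  move=> nf; rewrite fE; case: pselect => // ?.
  have [|Ky ny] := @pick_orP U x0 (fun y => K y /\ forall eta (r : olt eta xi), f eta <> y).
    apply: contrapT => H; apply: nf => y Ky; apply: contrapT => H2.
    by apply: H; exists y; split=> // eta r E; apply: H2; exists eta.
  by split.
have inj xi eta : ~ full xi -> ~ full eta -> f xi = f eta -> xi = eta.
  move=> nx ne E; case: (olt_total xi eta) => // lt.
    by case: (fresh eta ne) => _ /(_ xi lt).
  by case: (fresh xi nx) => _ /(_ eta lt); rewrite E.
have [alpha fa amin] : exists2 alpha, full alpha & forall eta, full eta -> ole alpha eta.
  apply: olt_least; apply: contrapT => nfull.
  have nf xi : ~ full xi by move=> H; apply: nfull; exists xi.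
  have [| |omega oP] := @ord_of_class U (fun _ => True); last 1 first.
  - by apply: (@oltxx U omega); apply/oP.
  - have [|s sP] := @osetlike_bigcup U K (fun y xi => f xi = y) setK.
      move=> y _; have [[xi E]|H] := EM (exists xi, f xi = y).
        have [s sP] := osetlike1 xi; exists s => eta E'; apply: sP.
        by apply: inj => //; rewrite E.
      by have [w _] := @infinity_ax U; exists w => xi E; case: H; exists xi.
    by exists s => xi _; apply: sP; exists (f xi) => //; case: (fresh xi (nf xi)).
  - by [].
have nf xi : olt xi alpha -> ~ full xi by move=> lt /amin /oleNgt; apply.
exists alpha, f; split=> //.
- by move=> xi /nf /fresh [].
- by move=> xi eta /nf h /nf h'; exact: inj.
- by have [eta lt _] := fa _ Kx0; exact: ole_lt_trans (ole0x _) lt.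
Qed.

Definition omax xi eta : ord := if pselect (olt xi eta) then eta else xi.

Lemma omax_lt xi eta zeta : olt zeta (omax xi eta) <-> olt zeta xi \/ olt zeta eta.
Proof.
rewrite /omax; case: pselect => h; split; try tauto.
  by move=> [h'|//]; exact: olt_trans h' h.
by move=> [//|h']; exact: olt_le_trans h' (iffRL (oleNgt _ _) h).
Qed.

Lemma omax_ltr xi eta zeta : olt (omax xi eta) zeta <-> olt xi zeta /\ olt eta zeta.
Proof.
rewrite /omax; case: pselect => h; split; try tauto.
  by move=> h'; split=> //; exact: olt_trans h h'.
by move=> h'; split=> //; exact: ole_lt_trans (iffRL (oleNgt _ _) h) h'.
Qed.

Lemma omax_cases xi eta : omax xi eta = xi \/ omax xi eta = eta.
Proof. by rewrite /omax; case: pselect; [right|left]. Qed.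

Lemma ole_maxl xi eta : ole xi (omax xi eta).
Proof. by apply/oleNgt => /omax_ltr [/oltxx]. Qed.

Lemma ole_maxr xi eta : ole eta (omax xi eta).
Proof. by apply/oleNgt => /omax_ltr [_ /oltxx]. Qed.

Lemma max_ltE xi eta xi' eta' :
  max_lt xi eta xi' eta' <-> olt (omax xi eta) (omax xi' eta').
Proof. by rewrite omax_ltr !omax_lt. Qed.

Lemma pair_ltE xi eta xi' eta' :
  pair_lt xi eta xi' eta' <->
  olt (omax xi eta) (omax xi' eta') \/
  (omax xi eta = omax xi' eta' /\ (olt xi xi' \/ (xi = xi' /\ olt eta eta'))).
Proof.
rewrite /pair_lt !max_ltE; split; last first.
  by move=> [h|[-> h]]; [left|right; split=> //; exact: oltxx].
move=> [h|[h h']]; first by left.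
case: (olt_total (omax xi eta) (omax xi' eta')) => // E; [by left|by right].
Qed.

Let plt (a b : ord * ord) := pair_lt a.1 a.2 b.1 b.2.

Let plt_wf : well_founded plt.
Proof.
suff H m : forall xi eta, omax xi eta = m -> Acc plt (xi, eta) by case=> xi eta; exact: H.
elim/(well_founded_ind (@olt_wf U)): m => m IHm xi.
elim/(well_founded_ind (@olt_wf U)): xi => xi IHxi eta.
elim/(well_founded_ind (@olt_wf U)): eta => eta IHeta E.
constructor=> -[a b] /pair_ltE /= [lt|[E' [lt|[aE lt]]]].
- by apply: (IHm (omax a b)) => //; rewrite -E.
- by apply: IHxi => //; rewrite E'.
- by rewrite aE; apply: IHeta => //; rewrite -aE E'.
Qed.

Let plt_trans a b c : plt a b -> plt b c -> plt a c.
Proof.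
move=> /pair_ltE h /pair_ltE h'; apply/pair_ltE.
case: h h' => [l|[E l]] [l'|[E' l']].
- by left; exact: olt_trans l l'.
- by left; rewrite -E'.
- by left; rewrite E.
- right; split; first by rewrite E.
  case: l l' => [l|[e l]] [l'|[e' l']].
  + by left; exact: olt_trans l l'.
  + by left; rewrite -e'.
  + by left; rewrite e.
  + by right; split; [rewrite e|exact: olt_trans l l'].
Qed.

Let plt_total a b : [\/ plt a b, a = b | plt b a].
Proof.
case: a b => [a b] [c d].
case: (olt_total (omax a b) (omax c d)) => E.
- by apply: Or31; apply/pair_ltE; left.
- case: (olt_total a c) => Eac.
  + by apply: Or31; apply/pair_ltE; right; split=> //; left.
  + case: (olt_total b d) => Ebd.
    * by apply: Or31; apply/pair_ltE; right; split=> //; right.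
    * by apply: Or32; rewrite Eac Ebd.
    * by apply: Or33; apply/pair_ltE; right; split=> //; right.
  + by apply: Or33; apply/pair_ltE; right; split=> //; left.
- by apply: Or33; apply/pair_ltE; left.
Qed.

Lemma osetlike_image2 (h : ord -> ord -> ord) kappa :
  osetlike (fun xi => exists a b, [/\ olt a kappa, olt b kappa & xi = h a b]).
Proof.
have [|s sP] := @osetlike_bigcup U (fun y => y ∈ oval kappa)
    (fun y xi => exists a, oval a = y /\ exists2 b, olt b kappa & xi = h a b) (setlike_mem _).
  move=> y /ord_mem [a <- _]; apply: (osetlike_sub (osetlike_image (h a) kappa)) => xi.
  by move=> [a' [/oval_inj -> ?]].
exists s => xi [a [b [ha hb ->]]]; apply: sP; exists (oval a) => //.
by exists a; split=> //; exists b.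
Qed.

Lemma pairing_ex : exists p : ord -> ord -> ord, is_pairing p.
Proof.
have [|pi piP] := collapse plt_wf plt_trans.
  move=> t h; apply: (osetlike_sub (osetlike_image2 (fun a b => h (a, b)) (osuc (omax t.1 t.2)))).
  move=> xi [[a b] /pair_ltE /= lt ->]; exists a, b.
  have le : ole (omax a b) (omax t.1 t.2) by case: lt => [?|[-> _]]; [left|right].
  by split=> //; apply/olt_suc; apply: ole_trans le; [exact: ole_maxl|exact: ole_maxr].
have mono a b : plt a b -> olt (pi a) (pi b) by move=> h; apply/piP; exists a.
exists (fun a b => pi (a, b)); split=> [a b c d|zeta].
  split; last by move=> h; apply: mono.
  case: (plt_total (a, b) (c, d)) => // [-> /oltxx //|/mono h h'].
  by case: (@oltxx U (pi (a, b))); exact: olt_trans h' h.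
have ge xi : ole xi (pi (xi, ozero)).
  elim/(well_founded_ind (@olt_wf U)): xi => xi IH; apply/oleNgt => lt.
  have := IH _ lt; apply/oltNge; apply: mono; apply/pair_ltE; left.
  apply/omax_ltr; split; first by apply: olt_le_trans (ole_maxl _ _).
  by apply: ole_lt_trans (ole0x _) (olt_le_trans lt (ole_maxl _ _)).
have /piP [[a b] _ ->] : olt zeta (pi (osuc zeta, ozero)).
  by apply: olt_le_trans (olt_sucx zeta) (ge _).
by exists a, b.
Qed.

Definition opair : ord -> ord -> ord := sval (cid pairing_ex).

Lemma opairP : is_pairing opair.
Proof. by rewrite /opair; case: (cid pairing_ex). Qed.

Lemma opair_lt a b c d : olt (opair a b) (opair c d) <-> pair_lt a b c d.
Proof. by case: opairP => h _; apply: h. Qed.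

Lemma opair_surj zeta : exists a b, zeta = opair a b.
Proof. by case: opairP => _ /(_ zeta) [a [b <-]]; exists a, b. Qed.

Lemma opair_inj a b c d : opair a b = opair c d -> a = c /\ b = d.
Proof.
move=> E; case: (plt_total (a, b) (c, d)) => [/opair_lt|[-> ->]|/opair_lt] //=.
  by rewrite E => /oltxx.
by rewrite E => /oltxx.
Qed.

Lemma opair_block a b m : olt (opair a b) (opair ozero m) <-> olt (omax a b) m.
Proof.
have E : omax ozero m = m.
  by case: (omax_cases ozero m) => // E; apply: ole_anti; [rewrite E; exact: ole0x|exact: ole_maxr].
rewrite opair_lt pair_ltE E; split; last by left.
move=> [//|[E' [/olt0 //|[aE lt]]]]; move: E' lt; rewrite aE.
case: (omax_cases ozero b) => -> E'; last by rewrite E' => /oltxx.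
by rewrite -E' => /olt0.
Qed.

Lemma ole_block m : ole m (opair ozero m).
Proof.
elim/(well_founded_ind (@olt_wf U)): m => m IH; apply/oleNgt => lt.
have := IH _ lt; apply/oltNge; apply/opair_block; apply/omax_ltr; split=> //.
exact: ole_lt_trans (ole0x _) lt.
Qed.

Lemma opair_le_l a b : ole a (opair a b).
Proof.
apply: (ole_trans (ole_maxl a b)); apply: (ole_trans (ole_block _)).
by apply/oleNgt => /opair_block /oltxx.
Qed.

Lemma opair_le_r a b : ole b (opair a b).
Proof.
apply: (ole_trans (ole_maxr a b)); apply: (ole_trans (ole_block _)).
by apply/oleNgt => /opair_block /oltxx.
Qed.

Lemma opair_next a b c d : pair_lt a b c d ->
  (forall e f, pair_lt a b e f -> ~ pair_lt e f c d) -> opair c d = osuc (opair a b).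
Proof.
move=> lt nb; apply: ord_ext => zeta; rewrite olt_suc.
have [e [f ->]] := opair_surj zeta; rewrite opair_lt; split.
  by move=> h; apply/oleNgt; rewrite opair_lt => h'; exact: (nb e f).
by move=> le; apply/opair_lt; apply: ole_lt_trans le _; apply/opair_lt.
Qed.

(** These are the fixed points of [opair ozero]: the codes of pairs below such a [mu] are exactly
    the ordinals below [mu]. *)
Definition pclosed (mu : ord) := forall a b, olt a mu -> olt b mu -> olt (opair a b) mu.

Lemma pclosed_lt mu a b : pclosed mu -> olt (opair a b) mu <-> olt a mu /\ olt b mu.
Proof.
move=> pc; split; last by move=> [? ?]; exact: pc.
by move=> h; split; apply: ole_lt_trans h; [exact: opair_le_l|exact: opair_le_r].
Qed.

Lemma pclosed_block mu : pclosed mu -> opair ozero mu = mu.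
Proof.
move=> pc; apply: ord_ext => zeta; have [a [b ->]] := opair_surj zeta.
by rewrite opair_block omax_ltr; split=> [[]|/pclosed_lt]; [exact: pc|apply].
Qed.

Lemma pclosed_closure_point (F : ord -> ord) alpha :
  exists lam, [/\ olt alpha lam, forall xi, olt xi lam -> olt (F xi) lam,
                  ~ is_successor lam & pclosed lam].
Proof.
have [lam [h1 h2 h3]] := closure_point (fun xi => omax (F xi) (opair ozero (osuc xi))) alpha.
exists lam; split=> //; first by move=> xi /h2 /omax_ltr [].
move=> a b ha hb; have /h2 /omax_ltr [_] : olt (omax a b) lam by apply/omax_ltr.
by apply: olt_trans; apply/opair_block; exact: olt_sucx.
Qed.

End Collapse.

(** * Classes enumerated by the ordinals below [lam], and hulls *)

Section Small.

Variable U : zfc_universe.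
Local Notation ord := (ord U).
Implicit Types (xi eta zeta : ord).

Variable lam : ord.
Hypothesis lam_gt0 : olt ozero lam.
Hypothesis lam_ns : ~ is_successor lam.
Hypothesis lam_pc : pclosed lam.

Definition small (T : Type) (A : T -> Prop) : Prop :=
  exists g : ord -> T, forall x, A x -> exists2 eta, olt eta lam & g eta = x.

Lemma small_sub (T : Type) (A B : T -> Prop) : small A -> (forall x, B x -> A x) -> small B.
Proof. by move=> [g gP] BA; exists g => x /BA /gP. Qed.

Lemma small_lt : small (fun xi => olt xi lam).
Proof. by exists id => xi lt; exists xi. Qed.

Lemma small_image (S T : Type) (A : S -> Prop) (h : S -> T) :
  small A -> small (fun x => exists2 y, A y & x = h y).
Proof. by move=> [g gP]; exists (h \o g) => x [y /gP [eta lt <-] ->]; exists eta. Qed.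

Lemma small_pair (S T : Type) (A : S -> Prop) (B : T -> Prop) :
  small A -> small B -> small (fun x : S * T => A x.1 /\ B x.2).
Proof.
move=> [g gP] [h hP].
exists (fun zeta => let c := pick_or (ozero, ozero) (fun c => zeta = opair c.1 c.2) in (g c.1, h c.2)).
move=> [x y] [/= /gP [a ha <-] /hP [b hb <-]]; exists (opair a b); first exact: lam_pc.
have /= := @pick_orP _ (@ozero U, @ozero U) (fun c => opair a b = opair c.1 c.2).
have ex : exists c : ord * ord, opair a b = opair c.1 c.2 by exists (a, b).
by move=> /(_ ex) /opair_inj [<- <-].
Qed.

Lemma lt_nat n : olt (ozero +o n) lam.
Proof. exact: nsucc_add. Qed.

(** Names for the elements of a hull. The two numbers of a node select one of countably many
    relations; three arguments suffice for the relations that describe a computation. *)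
Inductive term := Leaf of ord | Node of nat & nat & term & term & term.

Fixpoint tcode (t : term) : ord :=
  match t with
  | Leaf xi => opair ozero xi
  | Node i j a b c => opair (osuc ozero) (opair (ozero +o i) (opair (ozero +o j)
      (opair (tcode a) (opair (tcode b) (tcode c)))))
  end.

Fixpoint tbelow (t : term) : Prop :=
  match t with
  | Leaf xi => olt xi lam
  | Node i j a b c => [/\ tbelow a, tbelow b & tbelow c]
  end.

Lemma tcode_inj : injective tcode.
Proof.
elim=> [xi|i j a IHa b IHb c IHc] [eta|i' j' a' b' c'] /=.
- by move=> /opair_inj [_ ->].
- move=> /opair_inj [E _]; case: (@olt0 U ozero); rewrite {2}E; exact: olt_sucx.
- move=> /opair_inj [E _]; case: (@olt0 U ozero); rewrite -{2}E; exact: olt_sucx.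
- move=> /opair_inj [_ /opair_inj [/oadd_injl <- /opair_inj [/oadd_injl <-]]].
  by move=> /opair_inj [/IHa <- /opair_inj [/IHb <- /IHc <-]].
Qed.

Lemma tcode_lt t : tbelow t -> olt (tcode t) lam.
Proof.
elim: t => [xi|i j a IHa b IHb c IHc] /=; first exact: lam_pc.
move=> [/IHa ha /IHb hb /IHc hc]; have h1 := lt_nat 1.
by do ?[apply: lam_pc] => //; exact: lt_nat.
Qed.

(* The hull is the class of values of terms with leaves below [lam]; pairing codes these terms below [lam]. *)
Lemma small_hull (Q : nat -> nat -> ord -> ord -> ord -> ord -> Prop) :
  exists H : ord -> Prop,
  [/\ small H, forall xi, olt xi lam -> H xi &
      forall i j a b c, H a -> H b -> H c -> (exists s, Q i j a b c s) ->
        exists2 s, H s & Q i j a b c s].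
Proof.
pose fix ev t := match t with Leaf xi => xi | Node i j a b c =>
   pick_or ozero (Q i j (ev a) (ev b) (ev c)) end.
exists (fun xi => exists2 t, tbelow t & xi = ev t); split.
- apply: small_image; exists (fun zeta => pick_or (Leaf ozero) (fun t => zeta = tcode t)).
  move=> t tb; exists (tcode t); first exact: tcode_lt.
  apply: tcode_inj; rewrite -(pick_orP (Leaf ozero) (Q := fun t' => tcode t = tcode t')) //.
  by exists t.
- by move=> xi lt; exists (Leaf xi).
- move=> i j _ _ _ [a ha ->] [b hb ->] [c hc ->] ex.
  exists (ev (Node i j a b c)); last exact: pick_orP.
  by exists (Node i j a b c).
Qed.

End Small.

(** * Halting computations on small inputs *)

Section Liminf.

Variable U : zfc_universe.
Local Notation ord := (ord U).
Implicit Types (r s t xi eta zeta : ord).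

Definition tail_values (T : Type) t (S : ord -> Prop) (f : ord -> T) r : T -> Prop :=
  fun v => exists s, [/\ ole r s, olt s t, S s & f s = v].

(** States, head positions and tape bits take their inferior limits in three different orders; this
    is what the orders have in common. *)
Record wellorder (T : Type) (le : T -> T -> Prop) : Prop := Wellorder {
  wo_refl : forall a, le a a;
  wo_trans : forall b a c, le a b -> le b c -> le a c;
  wo_anti : forall a b, le a b -> le b a -> a = b;
  wo_min : forall A : T -> Prop, (exists a, A a) -> exists m, is_min le A m }.

Lemma wo_total (T : Type) (le : T -> T -> Prop) a b : wellorder le -> le a b \/ le b a.
Proof.
move=> [_ _ _ /(_ (fun c => c = a \/ c = b))] [|m [mE H]]; first by exists a; left.
by case: mE => E; [left|right]; rewrite -E; apply: H; [right|left].
Qed.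

Lemma wo_nat : wellorder (fun m n : nat => m <= n).
Proof.
split=> [a|b a c|a b h h'|A [a Aa]]; [exact: leqnn|exact: leq_trans| |].
  by apply/eqP; rewrite eqn_leq h h'.
elim: a {-2}a (leqnn a) Aa => [|n IH] a an Aa.
  by exists a; split=> // b _; move: an; rewrite leqn0 => /eqP ->.
have [[b ba Ab]|H] := EM (exists2 b, b < a & A b); first by apply: (IH b) => //; lia.
exists a; split=> // b Ab; rewrite leqNgt; apply/negP => lt; apply: H.
by exists b.
Qed.

Lemma wo_bool : wellorder (fun c d : bool => c ==> d).
Proof.
split=> [[]|[] [] []|[] []|A [a Aa]] //.
have [Af|nAf] := EM (A false); first by exists false.
by exists a; split=> // -[] //; rewrite implybT.
Qed.

Lemma wo_ord : wellorder (@ole U).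
Proof.
split; [exact: olexx|exact: ole_trans|exact: ole_anti|].
by move=> A /olt_least [m Am H]; exists m.
Qed.

Variables (T : Type) (le : T -> T -> Prop).
Hypothesis wo : wellorder le.

Lemma liminf_cofinal t (S : ord -> Prop) (f : ord -> T) l v r0 :
  olt r0 t -> (forall s, ole r0 s -> olt s t -> S s -> le v (f s)) ->
  (forall r, olt r t -> exists s, [/\ ole r s, olt s t, S s & f s = v]) ->
  is_liminf le t S f l -> l = v.
Proof.
move=> r0t lo cof [up lub]; apply: (wo_anti wo).
  apply: lub => m [r rt [[s [rs st Ss sm]] mmin]].
  by have [s' [h1 h2 h3 <-]] := cof r rt; apply: mmin; exists s'.
apply: up; exists r0 => //; split; first exact: cof.
by move=> a [s [h1 h2 h3 <-]]; exact: lo.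
Qed.

Lemma liminf_const t (f : ord -> T) l v r0 :
  olt r0 t -> (forall s, ole r0 s -> olt s t -> f s = v) ->
  is_liminf le t (fun _ => True) f l -> l = v.
Proof.
move=> r0t H; apply: (liminf_cofinal (r0 := r0)) => // [s h1 h2 _|r rt].
  by rewrite H //; exact: (wo_refl wo).
case: (ole_or_lt r r0) => h; first by exists r0; split=> //; exact: H (olexx _) r0t.
by exists r; split=> //; [exact: olexx|apply: H => //; exact: oltW].
Qed.

(** The collapse [pi] of a hull [H] commutes with inferior limits, [g] being the induced map on
    values. Full elementarity of the hull is replaced by two demands: it contains a time attaining
    each tail minimum, and for each value [v] below [l] the start of a tail with minimum above [v].
    Then no tail minimum of the collapsed run exceeds [g l], and no smaller value bounds them
    all. *)
Lemma liminf_transfer (H : ord -> Prop) (pi : ord -> ord) (KT : T -> Prop) (g : T -> T)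
    t S f l S' f' l' :
  (forall xi eta, H xi -> H eta -> ole xi eta -> ole (pi xi) (pi eta)) ->
  (forall xi zeta, H xi -> (olt zeta (pi xi) <-> exists2 s, H s /\ olt s xi & zeta = pi s)) ->
  (forall a b, KT a -> KT b -> (le (g a) (g b) <-> le a b)) ->
  (forall b c, KT b -> le c (g b) -> exists2 a, KT a & c = g a) ->
  H t -> KT l ->
  (forall s, H s -> olt s t -> [/\ S s <-> S' (pi s), KT (f s) & f' (pi s) = g (f s)]) ->
  (forall r m, H r -> olt r t -> is_min le (tail_values t S f r) m ->
     exists s, [/\ H s, ole r s, olt s t, S s & f s = m]) ->
  (forall v, KT v -> ~ le l v -> exists r m, [/\ H r, olt r t,
     is_min le (tail_values t S f r) m & ~ le m v]) ->
  is_liminf le t S f l -> is_liminf le (pi t) S' f' l' -> l' = g l.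
Proof.
move=> pim piE gm gd Ht Kl HS Hmin Hlub [up lub].
have piI s : H s -> olt s t -> olt (pi s) (pi t) by move=> ? ?; apply/piE => //; exists s.
have piJ r s : H r -> H s -> ole (pi r) (pi s) -> ole r s.
  move=> Hr Hs /oleNgt h; apply/oleNgt => lt; apply: h.
  by apply/piE => //; exists s.
move=> [up' lub']; apply: (wo_anti wo).
  apply: lub' => m' [r' /(piE _ _ Ht) [r [Hr rt] ->] [[s' [rs s't Ss f's'] mmin']]].
  case/(piE _ _ Ht): (s't) => s [Hs st] sE; rewrite sE in rs Ss f's'.
  have [S1 S2 S3] := HS s Hs st.
  have [|m mm] := @wo_min _ _ wo (tail_values t S f r).
    by exists (f s), s; split=> //; [exact: piJ|exact/S1].
  have [s0 [Hs0 rs0 s0t Ss0 f0]] := Hmin r m Hr rt mm.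
  have [S10 S20 S30] := HS s0 Hs0 s0t.
  apply: (@wo_trans _ _ wo (g m)).
    apply: mmin'; exists (pi s0); split; [exact: pim|exact: piI|exact/S10|by rewrite S30 f0].
  apply/gm => //; first by rewrite -f0.
  by apply: up; exists r.
case: (wo_total (g l) l' wo) => // lel; apply: contrapT => nle.
have [a Ka aE] := gd _ _ Kl lel.
have [|r [m [Hr rt mm nm]]] := Hlub a Ka; first by rewrite -gm // -aE.
have [s0 [Hs0 rs0 s0t Ss0 f0]] := Hmin r m Hr rt mm.
have [S10 S20 S30] := HS s0 Hs0 s0t.
apply: nm; apply/gm => //; first by rewrite -f0.
rewrite -aE; apply: up'; exists (pi r); first exact: piI.
split; first by exists (pi s0); split; [exact: pim|exact: piI|exact/S10|rewrite S30 f0].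
move=> c [s' [rs /(piE _ _ Ht) [s [Hs st] sE] Ss <-]]; rewrite sE in rs Ss *.
have [S1 S2 S3] := HS s Hs st; rewrite S3; apply/gm => //; first by rewrite -f0.
by case: mm => _; apply; exists s; split=> //; [exact: piJ|exact/S1].
Qed.

End Liminf.

(** In contrast to [liminf_cofinal], the limit [h] need not be attained; head positions increase to
    the start of a new block in this way. *)
Lemma liminf_head (U : zfc_universe) (t : ord U) (S : ord U -> Prop) (f : ord U -> ord U) l h :
  (forall r, olt r t -> exists s, [/\ ole r s, olt s t, S s & ole (f s) h]) ->
  (forall x, olt x h -> exists2 r, olt r t &
     forall s, ole r s -> olt s t -> S s -> olt x (f s)) ->
  is_liminf (@ole U) t S f l -> l = h.
Proof.
move=> cof lo [up lub]; apply: ole_anti.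
  apply: lub => m [r rt [_ mmin]]; have [s [h1 h2 h3 h4]] := cof r rt.
  by apply: ole_trans h4; apply: mmin; exists s.
apply/oleNgt => /lo [r rt H].
have [s [h1 h2 h3 h4]] := cof r rt.
have [|m mm] := @wo_min _ _ (wo_ord U) (tail_values t S f r); first by exists (f s), s.
have /oleNgt := up m (ex_intro2 _ _ r rt mm); apply.
by case: mm => [[s' [a b c <-]] _]; exact: H.
Qed.

Lemma program_det (P : program) k k' : k \in val P -> k' \in val P ->
  cmd_state k = cmd_state k' -> cmd_read k = cmd_read k' -> k = k'.
Proof.
move=> kP k'P E1 E2; have /andP [_ /allP /(_ k kP) /allP /(_ k' k'P)] := valP P.
by rewrite E1 E2 !eqxx /= => /eqP.
Qed.

Section HaltingBound.

Variable U : zfc_universe.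
Local Notation ord := (ord U).
Implicit Types (r s t xi eta zeta : ord).

Lemma ord_cases t : [\/ t = ozero, exists s, t = osuc s | is_limit t].
Proof.
have [/is_zeroE z|nz] := EM (is_zero t); first by apply: Or31.
have [/is_successorE [s E]|ns] := EM (is_successor t); first by apply: Or32; exists s.
by apply: Or33.
Qed.

Variables (P : program) (X0 : oset U) (t1 : ord) (C : ord -> config U).
Hypothesis haltC : halting_computation P X0 t1 C.

Lemma unvisited_cell zeta t : ole t t1 ->
  (forall s, olt s t -> head_pos (C s) <> zeta) -> tape (C t) zeta <-> X0 zeta.
Proof.
have [C0 CS CL _] := haltC.
elim/(well_founded_ind (@olt_wf U)): t => t IH tt1 nv.
case: (ord_cases t) => [z|[s E]|lt].
- by have [|_ _ h] := C0 t; [apply/is_zeroE|apply: h].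
- have st : olt s t by rewrite E; exact: olt_sucx.
  have [|k [_ [_ _ _ h]]] := CS s t (olt_le_trans st tt1); first by apply/osuccE.
  rewrite h; last by move=> h'; apply: (nv s).
  apply: IH => //; first by left; exact: olt_le_trans st tt1.
  by move=> s' h'; apply: nv; exact: olt_trans h' st.
- have [_ _ tl] := CL t tt1 lt.
  have [nz _] := lt; have z : olt ozero t.
    by case: (ole0x t) => // E; case: nz; apply/is_zeroE.
  rewrite (liminf_const wo_bool z _ (tl zeta) (v := tape (C ozero) zeta)).
    by have [|_ _ h] := C0 ozero; [apply/is_zeroE|apply: h].
  move=> s _ st; have e s' : olt s' t -> tape (C s') zeta <-> X0 zeta.
    move=> h; apply: IH => //; first by left; exact: olt_le_trans h tt1.
    by move=> s'' h'; apply: nv; exact: olt_trans h' h.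
  have e1 := e _ st; have e2 := e _ z.
  by apply/idP/idP => [/e1 h|/e2 h]; [apply/e2|apply/e1].
Qed.

Variable lam : ord.
Hypothesis lam_gt0 : olt ozero lam.
Hypothesis lam_ns : ~ is_successor lam.
Hypothesis lam_pc : pclosed lam.
Variable I : ord -> Prop.
Hypothesis I_down : forall xi eta, olt xi eta -> I eta -> I xi.
Hypothesis I_small : small lam I.
Hypothesis X0I : forall zeta, X0 zeta -> I zeta.

Let cstate t := state (C t).
Let chead t := head_pos (C t).
Let ctape xi t := tape (C t) xi.
Let same t := fun s => state (C s) = state (C t).
Let nle := fun m n : nat => m <= n.
Let ble := fun c d : bool => c ==> d.
Let yes := fun _ : ord => True.

Definition attains (T : Type) (le : T -> T -> Prop) (S : ord -> Prop) (f : ord -> T) r t s :=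
  [/\ ole r s, olt s t, S s & is_min le (tail_values t S f r) (f s)].

Definition exceeds (T : Type) (le : T -> T -> Prop) (S : ord -> Prop) (f : ord -> T) v t r :=
  olt r t /\ exists2 m, is_min le (tail_values t S f r) m & ~ le m v.

Lemma exceedsP (T : Type) (le : T -> T -> Prop) S (f : ord -> T) v t l :
  wellorder le -> is_liminf le t S f l -> ~ le l v -> exists r, exceeds le S f v t r.
Proof.
move=> wo [_ lub] nle'; apply: contrapT => H; apply: nle'; apply: lub => m [r rt mm].
by apply: contrapT => nm; apply: H; exists r; split=> //; exists m.
Qed.

(** The closure conditions on the hull. Kinds 0 to 4 provide the input, the halting time and single
    steps. Kinds 5, 7, 9 provide the attained tail minima and 6, 8, 10 the tails with large minimum
    that [liminf_transfer] needs for states, head positions and cells. A state or bit serving as a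
    bound is passed as the number [j]. *)
Let Q (g : ord -> ord) (i j : nat) (a b c s : ord) : Prop :=
  match i with
  | 0 => s = g a
  | 1 => s = t1
  | 2 => a = osuc s
  | 3 => s = osuc a
  | 4 => s = chead a
  | 5 => attains nle yes cstate a b s
  | 6 => exceeds nle yes cstate j a s
  | 7 => attains (@ole U) (same b) chead a b s
  | 8 => exceeds (@ole U) (same a) chead b a s
  | 9 => attains ble yes (ctape c) a b s
  | _ => exceeds ble yes (ctape b) (j == 1) a s
  end.

(* With a small hull [H] of the input closed under the functions and witnesses in [Q], and its collapse [pi],
   the configuration at time [pi t] is the image under [pi] of the one at time [t], for [t] in [H]. *)
Lemma halting_small zeta :
  tape (C t1) zeta -> small lam (fun xi => ole xi zeta).
Proof.
move=> tz.
have Xsmall : X0 zeta -> small lam (fun xi => ole xi zeta).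
  move=> /X0I Iz; apply: (small_sub I_small) => xi [lt|-> //]; exact: I_down lt Iz.
(* A bit in a cell that is never visited comes from the input, so from here on [zeta] is visited at
   some time [t] before [t1]. *)
have [[t tt1 headt]|nv] := EM (exists2 s, olt s t1 & head_pos (C s) = zeta); last first.
  apply: Xsmall; apply/(unvisited_cell (olexx t1)) => // s st E; apply: nv.
  by exists s.
have [C0 CS CL fin] := haltC.
have [g gP] := I_small.
have [H [Hsmall Hlam Hcl]] := small_hull lam_gt0 lam_ns lam_pc (Q g).
have H0 : H ozero by exact: Hlam.
have IH_ xi : I xi -> H xi.
  move=> /gP [eta lt <-].
  by have [|s Hs <-] := Hcl 0 0 eta ozero ozero (Hlam _ lt) H0 H0; first by exists (g eta).
have Ht1 : H t1.
  by have [|s Hs <-] := Hcl 1 0 ozero ozero ozero H0 H0 H0; first by exists t1.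
have Hpred s : H (osuc s) -> H s.
  move=> h; have [|s' Hs /= /osuc_inj -> //] := Hcl 2 0 _ ozero ozero h H0 H0.
  by exists s.
have Hsuc s : H s -> H (osuc s).
  move=> h; have [|s' Hs' <- //] := Hcl 3 0 _ ozero ozero h H0 H0.
  by exists (osuc s).
have Hhead s : H s -> H (chead s).
  move=> h; have [|s' Hs' <- //] := Hcl 4 0 _ ozero ozero h H0 H0.
  by exists (chead s).
have [| | |pi piE0] := @collapse U ord (fun a b => H a /\ olt a b).
- by elim/(well_founded_ind (@olt_wf U)) => a IH; constructor=> b [_ /IH].
- by move=> a b c [Ha ab] [Hb bc]; split=> //; exact: olt_trans ab bc.
- move=> s h; apply: osetlike_sub (osetlike_image h s) _ => xi [eta [_ lt] ->].
  by exists eta.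
have piE xi z : H xi -> (olt z (pi xi) <-> exists2 s, H s /\ olt s xi & z = pi s).
  by move=> _; exact: piE0.
have pi_lt s s' : H s -> olt s s' -> olt (pi s) (pi s') by move=> h1 h2; apply/piE0; exists s.
have pi_le s s' : H s -> H s' -> ole s s' -> ole (pi s) (pi s').
  by move=> h1 h2 [lt|->]; [left; exact: pi_lt|right].
have pi_inj s s' : H s -> H s' -> pi s = pi s' -> s = s'.
  move=> h h' E; case: (olt_total s s') => // lt.
    by have := pi_lt _ _ h lt; rewrite E => /oltxx.
  by have := pi_lt _ _ h' lt; rewrite E => /oltxx.
have pi_leE s s' : H s -> H s' -> ole (pi s) (pi s') <-> ole s s'.
  move=> h h'; split; last exact: pi_le.
  by move=> /oleNgt nl; apply/oleNgt => lt; apply: nl; exact: pi_lt.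
have pi_down s : ole (pi s) s.
  elim/(well_founded_ind (@olt_wf U)): s => s IH; apply/oleNgt => /piE0 [s' [Hs' lt] E].
  by have := IH _ lt; rewrite -E => /oleNgt.
have pi_id xi : I xi -> pi xi = xi.
  elim/(well_founded_ind (@olt_wf U)): xi => xi IH Ixi; apply: ord_ext => z.
  rewrite piE0; split; first by move=> [s [_ lt] ->]; rewrite IH //; exact: I_down lt Ixi.
  move=> lt; have Iz := I_down lt Ixi; exists z; last by rewrite IH.
  by split=> //; exact: IH_.
have pi_0 : pi ozero = ozero.
  by apply: ole_anti; [exact: pi_down|exact: ole0x].
have pi_S s : H s -> pi (osuc s) = osuc (pi s).
  move=> Hs; apply: ord_ext => z; rewrite piE0 olt_suc; split.
    by move=> [s' [Hs' /olt_suc le] ->]; exact: pi_le.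
  move=> [/piE0 [s' [Hs' lt] ->]|->]; last by exists s => //; split=> //; exact: olt_sucx.
  by exists s' => //; split=> //; exact: olt_trans lt (olt_sucx s).
have pi_nS s : H s -> ~ is_successor s -> ~ is_successor (pi s).
  move=> Hs ns /is_successorE [z E].
  have /piE0 [s' [Hs' lt] zE] : olt z (pi s) by rewrite E; exact: olt_sucx.
  have := pi_lt _ _ (Hsuc _ Hs') (nsucc_lt ns lt).
  by rewrite pi_S // E -zE => /oltxx.
have inv t' : H t' -> ole t' t1 ->
    [/\ state (C (pi t')) = state (C t'), head_pos (C (pi t')) = pi (head_pos (C t'))
      & forall xi, H xi -> tape (C (pi t')) (pi xi) = tape (C t') xi].
  elim/(well_founded_ind (@olt_wf U)): t' => t' IH Ht' t't1.
  case: (ord_cases t') => [z|[s E]|lt].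
  - rewrite z pi_0; have [|_ /is_zeroE -> h] := C0 ozero; first by apply/is_zeroE.
    rewrite /tape_is in h; split=> // xi Hxi; apply/idP/idP.
    + move/h => Xp; apply/h; suff <- : pi xi = xi by [].
      have := pi_id _ (X0I Xp); move: (X0I Xp) => /IH_ Hp Ep.
      by apply: pi_inj.
    + by move/h => Xx; rewrite pi_id; [apply/h|exact: X0I].
  - have Hs : H s by apply: Hpred; rewrite -E.
    have st : olt s t' by rewrite E; exact: olt_sucx.
    have st1 : olt s t1 by exact: olt_le_trans st t't1.
    have [e1 e2 e3] := IH s st Hs (oltW st1).
    have [|k [[kP kst krd] [k1 k2 k3 k4]]] := CS s t' st1; first by apply/osuccE.
    have [| |k' [[kP' kst' krd'] [k1' k2' k3' k4']]] := CS (pi s) (pi t').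
    + exact: ole_lt_trans (pi_down s) st1.
    + by rewrite E pi_S //; exact: osucc_suc.
    have Hh := Hhead _ Hs; have Hh' := Hhead _ Ht'.
    have kE : k' = k.
      apply: (program_det kP' kP); first by rewrite kst' kst.
      by rewrite krd' krd e2 e3.
    rewrite {}kE in kP' kst' krd' k1' k2' k3' k4'.
    split; first by rewrite k1' k1.
    + move: k2 k2'; rewrite /move_head e2; case: (cmd_right k).
        by move=> /osuccE -> /osuccE ->; rewrite pi_S.
      rewrite /chead in Hh Hh'.
      move=> [/osuccE hE|[ns /is_zeroE ->]].
        rewrite hE pi_S // => -[/osuccE /osuc_inj -> //|[ns]].
        by case: ns; exact: succ_suc.
      move=> [/osuccE hE|[_ /is_zeroE ->]]; last by rewrite pi_0.
      by case: (pi_nS _ Hh ns); apply/is_successorE; exists (head_pos (C (pi t'))).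
    + move=> xi Hxi; have [->|ne] := EM (xi = head_pos (C s)).
        by rewrite -e2 k3' k3.
      rewrite k4 // k4' ?e3 // e2 => /pi_inj E'.
      by apply: ne; apply: E'.
  - have lt' : is_limit (pi t').
      split; last by apply: pi_nS => //; case: lt.
      case: lt => nz _ /(_ ozero) z; apply: z; rewrite -pi_0; apply: pi_lt => //.
      by case: (ole0x t') => // E; case: nz; apply/is_zeroE.
    have [sl hl tl] := CL t' t't1 lt.
    have [sl' hl' tl'] := CL (pi t') (ole_trans (pi_down t') t't1) lt'.
    have IH' s : H s -> olt s t' -> _ := fun Hs st => IH s st Hs (oltW (olt_le_trans st t't1)).
    have eS : state (C (pi t')) = state (C t').
      apply: (liminf_transfer (H := H) (KT := fun _ => True) (g := id) wo_nat pi_le piE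
        _ _ Ht' _ _ _ _ sl sl') => //.
      + by move=> b c _ _; exists c.
      + by move=> s Hs /(IH' s Hs) [e1 _ _].
      + move=> r m Hr rt [[s [h1 h2 h3 h4]] h5].
        have [|s' Hs' [q1 q2 q3 q4]] := Hcl 5 0 r t' ozero Hr Ht' H0.
          by exists s; split=> //; rewrite /cstate h4; split=> //; exists s.
        exists s'; split=> //; apply: (wo_anti wo_nat); last first.
          by apply: h5; exists s'.
        by case: q4 => _; apply; exists s.
      + move=> v _ nv; have [r [rt [m mm nm]]] := exceedsP wo_nat sl nv.
        have [|r' Hr' [q1 [m' q2 q3]]] := Hcl 6 v t' ozero ozero Ht' H0 H0.
          by exists r; split=> //; exists m.
        by exists r', m'.
    split=> //.
    + apply: (liminf_transfer (H := H) (KT := H) (g := pi) (wo_ord U) pi_le piE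
        pi_leE _ Ht' _ _ _ _ hl hl').
      * move=> b c Hb [/piE0 [s [Hs _] ->]|->]; first by exists s.
        by exists b.
      * exact: Hhead.
      * move=> s Hs st; have [e1 e2 e3] := IH' s Hs st; split; [by rewrite e1 eS|exact: Hhead|exact: e2].
      * move=> r m Hr rt [[s [h1 h2 h3 h4]] h5].
        have [|s' Hs' [q1 q2 q3 q4]] := Hcl 7 0 r t' ozero Hr Ht' H0.
          by exists s; split=> //; rewrite /chead h4; split=> //; exists s.
        exists s'; split=> //; apply: ole_anti; last by apply: h5; exists s'.
        by case: q4 => _; apply; exists s.
      * move=> v Hv nv; have [r [rt [m mm nm]]] := exceedsP (wo_ord U) hl nv.
        have [|r' Hr' [q1 [m' q2 q3]]] := Hcl 8 0 t' v ozero Ht' Hv H0.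
          by exists r; split=> //; exists m.
        by exists r', m'.
    + move=> xi Hxi.
      apply: (liminf_transfer (H := H) (KT := fun _ => True) (g := id) wo_bool pi_le piE
        _ _ Ht' _ _ _ _ (tl xi) (tl' (pi xi))) => //.
      * by move=> b c _ _; exists c.
      * by move=> s Hs /(IH' s Hs) [_ _ e3]; split=> //; exact: e3.
      * move=> r m Hr rt [[s [h1 h2 h3 h4]] h5].
        have [|s' Hs' [q1 q2 q3 q4]] := Hcl 9 0 r t' xi Hr Ht' Hxi.
          by exists s; split=> //; rewrite /ctape h4; split=> //; exists s.
        exists s'; split=> //; apply: (wo_anti wo_bool); last by apply: h5; exists s'.
        by case: q4 => _; apply; exists s.
      * move=> v _ nv; have [r [rt [m mm nm]]] := exceedsP wo_bool (tl xi) nv.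
        have [|r' Hr' [q1 [m' q2 q3]]] := Hcl 10 v t' xi ozero Ht' Hxi H0.
          by exists r; split=> //; exists m => //; case: (v) nm.
        by exists r', m'; split=> //; case: (v) q3.
(* A step is due at each time before [t1], but at time [pi t1] the state is the halting state of
   time [t1]; hence [pi t1] is not earlier. *)
have pit1 : pi t1 = t1.
  case: (pi_down t1) => // lt.
  have [|k [[kP kst _] _]] := CS (pi t1) (osuc (pi t1)) lt; first exact: osucc_suc.
  have [e1 _ _] := inv t1 Ht1 (olexx _).
  by move: fin; rewrite -e1 -kst map_f.
(* Now every time before [t1] is the collapse of a time in the hull. So [zeta] is the collapse of a
   head position, and the ordinals up to it are collapses of hull elements. *)
move: tt1; rewrite -{1}pit1 => /piE0 [h [Hh ht1] tE].
have [_ e2 _] := inv h Hh (oltW ht1).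
have zE : zeta = pi (chead h) by rewrite -headt tE e2.
apply: (small_sub (small_image pi Hsmall)) => xi le.
have : olt xi (pi (osuc (chead h))).
  by rewrite pi_S; [apply/olt_suc; rewrite -zE|exact: Hhead].
by move=> /piE0 [s [Hs _] ->]; exists s.
Qed.

End HaltingBound.

(** * Codes of sets *)

Section Codes.

Variable U : zfc_universe.
Local Notation ord := (ord U).
Implicit Types (xi eta zeta lam mu : ord) (X Y : oset U) (x y z : U).

Lemma interleave_at (Xs : seq (oset U)) lam n i : ~ is_successor lam -> i < size Xs ->
  interleave Xs (lam +o (size Xs * n + i)) <-> nth (oempty (U := U)) Xs i (lam +o n).
Proof.
move=> ns ilt; split; last first.
  by move=> h; exists lam, (lam +o n), n, i; split=> //; exact: oadd_natI.
move=> [lam' [xi [m [j [ns' /oadd_natE -> jlt /oadd_natE E h]]]]].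
have [lamE nE] := oadd_uniq ns ns' E; subst lam'.
have nm : n = m by case: (ltngtP n m) => // lt; nia.
by move: nE h; rewrite nm => /addnI ->.
Qed.

Lemma interleaveP (Xs : seq (oset U)) zeta : interleave Xs zeta ->
  exists lam n i, [/\ ~ is_successor lam, i < size Xs, zeta = lam +o (size Xs * n + i) &
    nth (oempty (U := U)) Xs i (lam +o n)].
Proof.
move=> [lam [xi [n [i [ns /oadd_natE -> ilt /oadd_natE E h]]]]].
by exists lam, n, i.
Qed.

Lemma interleave_above (Xs : seq (oset U)) i xi : i < size Xs ->
  nth (oempty (U := U)) Xs i xi -> exists2 zeta, interleave Xs zeta & ole xi zeta.
Proof.
move=> ilt; have [lam [n [ns ->]]] := oadd_decomp xi => h.
exists (lam +o (size Xs * n + i)); first exact/interleave_at.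
by apply: ole_add2l; nia.
Qed.

(** Interleaving moves a bit only within its block, so bounds on tape contents are stated up to
    adding a finite number. *)
Definition near_below mu : oset U := fun xi => exists n, ole xi (mu +o n).

Lemma near_below_down mu xi eta : olt xi eta -> near_below mu eta -> near_below mu xi.
Proof. by move=> lt [n le]; exists n; left; exact: olt_le_trans lt le. Qed.

Lemma near_below_add mu xi n : near_below mu xi -> near_below mu (xi +o n).
Proof. by move=> [m le]; exists (m + n); rewrite -oaddA; exact: ole_addn. Qed.

Lemma near_below_le mu nu xi : ole mu nu -> near_below mu xi -> near_below nu xi.
Proof. by move=> le [n h]; exists n; apply: (ole_trans h); exact: ole_addn. Qed.

Lemma near_below_interleave mu (Xs : seq (oset U)) :
  (forall i xi, i < size Xs -> nth (oempty (U := U)) Xs i xi -> near_below mu xi) ->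
  forall zeta, interleave Xs zeta -> near_below mu zeta.
Proof.
move=> H zeta /interleaveP [lam [n [i [ns ilt -> h]]]].
apply: near_below_add; have := H _ _ ilt h.
by move=> [m le]; exists m; exact: ole_trans (ole_addr _ _) le.
Qed.

Lemma tc_refl x : tc_with x x.
Proof. exact: rt_refl. Qed.

Lemma tc_mem x y z : tc_with x y -> z ∈ y -> tc_with x z.
Proof. by move=> h h'; apply: rt_trans h; apply: rt_step. Qed.

Lemma tc_sub x (K : U -> Prop) : K x -> (forall y z, K y -> z ∈ y -> K z) ->
  forall y, tc_with x y -> K y.
Proof.
move=> Kx Kmem y h; elim: {y x} h Kx => // [y z h|x y z _ IH1 _ IH2] Kz; first exact: Kmem h.
by apply: IH1; exact: IH2.
Qed.

Lemma tc_cases x y : tc_with x y -> y = x \/ exists2 z, z ∈ x & tc_with z y.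
Proof.
move: y; apply: tc_sub; first by left.
move=> y z [->|[z' h h']] zy; right; first by exists z => //; exact: tc_refl.
by exists z' => //; exact: tc_mem h' zy.
Qed.

Lemma tc_setlike x : setlike (tc_with x).
Proof.
elim/(well_founded_ind (@foundation_ax U)): x => x IH.
have := setlike_or (setlike1 x) (setlike_bigcup (setlike_mem x) IH).
by move=> /setlike_sub; apply => y /tc_cases.
Qed.

Lemma enumerates_ex x : exists alpha f, enumerates_tc x alpha f.
Proof.
have [alpha [f [h1 h2 h3 h4 _]]] := enumeration (tc_setlike x) (tc_refl x).
by exists alpha, f; split=> // xi /is_zeroE ->.
Qed.

Definition code_of alpha (f : ord -> U) : oset U :=
  interleave [:: osingle alpha; membership_code (@opair U) alpha f].

Lemma code_ofP x alpha f : enumerates_tc x alpha f -> is_code (code_of alpha f) x.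
Proof. by move=> e; exists (@opair U), alpha, f; split=> //; exact: opairP. Qed.

Lemma coded_ex x : exists c : coded_set U, cset c = x.
Proof.
have [alpha [f e]] := enumerates_ex x.
by exists (CodedSet (code_ofP e)).
Qed.

Lemma code_of_near alpha f zeta : code_of alpha f zeta -> near_below (opair alpha alpha) zeta.
Proof.
apply: near_below_interleave => -[|[|]] //= xi _.
  by move=> ->; exists 0; exact: opair_le_l.
move=> [a [b [ha hb _ <-]]]; exists 0; left; apply/opair_lt/pair_ltE; left.
by apply/omax_ltr; split; [apply: olt_le_trans ha _|apply: olt_le_trans hb _]; exact: ole_maxl.
Qed.

Section Bounds.

Variable lam : ord.
Hypothesis lam_gt0 : olt ozero lam.
Hypothesis lam_ns : ~ is_successor lam.
Hypothesis lam_pc : pclosed lam.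

Definition small_ord xi := small lam (fun eta => ole eta xi).

Lemma small1 (T : Type) (a : T) : small lam (fun b => b = a).
Proof. by exists (fun _ => a) => b ->; exists ozero. Qed.

Lemma small_or (T : Type) (A B : T -> Prop) :
  small lam A -> small lam B -> small lam (fun a : T => A a \/ B a).
Proof.
move=> [g gP] [h hP].
have := small_image (fun c : bool * (ord * ord) => if c.1 then g c.2.1 else h c.2.2)
  (small_pair lam_pc (A := fun _ => True) _ (small_pair lam_pc (small_lt lam) (small_lt lam))).
move=> /(_ _) H; apply: small_sub (H _) _.
  exists (fun xi => `[< xi = ozero >]) => b _; exists (if b then ozero else osuc ozero).
    by case: b => //; exact: nsucc_lt.
  by apply/asboolP; case: b => // /= E; apply: (@olt0 U ozero); rewrite -{2}E; exact: olt_sucx.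
move=> x [/gP [eta lt <-]|/hP [eta lt <-]].
  by exists (true, (eta, ozero)).
by exists (false, (ozero, eta)).
Qed.

Lemma small_ord_le xi eta : ole xi eta -> small_ord eta -> small_ord xi.
Proof. by move=> le /small_sub; apply => zeta h; exact: ole_trans h le. Qed.

Lemma small_ord_max xi eta : small_ord xi -> small_ord eta -> small_ord (omax xi eta).
Proof. by case: (omax_cases xi eta) => ->. Qed.

Lemma small_ord_lam : small_ord lam.
Proof. exact: small_or (small_lt lam) (small1 lam). Qed.

Lemma small_near mu : small_ord mu -> small lam (near_below mu).
Proof.
move=> [g gP].
have [H [Hs Hlam Hcl]] := small_hull lam_gt0 lam_ns lam_pc
  (fun i _ a _ _ s => if i is 0 then s = g a else s = osuc a).
have H0 := Hlam _ lam_gt0.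
have Hmu xi : ole xi mu -> H xi.
  move=> /gP [eta lt <-].
  by have [|s hs <-] := Hcl 0 0 eta ozero ozero (Hlam _ lt) H0 H0; first by exists (g eta).
apply: (small_sub Hs) => xi [n]; elim: n xi => [|n IH] xi //=; first exact: Hmu.
case=> [/olt_suc|->]; first exact: IH.
have Hn : H (mu +o n) by apply: IH; exact: olexx.
by have [|s hs <-] := Hcl 1 0 _ ozero ozero Hn H0 H0; first by exists (osuc (mu +o n)).
Qed.

Lemma small_opair alpha : small_ord alpha -> small_ord (opair alpha alpha).
Proof.
move=> sa; have := small_image (fun c : ord * ord => opair c.1 c.2) (small_pair lam_pc sa sa).
move=> /small_sub; apply => zeta; have [a [b ->]] := opair_surj zeta => le.
exists (a, b) => //=.
have : ole (omax a b) (omax alpha alpha).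
  by case: le => [/opair_lt/pair_ltE [?|[-> _]]|/opair_inj [-> ->]]; [left|right|right].
have -> : omax alpha alpha = alpha by case: (omax_cases alpha alpha).
by move=> h; split; [exact: ole_trans (ole_maxl a b) h|exact: ole_trans (ole_maxr a b) h].
Qed.

Definition bounded X := exists2 mu, small_ord mu & forall xi, X xi -> near_below mu xi.

Lemma bounded_interleave (Xs : seq (oset U)) :
  (forall i, i < size Xs -> bounded (nth (oempty (U := U)) Xs i)) -> bounded (interleave Xs).
Proof.
move=> H.
suff [mu smu muP] : exists2 mu, small_ord mu &
    forall i xi, i < size Xs -> nth (oempty (U := U)) Xs i xi -> near_below mu xi.
  by exists mu => //; exact: near_below_interleave.
elim: Xs H => [|X Xs IH] H; first by exists lam => //; exact: small_ord_lam.
have [|mu smu muP] := IH; first by move=> i ilt; exact: (H i.+1).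
have [nu snu nuP] := H 0 isT.
exists (omax mu nu); first exact: small_ord_max.
move=> [|i] xi /= ilt h; first exact: near_below_le (ole_maxr _ _) (nuP _ h).
exact: near_below_le (ole_maxl _ _) (muP i xi ilt h).
Qed.

Lemma bounded_single alpha : small_ord alpha -> bounded (osingle alpha).
Proof. by exists alpha => // xi ->; exists 0; exact: olexx. Qed.

Lemma bounded_empty : bounded (oempty (U := U)).
Proof. by exists lam => //; exact: small_ord_lam. Qed.

Lemma computes_small (P : program) X Y : bounded X -> computes P X Y ->
  forall zeta, Y zeta -> small_ord zeta.
Proof.
move=> bX [t1 [C [hC [X' [W fin]]]]] zeta Yz.
have [mu smu muP] : bounded (interleave [:: X; oempty (U := U); oempty (U := U)]).
  by apply: bounded_interleave => -[|[|[|]]] //= _; exact: bounded_empty.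
have [zeta' /fin tz le] := @interleave_above [:: X'; W; Y] 2 zeta isT Yz.
apply: small_ord_le le _.
by apply: (halting_small hC lam_gt0 lam_ns lam_pc (@near_below_down mu) (small_near smu) muP tz).
Qed.

Lemma tc_small_bounded x alpha f : enumerates_tc x alpha f -> small lam (tc_with x) ->
  bounded (code_of alpha f).
Proof.
move=> [h1 h2 h3 h4] sm; exists (opair alpha alpha); last exact: code_of_near.
apply: small_opair.
suff s : small lam (fun xi => olt xi alpha) by exact: small_or s (small1 alpha).
have := small_image (fun y => pick_or ozero (fun xi => olt xi alpha /\ f xi = y)) sm.
move=> /small_sub; apply => xi lt; exists (f xi); first exact: h1.
have [|h h'] := @pick_orP _ (@ozero U) (fun eta => olt eta alpha /\ f eta = f xi).
  by exists xi.
by apply: h2.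
Qed.

Lemma coded_bounded x : small lam (tc_with x) ->
  exists2 c : coded_set U, cset c = x & bounded (ccode c).
Proof.
move=> sm; have [alpha [f e]] := enumerates_ex x.
by exists (CodedSet (code_ofP e)) => //; exact: tc_small_bounded e sm.
Qed.

(** The length of the enumeration is itself marked by a bit of the code, so it is small, and the
    enumeration maps it onto the transitive closure. *)
Lemma code_tc_small (c : coded_set U) : (forall zeta, ccode c zeta -> small_ord zeta) ->
  small lam (tc_with (cset c)).
Proof.
have [p [alpha [f [_ [h1 h2 h3 h4] cE]]]] := ccodeP c.
move=> H; have [zeta /cE/H sz le] :=
  @interleave_above [:: osingle alpha; membership_code p alpha f] 0 alpha isT erefl.
have := small_image f (small_ord_le le sz).
by move=> /small_sub; apply => y /h3 [xi lt <-]; exists xi => //; left.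
Qed.

Lemma rcode_prog_small (P : program) alpha :
  (forall zeta, rcode (RProg P alpha) zeta -> small_ord zeta) -> small_ord alpha.
Proof.
move=> H; have [zeta /H sz le] :=
  @interleave_above [:: osingle_nat (U := U) (pickle (val P)); osingle alpha] 1 alpha isT erefl.
exact: small_ord_le le sz.
Qed.

Lemma interleave_small (Xs : seq (oset U)) i : i < size Xs ->
  (forall zeta, interleave Xs zeta -> small_ord zeta) ->
  forall zeta, nth (oempty (U := U)) Xs i zeta -> small_ord zeta.
Proof.
move=> ilt H zeta h; have [zeta' /H sz le] := interleave_above ilt h.
exact: small_ord_le le sz.
Qed.

End Bounds.

End Codes.

(** * Existence of computations *)

Section Computation.

Variable U : zfc_universe.
Local Notation ord := (ord U).
Implicit Types (r s t xi eta zeta lam : ord).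

Lemma config_ext (c c' : config U) : state c = state c' -> head_pos c = head_pos c' ->
  (forall xi, tape c xi = tape c' xi) -> c = c'.
Proof.
case: c c' => [s h T] [s' h' T'] /= -> -> E.
by congr Config; apply: functional_extensionality_dep.
Qed.

Lemma liminf_ex (T : Type) (le : T -> T -> Prop) t (S : ord -> Prop) f u :
  wellorder le -> (forall s, olt s t -> le (f s) u) -> exists l, is_liminf le t S f l.
Proof.
move=> wo fu.
have [|l [lu lmin]] := @wo_min _ _ wo (fun v => forall m r, olt r t ->
    is_min le (tail_values t S f r) m -> le m v).
  by exists u => m r rt [[s [_ st _ <-]] _]; exact: fu.
exists l; split=> [a [r rt am]|v vu]; first exact: lu rt am.
by apply: lmin => m r rt mm; apply: vu; exists r.
Qed.

Lemma liminf_congr (T : Type) (le : T -> T -> Prop) t (S S' : ord -> Prop) f f' l :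
  (forall s, olt s t -> f s = f' s) -> (forall s, olt s t -> (S s <-> S' s)) ->
  is_liminf le t S f l -> is_liminf le t S' f' l.
Proof.
move=> ff SS; have E r : tail_values t S f r = tail_values t S' f' r.
  apply: functional_extensionality_dep => v; apply: propext; split=> -[s [rs st Ss <-]]; exists s.
    by split=> //; [apply/SS|rewrite ff].
  by split=> //; [apply/SS|rewrite ff].
pose mins S0 f0 := fun m => exists2 r, olt r t & is_min le (tail_values t S0 f0 r) m.
have M : mins S f = mins S' f'.
  by apply: functional_extensionality_dep => m; apply: propext; split=> -[r rt mm]; exists r => //; move: mm; rewrite E.
by rewrite -[is_liminf le t S f l]/(is_lub le (mins S f) l) M.
Qed.

(** A halted configuration is repeated, so that a run is defined at all times and its halting time
    can be found afterwards. *)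
Definition next_config (P : program) (c c' : config U) : Prop :=
  (state c \in program_states P -> step P c c') /\ (state c \notin program_states P -> c' = c).

Definition canonical_run (P : program) (c0 : config U) (C : ord -> config U) : Prop :=
  [/\ C ozero = c0, forall t, next_config P (C t) (C (osuc t)) &
      forall t, is_limit t -> limit_config C t].

Lemma osetlike_heads (C : ord -> config U) t :
  exists u, forall s, olt s t -> ole (head_pos (C s)) u.
Proof.
have [u uP] := olub_class (osetlike_image (fun s => head_pos (C s)) t).
exists u => s st; left; apply/uP; exists (head_pos (C s)); last exact: olexx.
by exists s.
Qed.

(** Stated for every [C'] with the same history, since the recursion defining a run needs the
    configuration at [t] before the run exists. *)
Lemma limit_config_ex (C : ord -> config U) t M :
  (forall s, olt s t -> state (C s) <= M) ->
  exists c, forall C', (forall s, olt s t -> C' s = C s) -> C' t = c -> limit_config C' t.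
Proof.
move=> bM.
have [q qP] := liminf_ex (fun _ => True) wo_nat bM.
have [u uP] := osetlike_heads C t.
have [h hP] := liminf_ex (fun s => state (C s) = q) (wo_ord U) uP.
have [|T TP] := @choice ord bool
    (fun xi b => is_liminf (fun c d : bool => c ==> d) t (fun _ => True) (fun s => tape (C s) xi) b).
  by move=> xi; apply: (liminf_ex (u := true) _ wo_bool) => s _; rewrite implybT.
exists (Config q h T) => C' CC' E; split; rewrite E /=.
- by apply: liminf_congr qP => // s /CC' ->.
- by apply: liminf_congr hP => s /CC' ->.
- by move=> xi; apply: liminf_congr (TP xi) => // s /CC' ->.
Qed.

Lemma program_next_bound (P : program) : exists M, forall k, k \in val P -> cmd_next k <= M.
Proof.
elim: (val P) => [|k s [M IH]]; first by exists 0.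
exists (maxn (cmd_next k) M) => k'; rewrite inE => /orP [/eqP ->|/IH]; lia.
Qed.

Lemma step_ex (P : program) (c : config U) : state c \in program_states P -> exists c', step P c c'.
Proof.
move=> /mapP [k kP kst]; have /andP [/allP /(_ k kP) /hasP [k' k'P /andP [/eqP e1 /eqP e2]] _] := valP P.
have [k0 [k0P k0s k0r]] : exists k0, [/\ k0 \in val P, cmd_state k0 = state c &
    cmd_read k0 = tape c (head_pos c)].
  case: (eqVneq (cmd_read k) (tape c (head_pos c))) => e; first by exists k.
  exists k'; split=> //; first by rewrite e1.
  by move: e e2; case: (cmd_read k); case: (cmd_read k'); case: (tape _ _).
have [h hP] : exists h, move_head (cmd_right k0) (head_pos c) h.
  rewrite /move_head; case: (cmd_right k0); first by exists (osuc (head_pos c)); exact: osucc_suc.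
  have [/is_successorE [h E]|ns] := EM (is_successor (head_pos c)).
    by exists h; left; apply/osuccE.
  by exists ozero; right; split=> //; apply/is_zeroE.
exists (Config (cmd_next k0) h (fun xi => if `[< xi = head_pos c >] then cmd_write k0 else tape c xi)).
exists k0; split=> //; split=> //=; first by case: asboolP.
by move=> xi ne; case: asboolP.
Qed.

Lemma canonical_ex (P : program) (c0 : config U) : exists C, canonical_run P c0 C.
Proof.
pose spec t (h : forall s, olt s t -> config U) c :=
  [/\ t = ozero -> c = c0, forall s (r : olt s t), t = osuc s -> next_config P (h s r) c &
     is_limit t -> forall C', (forall s (r : olt s t), C' s = h s r) -> C' t = c -> limit_config C' t].
have [C CE] := wf_recursion (fun t h => pick_or c0 (spec t h)) (@olt_wf U).
have [M MP] := program_next_bound P.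
(* The bound on the states is carried through the recursion because it makes the inferior limit of
   the states exist at limit times. *)
have CP t : spec t (fun s _ => C s) (C t) /\ state (C t) <= maxn M (state c0).
  elim/(well_founded_ind (@olt_wf U)): t => t IH.
  suff [c cP] : exists c, spec t (fun s _ => C s) c.
    have sp : spec t (fun s _ => C s) (C t) by rewrite CE; apply: pick_orP; exists c.
    split=> //; case: sp => h0 hS hL; case: (ord_cases t) => [/h0 ->|[s E]|lt]; first lia.
      have st : olt s t by rewrite E; exact: olt_sucx.
      have [nx1 nx2] := hS s st E; have [_ b] := IH s st.
      case: (boolP (state (C s) \in program_states P)) => [/nx1 [k [[kP _ _] [-> _ _ _]]]|/nx2 -> //].
      by have := MP k kP; lia.
    have [[up lub] _ _] := hL lt C (fun s _ => erefl) erefl.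
    by apply: lub => m [r rt [[s [_ st _ <-]] _]]; case: (IH s st).
  case: (ord_cases t) => [z|[s E]|lt].
  - exists c0; split=> // [s r|[nz _]]; first by case: (@olt0 U s); rewrite -z.
    by case: nz; apply/is_zeroE.
  - have [c cP] : exists c, next_config P (C s) c.
      case: (boolP (state (C s) \in program_states P)) => [h|h].
        by have [c' st] := step_ex h; exists c'; split=> //; rewrite h.
      by exists (C s); split=> //; rewrite (negbTE h).
    exists c; split.
    + by move=> z; case: (@olt0 U s); rewrite -z E; exact: olt_sucx.
    + by move=> s' r E'; rewrite E in E'; rewrite -(osuc_inj E').
    + by move=> [_ ns]; case: ns; rewrite E; exact: succ_suc.
  - have [|c cP] := @limit_config_ex C t (maxn M (state c0)).
      by move=> s st; case: (IH s st).
    exists c; split.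
    + by move=> z; case: lt => nz; case: nz; apply/is_zeroE.
    + by move=> s r E; case: lt => _ ns; case: ns; rewrite E; exact: succ_suc.
    + by move=> _ C' CC' E; apply: cP.
exists C; split=> [|t|t lt].
- by have [[h _ _] _] := CP ozero; exact: h.
- by have [[_ h _] _] := CP (osuc t); apply: (h t (olt_sucx t)).
- by have [[_ _ h] _] := CP t; apply: h.
Qed.

Section Canonical.

Variables (P : program) (c0 : config U) (C : ord -> config U).
Hypothesis canC : canonical_run P c0 C.

Lemma halted_stays t : state (C t) \notin program_states P -> forall s, ole t s -> C s = C t.
Proof.
move=> ht; have [_ CS CL] := canC.
move=> s; elim/(well_founded_ind (@olt_wf U)): s => s IH [ts|<- //].
case: (ord_cases s) => [z|[s' E]|lt].
- by move: ts; rewrite z => /olt0.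
- have ts' : ole t s' by apply/olt_suc; rewrite -E.
  have e : C s' = C t by apply: IH => //; rewrite E; exact: olt_sucx.
  by have [_] := CS s'; rewrite -E e => /(_ ht).
- have [h1 h2 h3] := CL s lt.
  have e1 : state (C s) = state (C t).
    by apply: (liminf_const wo_nat ts _ h1) => s' ts' s's; rewrite IH.
  apply: config_ext => //.
    apply: (liminf_cofinal (wo_ord U) ts _ _ h2) => [s' ts' s's _|r rs].
      by rewrite IH //; exact: olexx.
    case: (ole_or_lt r t) => h; first by exists t; split.
    have tr := oltW h.
    by exists r; split=> //; [exact: olexx|rewrite IH|rewrite IH].
  by move=> xi; apply: (liminf_const wo_bool ts _ (h3 xi)) => s' ts' s's; rewrite IH.
Qed.

Lemma canonical_halting X0 t : state c0 = 0 -> head_pos c0 = ozero -> tape_is c0 X0 ->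
  state (C t) \notin program_states P ->
  exists2 t1, halting_computation P X0 t1 C & C t1 = C t.
Proof.
move=> s0 h0 T0 ht; have [C0 CS CL] := canC.
have [|t1 ht1 tmin] := @olt_least U (fun t => state (C t) \notin program_states P).
  by exists t.
exists t1; last by apply: esym; apply: halted_stays => //; exact: tmin.
split=> [s /is_zeroE ->|s s' lt /osuccE ->|s _|//]; last exact: CL.
  by rewrite C0; split=> //; rewrite h0; apply/is_zeroE.
have [nx _] := CS s; apply: nx; apply/negPn/negP => h.
by have /oleNgt := tmin _ h.
Qed.

End Canonical.

Definition initial_config (X0 : oset U) : config U :=
  Config 0 ozero (fun xi => `[< X0 xi >]).

(* The input and work tracks are unconstrained at halting time, so only the output track has to be known. *)
Lemma computes_intro (P : program) X Y C t :
  canonical_run P (initial_config (interleave [:: X; oempty (U := U); oempty (U := U)])) C ->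
  state (C t) \notin program_states P ->
  (forall lam n, ~ is_successor lam -> tape (C t) (lam +o (3 * n + 2)) <-> Y (lam +o n)) ->
  computes P X Y.
Proof.
move=> canC ht out.
have T0 : tape_is (initial_config (interleave [:: X; oempty (U := U); oempty (U := U)]))
    (interleave [:: X; oempty (U := U); oempty (U := U)]).
  by move=> xi; split=> /asboolP.
have [t1 hC E] := canonical_halting canC erefl erefl T0 ht.
exists t1, C; split=> //.
pose tr i : oset U := fun xi => exists lam n, [/\ ~ is_successor lam, xi = lam +o n &
  tape (C t) (lam +o (3 * n + i))].
have trE i lam n : ~ is_successor lam -> tr i (lam +o n) <-> tape (C t) (lam +o (3 * n + i)).
  move=> ns; split; last by exists lam, n.
  by move=> [lam' [n' [ns' /(oadd_uniq ns ns') [-> ->]]]].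
exists (tr 0), (tr 1) => zeta; rewrite E.
have [lam [n [ns ->]]] := oadd_decomp zeta.
have i3 : n %% 3 < 3 by rewrite ltn_mod.
have -> : n = 3 * (n %/ 3) + n %% 3 by rewrite mulnC -divn_eq.
rewrite (@interleave_at U [:: tr 0; tr 1; Y] lam (n %/ 3) (n %% 3) ns i3).
by case: (n %% 3) i3 => [|[|[|]]] //= _; rewrite ?trE ?out.
Qed.

Definition upd (T : ord -> bool) zeta (b : bool) : ord -> bool :=
  fun xi => if `[< xi = zeta >] then b else T xi.

Lemma upd_same T zeta : upd T zeta (T zeta) = T.
Proof.
by apply: functional_extensionality_dep => xi; rewrite /upd; case: asboolP => // ->.
Qed.

Lemma updE T lam i b j : upd T (lam +o i) b (lam +o j) = if j == i then b else T (lam +o j).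
Proof.
rewrite /upd; case: asboolP => [/oadd_injl ->|ne]; first by rewrite eqxx.
by case: eqP => // E; case: ne; rewrite E.
Qed.

Lemma upd_other T zeta b xi : xi <> zeta -> upd T zeta b xi = T xi.
Proof. by rewrite /upd; case: asboolP. Qed.

End Computation.

(** * Programs given by a table, and finite runs inside a block *)

Section Table.

Variables (N : nat) (d : nat -> bool -> bool * bool * nat).

Definition table_seq : seq command :=
  [seq (s, c, (d s c).1.1, (d s c).1.2, (d s c).2) | s <- iota 0 N, c <- [:: false; true]].

Lemma table_seqP k : reflect (exists s c, s < N /\ k = (s, c, (d s c).1.1, (d s c).1.2, (d s c).2))
  (k \in table_seq).
Proof.
apply: (iffP allpairsP) => [[[s c] /= [sN _ ->]]|[s [c [sN ->]]]].
  by exists s, c; rewrite mem_iota in sN.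
by exists (s, c); rewrite mem_iota /=; split=> //; case: c.
Qed.

Lemma table_is_program : is_program table_seq.
Proof.
apply/andP; split; apply/allP => k /table_seqP [s [c [sN ->]]].
  apply/hasP; exists (s, ~~ c, (d s (~~ c)).1.1, (d s (~~ c)).1.2, (d s (~~ c)).2).
    by apply/table_seqP; exists s, (~~ c).
  by rewrite /= eqxx; case: c.
by apply/allP => k' /table_seqP [s' [c' [sN' ->]]] /=; apply/implyP => /andP [/eqP -> /eqP ->].
Qed.

Definition table_program : program := exist _ table_seq table_is_program.

Lemma table_states s : (s \in program_states table_program) = (s < N).
Proof.
apply/mapP/idP => [[k /table_seqP [s' [c [lt ->]]] ->] //|lt].
by exists (s, true, (d s true).1.1, (d s true).1.2, (d s true).2) => //; apply/table_seqP; exists s, true.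
Qed.

Variable U : zfc_universe.
Local Notation ord := (ord U).
Variables (c0 : config U) (C : ord -> config U).
Hypothesis canC : canonical_run table_program c0 C.

Lemma canonical_step t s h T h' : C t = Config s h T -> s < N ->
  move_head (d s (T h)).1.2 h h' ->
  C (osuc t) = Config (d s (T h)).2 h' (upd T h (d s (T h)).1.1).
Proof.
move=> Ct sN mv; have [_ CS _] := canC; have [nx _] := CS t.
have [|k [[kP k1 k2] [h1 h2 h3 h4]]] := nx; first by rewrite Ct table_states.
move: kP k1 k2 h1 h2 h3 h4 => /table_seqP [s' [c [_ ->]]]; rewrite Ct /= => -> -> h1 h2 h3 h4.
apply: config_ext => //=.
  move: h2 mv; rewrite /move_head; case: (d s (T h)).1.2; first by move=> /osuccE -> /osuccE ->.
  move=> [/osuccE e|[ns /is_zeroE ->]] [/osuccE e'|[ns' /is_zeroE ->]] //.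
  - by apply: (@osuc_inj U); rewrite -e -e'.
  - by case: ns'; rewrite e; exact: succ_suc.
  - by case: ns; rewrite e'; exact: succ_suc.
move=> xi; rewrite /upd; case: asboolP => [->|ne] //; exact: h4.
Qed.

(* [reach lam h q c c']: the machine passes in finitely many steps inside the block of the
   nonsuccessor [lam] from [c] to [c'], visiting only offsets [>= h] and states [>= q]. *)
Inductive reach (lam : ord) (h q : nat) :
    nat -> nat -> (ord -> bool) -> nat -> nat -> (ord -> bool) -> Prop :=
| reach_refl s j T : reach lam h q s j T s j T
| reach_step s j T s' j' T' : s < N -> h <= j -> q <= s ->
    (d s (T (lam +o j))).1.2 || (0 < j) ->
    reach lam h q (d s (T (lam +o j))).2 (if (d s (T (lam +o j))).1.2 then j.+1 else j.-1)
      (upd T (lam +o j) (d s (T (lam +o j))).1.1) s' j' T' ->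
    reach lam h q s j T s' j' T'.

Lemma reach_canonical lam h q s j T s' j' T' t : reach lam h q s j T s' j' T' ->
  C t = Config s (lam +o j) T ->
  exists k, [/\ C (t +o k) = Config s' (lam +o j') T', (s, j) <> (s', j') -> 0 < k &
    forall i, i < k -> exists j0, [/\ head_pos (C (t +o i)) = lam +o j0, h <= j0 & q <= state (C (t +o i))]].
Proof.
move=> R; elim: R t => {s j T s' j' T'} [s j T|s j T s' j' T' sN hj qs mv _ IH] t Ct.
  by exists 0; split.
have [|k [h1 h2 h3]] := IH (osuc t).
  apply: canonical_step => //; move: mv; rewrite /move_head.
  case: (d _ _).1.2 => /= mv; first exact: osucc_suc.
  by left; apply/osuccE; rewrite -oaddS prednK.
exists k.+1; split=> //; first by rewrite -oaddSr.
move=> [|i] lt; first by exists j; rewrite Ct.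
by have := h3 i lt; rewrite oaddSr.
Qed.

Lemma reach_write lam h q s j T s' j' T' b m s1 :
  d s (T (lam +o j)) = (b, m, s1) -> s < N -> h <= j -> q <= s -> m || (0 < j) ->
  reach lam h q s1 (if m then j.+1 else j.-1) (upd T (lam +o j) b) s' j' T' ->
  reach lam h q s j T s' j' T'.
Proof. by move=> E sN hj qs mv R; apply: reach_step => //; rewrite E. Qed.

Lemma reach_keep lam h q s j T s' j' T' m s1 :
  d s (T (lam +o j)) = (T (lam +o j), m, s1) -> s < N -> h <= j -> q <= s -> m || (0 < j) ->
  reach lam h q s1 (if m then j.+1 else j.-1) T s' j' T' ->
  reach lam h q s j T s' j' T'.
Proof. by move=> E sN hj qs mv R; apply: (reach_write E) => //; rewrite upd_same. Qed.

Lemma reach_right n lam h q s j T s' j' T' :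
  (forall i c, i < n -> d (s + i) c = (c, true, (s + i).+1)) ->
  s + n <= N -> h <= j -> q <= s ->
  reach lam h q (s + n) (j + n) T s' j' T' -> reach lam h q s j T s' j' T'.
Proof.
elim: n s j => [|n IH] s j dE sN hj qs; first by rewrite !addn0.
rewrite !addnS => R; apply: (@reach_keep _ _ _ _ _ _ _ _ _ true s.+1) => //; last 1 first.
- apply: IH; [|lia|lia|lia|by rewrite !addSn].
  by move=> i c lt; rewrite addSnnS; apply: dE.
- by have := dE 0; rewrite addn0; apply.
- by lia.
Qed.

Lemma reach_left n lam h q s j T s' j' T' :
  (forall i c, i < n -> d (s + i) c = (c, false, (s + i).+1)) ->
  s + n <= N -> h + n <= j.+1 -> n <= j -> q <= s ->
  reach lam h q (s + n) (j - n) T s' j' T' -> reach lam h q s j T s' j' T'.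
Proof.
elim: n s j => [|n IH] s j dE sN hj nj qs; first by rewrite addn0 subn0.
rewrite addnS => R; apply: (@reach_keep _ _ _ _ _ _ _ _ _ false s.+1) => //; try lia.
  by have := dE 0; rewrite addn0; apply.
apply: IH; [|lia|lia|lia|lia|].
  by move=> i c lt; rewrite addSnnS; apply: dE.
by rewrite addSn (_ : j.-1 - n = j - n.+1) //; lia.
Qed.

End Table.

Section ConstantProgram.

Variable U : zfc_universe.
Local Notation ord := (ord U).

Lemma nat_zero_code N (lam : ord) n : ~ is_successor lam ->
  interleave [:: osingle_nat (U := U) N; osingle ozero] (lam +o n) <->
  lam = ozero /\ (n = 2 * N \/ n = 1).
Proof.
move=> ns; have i2 : n %% 2 < 2 by rewrite ltn_mod.
have nE : n = 2 * (n %/ 2) + n %% 2 by rewrite mulnC -divn_eq.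
rewrite {1}nE (@interleave_at U [:: osingle_nat (U := U) N; osingle ozero] lam _ _ ns i2).
have z0 := @ozero_nsucc U.
case: (n %% 2) i2 nE => [|[|]] //= _ nE; split.
- move=> [z /is_zeroE -> /oadd_natE E].
  by have [-> e] := oadd_uniq ns z0 E; split=> //; left; lia.
- move=> [-> nn]; exists ozero; first exact/is_zeroE.
  by apply/oadd_natE; congr (_ +o _); lia.
- move=> E; have [-> e] := oadd_uniq ns z0 (E : _ = ozero +o 0).
  by split=> //; right; lia.
- by move=> [-> nn]; have -> : n %/ 2 = 0 by lia.
Qed.

(** The code of a realizer with program number M and parameter zero has its bits at 2M and 1. On the
    output track, cell n of the first block is tape cell 3n + 2, which gives 6M + 2 and 5; the 6M +
    6 states carry the head past both. *)
Definition write_two (M : nat) (s : nat) (c : bool) : bool * bool * nat :=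
  (c || (s == 5) || (s == 6 * M + 2), true, s.+1).

Definition constant_program (M : nat) : program := table_program (6 * M + 6) (write_two M).

Lemma constant_computes M (X : oset U) :
  computes (constant_program M) X (interleave [:: osingle_nat (U := U) M; osingle ozero]).
Proof.
pose X0 := interleave [:: X; oempty (U := U); oempty (U := U)].
have [C canC] := canonical_ex (constant_program M) (initial_config X0).
have run n : n <= 6 * M + 6 -> exists T, C (ozero +o n) = Config n (ozero +o n) T /\
    forall xi, T xi <-> X0 xi \/ exists i, [/\ i < n, xi = ozero +o i & (i == 5) || (i == 6 * M + 2)].
  elim: n => [|n IH] lt.
    have [C0 _ _] := canC; exists (fun xi => `[< X0 xi >]); split; first by rewrite C0.
    by move=> xi; split=> [/asboolP|[?|[i []]] //]; [left|apply/asboolP].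
  have [|T [Cn TP]] := IH; first by lia.
  have := canonical_step canC Cn _ _ (h' := ozero +o n.+1).
  rewrite /write_two /= => -> //; last exact: osucc_suc.
  eexists; split; first by [].
  move=> xi; rewrite /upd; case: asboolP => [->|ne].
    split.
      rewrite -orbA => /orP [/TP [?|[i [ilt /oadd_injl -> h]]]|h]; first by left.
        by right; exists i; split=> //; lia.
      by right; exists n; split.
    move=> [h|[i [_ /oadd_injl <- h]]]; last by rewrite -orbA h orbT.
    by apply/orP; left; apply/orP; left; apply/TP; left.
  rewrite TP; split=> -[h|[i [ilt E h]]]; [by left|right; exists i; split=> //; lia|by left|].
  right; exists i; split=> //; rewrite ltnS leq_eqVlt in ilt.
  by case/orP: ilt => // /eqP e; case: ne; rewrite E e.
have [T [CN TP]] := run _ (leqnn _).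
apply: (computes_intro canC (t := ozero +o (6 * M + 6))); rewrite CN.
  by rewrite table_states /= ltnn.
move=> lam n ns /=; rewrite TP nat_zero_code //; split.
  move=> [h|[i [ilt E h]]].
    move: h; rewrite /X0 (@interleave_at U [:: X; oempty (U := U); oempty (U := U)] lam n 2 ns isT) //.
  have [-> e] := oadd_uniq ns (@ozero_nsucc U) E.
  by split=> //; case/orP: h => /eqP h; [right|left]; lia.
move=> [-> h]; right; exists (3 * n + 2); split=> //; case: h => ->; try lia.
Qed.

End ConstantProgram.

(** * The power set axiom *)

Section Realizers.

Variable U : zfc_universe.
Local Notation ord := (ord U).
Implicit Types (xi eta zeta lam mu : ord) (X Y : oset U) (x y z : U) (R : realizer U).

Definition nil_program : program := exist _ [::] isT.
Definition nil_realizer : realizer U := RProg nil_program ozero.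

Lemma constant_realizer (P : program) X :
  computes (constant_program (pickle (val P))) X (rcode (RProg P (@ozero U))).
Proof. exact: constant_computes. Qed.

Lemma constant_nil X : computes (constant_program (pickle (val nil_program))) X (rcode nil_realizer).
Proof. exact: constant_realizer. Qed.

Lemma realizes_qfreeE A (e : env U) R : qfree A ->
  realizes A e R = ((exists P alpha, R = RProg P alpha) /\
                    sat (fun _ => True) A (fun v => cset (e v))).
Proof. by case: A => //= [B C|B C|B C|B] ->. Qed.

Lemma realizes_qfree A (e : env U) R : qfree A -> realizes A e R ->
  sat (fun _ => True) A (fun v => cset (e v)).
Proof. by move=> q; rewrite realizes_qfreeE // => -[]. Qed.

Lemma realizes_qfree_nil A (e : env U) : qfree A ->
  sat (fun _ => True) A (fun v => cset (e v)) -> realizes A e nil_realizer.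
Proof. by move=> q h; rewrite realizes_qfreeE //; split=> //; exists nil_program, ozero. Qed.

Lemma realizes_all v A (e : env U) R : realizes (fAll v A) e R ->
  exists P alpha, R = RProg P alpha /\ forall a : coded_set U, exists R1,
    computes P (interleave (osingle alpha :: ccode a :: codes e (fv (fAll v A)))) (rcode R1) /\
    realizes A (update e v a) R1.
Proof. by []. Qed.

Lemma realizes_ex v A (e : env U) R : realizes (fEx v A) e R ->
  exists P alpha, R = RProg P alpha /\ exists (b : coded_set U) R1,
    computes P (interleave (osingle alpha :: codes e (fv (fEx v A)))) (interleave [:: ccode b; rcode R1]) /\
    realizes A (update e v b) R1.
Proof. by []. Qed.

Lemma realizes_forall v A (e : env U) R : realizes (fAll v A) e R ->
  forall a : coded_set U, exists R1, realizes A (update e v a) R1.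
Proof. by move=> [P [alpha [_ H]]] a; have [R1 [_ h]] := H a; exists R1. Qed.

Lemma realizes_exists v A (e : env U) R : realizes (fEx v A) e R ->
  exists (a : coded_set U) R1, realizes A (update e v a) R1.
Proof. by move=> [P [alpha [_ [b [R1 [_ h]]]]]]; exists b, R1. Qed.

Lemma realizes_and A B (e : env U) R : ~~ (qfree A && qfree B) -> realizes (fAnd A B) e R ->
  (exists R1, realizes A e R1) /\ (exists R1, realizes B e R1).
Proof.
by move=> /negbTE /= ->; move=> [R1 [R2 [_ h1 h2]]]; split; [exists R1|exists R2].
Qed.

Lemma realizes_impl A B (e : env U) R R1 : ~~ (qfree A && qfree B) -> realizes (fImp A B) e R ->
  realizes A e R1 -> exists R2, realizes B e R2.
Proof.
by move=> /negbTE /= -> [P [alpha [_ H]]] /H [R2 [_ h]]; exists R2.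
Qed.

(** The body of the bounded quantifier is quantifier-free, so if the inclusion is true, one fixed
    realizer serves for every instance. *)
Lemma fSub_realized (w z x : nat) (e : env U) : w != z -> w != x ->
  (forall y : U, y ∈ cset (e z) -> y ∈ cset (e x)) -> exists R, realizes (fSub w z x) e R.
Proof.
move=> wz wx sub; exists (RProg (constant_program (pickle (val nil_program))) ozero).
exists (constant_program (pickle (val nil_program))), ozero; split=> // a.
exists nil_realizer; split; first exact: constant_nil.
apply: realizes_qfree_nil => //=.
by rewrite /update eqxx !(eq_sym _ w) (negbTE wz) (negbTE wx); exact: sub.
Qed.

End Realizers.

Section PowerSet.

Variable U : zfc_universe.
Local Notation ord := (ord U).
Implicit Types (xi eta zeta lam mu : ord) (X Y : oset U) (x y z : U) (R : realizer U).

Lemma tc_ordinal lam y : tc_with (oval lam) y -> exists2 xi, ole xi lam & y = oval xi.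
Proof.
move: y; apply: tc_sub; first by exists lam => //; exact: olexx.
move=> y z [xi le ->] /ord_mem [eta <- lt]; exists eta => //.
by left; exact: olt_le_trans lt le.
Qed.

Lemma powerset_unrealizable : ~ OTM_realizable U powerset_axiom.
Proof.
move=> [R real].
have [c0 _] := coded_ex (oval (@ozero U)).
have {real} := real (fun _ => c0); rewrite /universal_closure.
have -> : fv powerset_axiom = [::] by [].
rewrite /foldr => /realizes_all [P [alpha [_ real]]].
(* Only the parameter [alpha] of the outer program is known here. The parameter [alpha'] of the
   inner one cannot be bounded in advance, but it is part of an output and hence small. *)
have [lam [alt _ ns pc]] := pclosed_closure_point id alpha.
have lam0 : olt ozero lam by exact: ole_lt_trans (ole0x _) alt.
have slam : small_ord lam alpha by apply: small_ord_le (small_ord_lam lam0 ns pc); left.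
have [|lc lcE lcb] := coded_bounded lam0 ns pc (x := oval lam).
  have := small_image (@oval U) (small_ord_lam lam0 ns pc).
  by move=> /small_sub; apply => y /tc_ordinal.
have [R1 [cP]] := real lc.
move=> /realizes_ex [P' [alpha' [R1E [b [R2 [cP' real2]]]]]].
have salpha' : small_ord lam alpha'.
  apply: (@rcode_prog_small _ lam P'); rewrite -R1E; apply: (computes_small lam0 ns pc _ cP).
  by apply: bounded_interleave => // -[|[|]] //= _; exact: bounded_single.
have sb : small lam (tc_with (cset b)).
  apply: code_tc_small => //.
  have S := computes_small lam0 ns pc _ cP'.
  apply: (@interleave_small _ lam [:: ccode b; rcode R2] 0) => //; apply: S.
  by apply: bounded_interleave => // -[|[|]] //= _; exact: bounded_single.
(* The converse half of the equivalence turns the trivial realizer of the inclusion into membership,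
   so every subset of [lam] belongs to [cset b]. *)
have sub z : (forall y, y ∈ z -> y ∈ oval lam) -> z ∈ cset b.
  move=> zlam; have [zc zE] := coded_ex z.
  have [R3 /realizes_and [//|_ [R4 real4]]] := realizes_forall real2 zc.
  have [|R5 real5] := @fSub_realized U 3 2 0 (update (update (update (fun _ => c0) 0 lc) 1 b) 2 zc) isT isT.
    by rewrite /update /= zE lcE.
  have [|R6 /realizes_qfree h] := realizes_impl _ real4 real5; first by [].
  by rewrite -zE; exact: h.
have [g gP] := sb.
apply: (@cantor ord (fun xi => olt xi lam) (fun eta S => forall xi, olt xi lam -> (S xi <-> oval xi ∈ g eta))).
  by move=> eta S S' _ h h' xi lt; rewrite h // h'.
move=> S.
have [|z zP] := @setlikeP U (fun y => exists xi, [/\ y = oval xi, olt xi lam & S xi]).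
  by exists (oval lam) => y [xi [-> lt _]].
have [|eta lt gE] := gP z.
  apply: tc_mem (tc_refl _) _; apply: sub => y /zP [xi [-> //]].
exists eta => // xi ltx; rewrite gE zP; split; first by exists xi.
by move=> [xi' [/oval_inj -> _]].
Qed.

End PowerSet.

(** * Trees *)

Section Trees.

Variable U : zfc_universe.
Local Notation ord := (ord U).
Local Notation one := (osuc (@ozero U)).
Local Notation two := (osuc one).
Implicit Types (xi eta zeta lam mu nu : ord) (w : ord -> Prop) (x y z : U).

Lemma lt0P xi : olt ozero xi <-> xi <> ozero.
Proof.
split=> [lt E|ne]; first by move: lt; rewrite E => /olt0.
by case: (ole0x xi) => // E; case: ne.
Qed.

Lemma tree_ex w : exists T : ord -> U, forall xi y, y ∈ T xi <->
  exists eta, [/\ olt ozero eta, olt eta xi, eta = one -> w xi & y = T eta].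
Proof.
have [w0 _] := @infinity_ax U.
have [T TE] := @wf_recursion ord U (@olt U) (fun xi h => pick_or w0 (fun s => forall y, y ∈ s <->
  exists eta (r : olt eta xi), [/\ olt ozero eta, eta = one -> w xi & y = h eta r])) (@olt_wf U).
exists T => xi y.
have [|s sP] := @setlikeP U (fun y => exists eta (r : olt eta xi),
    [/\ olt ozero eta, eta = one -> w xi & y = T eta]).
  have [|s sP] := @setlike_bigcup U (fun y => y ∈ oval xi)
    (fun z y => exists2 eta, z = oval eta & y = T eta) (setlike_mem _).
    move=> z /ord_mem [eta <- _]; have [s sP] := setlike1 (T eta).
    by exists s => y' [eta' /oval_inj <- ->]; exact: sP.
  exists s => y' [eta [lt [_ _ ->]]]; apply: sP; exists (oval eta) => //.
  by exists eta.
have H := @pick_orP U w0 (fun s => forall y, y ∈ s <->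
  exists eta (r : olt eta xi), [/\ olt ozero eta, eta = one -> w xi & y = T eta]).
rewrite {1}TE H; last by exists s.
by split=> [[eta [r [h1 h2 h3]]]|[eta [h1 r h2 h3]]]; exists eta => //; exists r.
Qed.

(* The sets [tree w xi], [xi > 0], have the ordinals [0 < eta < xi] as members, up to renaming, except
   that the empty set [tree w 1] is a member of [tree w xi] only if [w xi]; so they record [w]. *)
Definition tree w : ord -> U := sval (cid (tree_ex w)).

Lemma treeP w xi y : y ∈ tree w xi <->
  exists eta, [/\ olt ozero eta, olt eta xi, eta = one -> w xi & y = tree w eta].
Proof. by rewrite /tree; case: (cid (tree_ex w)) => T /= H; exact: H. Qed.

Lemma lt_one xi : olt xi one <-> xi = ozero.
Proof. by rewrite olt_suc; split=> [[/olt0|]|->] //; exact: olexx. Qed.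

Lemma ord_pos_cases xi : olt ozero xi -> xi = one \/ ole two xi.
Proof.
move=> /ole_suc [lt|<-]; last by left.
by right; apply/ole_suc.
Qed.

Lemma one_lt_two : olt one two. Proof. exact: olt_sucx. Qed.
Lemma zero_lt_one : olt ozero one. Proof. exact: olt_sucx. Qed.
Lemma zero_lt_two : olt ozero two. Proof. exact: olt_trans zero_lt_one one_lt_two. Qed.

Lemma tree_one w y : ~ y ∈ tree w one.
Proof. by move=> /treeP [eta [h /lt_one E _ _]]; move: h; rewrite E => /oltxx. Qed.

Lemma tree_mem w xi eta : ole two eta -> olt eta xi -> tree w eta ∈ tree w xi.
Proof.
move=> le lt; apply/treeP; exists eta; split=> //; first exact: olt_le_trans zero_lt_two le.
by move=> E; move: le; rewrite E => /oleNgt; case; exact: one_lt_two.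
Qed.

Lemma tree_mem_one w xi : olt one xi -> w xi -> tree w one ∈ tree w xi.
Proof. by move=> lt wxi; apply/treeP; exists one; split=> //; exact: zero_lt_one. Qed.

Lemma tree_mem_pos w xi eta : w xi -> olt ozero eta -> olt eta xi -> tree w eta ∈ tree w xi.
Proof.
move=> wxi /ord_pos_cases [->|le] lt; first exact: tree_mem_one.
exact: tree_mem.
Qed.

Lemma tree_nonempty w xi : w two -> ole two xi -> exists y, y ∈ tree w xi.
Proof.
move=> w2 [lt|<-]; first by exists (tree w two); apply: tree_mem => //; exact: olexx.
by exists (tree w one); apply: tree_mem_one => //; exact: one_lt_two.
Qed.

(** With [w two], every node of index at least 2 is nonempty, which separates index 1 from the
    others. If [xi] is less than [xi'], then [tree w' xi] is a member of the common value, hence a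
    node of [w] with index below [xi]; by induction that index equals [xi], which is absurd. *)
Lemma tree_index w w' xi xi' : w two -> w' two -> olt ozero xi -> olt ozero xi' ->
  tree w xi = tree w' xi' -> xi = xi'.
Proof.
move=> w2 w2'; elim/(well_founded_ind (@olt_wf U)): xi xi' => xi IH xi' p p' E.
case: (olt_total xi xi') => // lt.
  case: (ord_pos_cases p) => [x1|le].
    have le' : ole two xi' by apply/ole_suc; rewrite -x1.
    have [y] := tree_nonempty w2' le'; by rewrite -E x1 => /tree_one.
  have := tree_mem w' le lt; rewrite -E => /treeP [eta [q qlt _ E']].
  by have := IH eta qlt _ q p (esym E') => e; move: qlt; rewrite e => /oltxx.
case: (ord_pos_cases p') => [x1|le].
  have le' : ole two xi by apply/ole_suc; rewrite -x1.
  have [y] := tree_nonempty w2 le'; by rewrite E x1 => /tree_one.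
have := tree_mem w le lt; rewrite E => /treeP [eta [q qlt _ E']].
by have e := IH xi' lt _ p' q E'; move: qlt; rewrite -e => /oltxx.
Qed.

Lemma tree_bit w xi : w two -> olt one xi -> w xi <-> tree w one ∈ tree w xi.
Proof.
move=> w2 lt; split; first exact: tree_mem_one.
move=> /treeP [eta [p _ h E]]; apply: h.
by rewrite (tree_index w2 w2 zero_lt_one p E).
Qed.

Lemma tree_inj w w' xi eta : w two -> w' two -> tree w xi = tree w' xi ->
  ole two eta -> ole eta xi -> (w eta <-> w' eta).
Proof.
move=> w2 w2' E le2 le.
have E1 : tree w one = tree w' one.
  by apply: extensionality_ax => y; split=> /tree_one.
have lt1 : olt one eta by apply: olt_le_trans one_lt_two le2.
have p : olt ozero eta by exact: olt_trans zero_lt_one lt1.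
have Ee : tree w eta = tree w' eta.
  case: le => [lt|-> //].
  have := tree_mem w le2 lt; rewrite E => /treeP [eta' [p' _ _ E']].
  by rewrite E' -(tree_index w2 w2' p p' E').
by rewrite tree_bit // (tree_bit w2') // Ee E1.
Qed.

Lemma tree_ext w w' xi : (forall eta, ole eta xi -> (w eta <-> w' eta)) -> tree w xi = tree w' xi.
Proof.
elim/(well_founded_ind (@olt_wf U)): xi => xi IH H; apply: extensionality_ax => y.
have IH' eta : olt eta xi -> tree w eta = tree w' eta.
  by move=> lt; apply: IH => // zeta le; apply: H; left; exact: ole_lt_trans le lt.
have Hx := H xi (olexx xi).
rewrite !treeP; split=> -[eta [h1 h2 h3 ->]]; exists eta; split=> //; rewrite ?IH' //.
  by move=> /h3 /Hx.
by move=> /h3 /Hx.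
Qed.

Lemma tree_tc w mu y : tc_with (tree w mu) y -> olt ozero mu ->
  exists xi, [/\ olt ozero xi, ole xi mu & y = tree w xi].
Proof.
move=> h p; move: y h; apply: tc_sub; first by exists mu; split=> //; exact: olexx.
move=> y z [xi [h1 h2 ->]] /treeP [eta [h3 h4 _ ->]]; exists eta; split=> //.
by left; exact: olt_le_trans h4 h2.
Qed.

(** A code starts with the coded set, so position 0 is taken by the root. For this reason the
    indices of nodes start at 1; every other position holds the same node for all [mu]. *)
Definition tree_enum w mu xi : U := if pselect (xi = ozero) then tree w mu else tree w xi.

Lemma tree_enum0 w mu : tree_enum w mu ozero = tree w mu.
Proof. by rewrite /tree_enum; case: pselect. Qed.

Lemma tree_enum_pos w mu xi : olt ozero xi -> tree_enum w mu xi = tree w xi.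
Proof. by move=> /lt0P ne; rewrite /tree_enum; case: pselect. Qed.

Lemma zero_or_pos xi : xi = ozero \/ olt ozero xi.
Proof. by case: (ole0x xi); [right|left]. Qed.

Lemma tree_enumerates w mu : w two -> w mu -> olt ozero mu ->
  enumerates_tc (tree w mu) mu (tree_enum w mu).
Proof.
move=> w2 wmu p; split.
- move=> xi lt; case: (zero_or_pos xi) => [->|q]; first by rewrite tree_enum0; exact: tc_refl.
  by rewrite tree_enum_pos //; apply: tc_mem (tc_refl _) _; exact: tree_mem_pos.
- move=> xi eta ltx lte.
  case: (zero_or_pos xi) => [->|q]; case: (zero_or_pos eta) => [->|q'] //;
    rewrite ?tree_enum0 ?tree_enum_pos //.
  + by move=> /(tree_index w2 w2 p q') E; move: lte; rewrite E => /oltxx.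
  + by move=> /(tree_index w2 w2 q p) E; move: ltx; rewrite E => /oltxx.
  + exact: tree_index.
- move=> y /tree_tc /(_ p) [xi [q [lt|->] ->]]; first by exists xi => //; rewrite tree_enum_pos.
  by exists ozero => //; rewrite tree_enum0.
- by move=> xi /is_zeroE ->; exact: tree_enum0.
Qed.

Definition tree_edge w xi eta : Prop :=
  olt ozero xi /\ (eta = ozero \/ (olt xi eta /\ (xi = one -> w eta))).

(** There is no reference to [mu] here: the codes of the nodes of a branch, at suitable [mu], are
    restrictions of this one class. *)
Definition edge_code w : oset U := fun zeta =>
  exists xi eta, zeta = opair xi eta /\ tree_edge w xi eta.

Lemma edge_codeE w xi eta : edge_code w (opair xi eta) <-> tree_edge w xi eta.
Proof.
split; last by move=> h; exists xi, eta.
by move=> [a [b [/opair_inj [-> ->]]]].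
Qed.

Lemma tree_edgeP w mu xi eta : w two -> w mu -> olt xi mu -> olt eta mu ->
  tree_enum w mu xi ∈ tree_enum w mu eta <-> tree_edge w xi eta.
Proof.
move=> w2 wmu ltx lte; have p : olt ozero mu by exact: ole_lt_trans (ole0x _) ltx.
have nroot zeta : olt ozero zeta -> ole zeta mu -> ~ tree w mu ∈ tree w zeta.
  move=> q le /treeP [a [h1 h2 _ /(tree_index w2 w2 p h1) E]].
  by apply: (@oltxx U mu); rewrite {1}E; exact: olt_le_trans h2 le.
case: (zero_or_pos xi) => [->|q].
  rewrite tree_enum0; split; last by move=> [/oltxx].
  case: (zero_or_pos eta) => [->|q']; first by rewrite tree_enum0 => /memxx.
  by rewrite tree_enum_pos // => /nroot; case=> //; left.
rewrite tree_enum_pos //; case: (zero_or_pos eta) => [->|q'].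
  rewrite tree_enum0; split; last by move=> _; exact: tree_mem_pos.
  by move=> _; split=> //; left.
rewrite tree_enum_pos // treeP; split.
  move=> [a [h1 h2 h3 /(tree_index w2 w2 q h1) E]]; subst a.
  by split=> //; right.
move=> [_ [E|[lt h]]]; first by move: q'; rewrite E => /oltxx.
by exists xi.
Qed.

Lemma tree_code w mu zeta : w two -> w mu -> pclosed mu ->
  membership_code (@opair U) mu (tree_enum w mu) zeta <-> (olt zeta mu /\ edge_code w zeta).
Proof.
move=> w2 wmu pc; split.
  move=> [a [b [ha hb /tree_edgeP e <-]]]; split; first exact: pc.
  by apply/edge_codeE; exact: e.
move=> [lt [a [b [E e]]]]; move: lt; rewrite E => /(pclosed_lt _ _ pc) [ha hb].
by exists a, b; split=> //; apply/tree_edgeP.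
Qed.

Lemma omax_l xi eta : ole eta xi -> omax xi eta = xi.
Proof. by rewrite /omax; case: pselect => // h /oleNgt. Qed.

Lemma omax_r xi eta : olt xi eta -> omax xi eta = eta.
Proof. by rewrite /omax; case: pselect. Qed.

(** The pairs with maximum m are ordered as (0, m), (1, m), ..., then (m, 0), (m, 1), ..., (m, m).
    This and the next two lemmas give the successor steps in this list and the step to the next
    maximum. *)
Lemma opair_succ_l xi eta : olt (osuc xi) eta -> opair (osuc xi) eta = osuc (opair xi eta).
Proof.
move=> lt; have lt' : olt xi eta by exact: olt_trans (olt_sucx _) lt.
apply: opair_next.
  by apply/pair_ltE; right; rewrite (omax_r lt) (omax_r lt'); split=> //; left; exact: olt_sucx.
move=> e f /pair_ltE h /pair_ltE; move: h; rewrite (omax_r lt) (omax_r lt').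
case=> [l|[E0 h]] [l'|[E h']].
- exact: oltxx (olt_trans l l').
- by move: l; rewrite E => /oltxx.
- by move: l'; rewrite -E0 => /oltxx.
- have fe : ole f eta by rewrite E0; exact: ole_maxr.
  case: h' => [/olt_suc le|[e1 l']].
    case: h => [l|[_ l]]; first exact: oltxx (olt_le_trans l le).
    exact: oltxx (olt_le_trans l fe).
  apply: (@oltxx U eta); rewrite {1}E0; apply/omax_ltr; split=> //.
  by rewrite e1.
Qed.

Lemma opair_succ_r xi eta : olt eta xi -> opair xi (osuc eta) = osuc (opair xi eta).
Proof.
move=> lt; have le' : ole (osuc eta) xi by exact/ole_suc.
apply: opair_next.
  apply/pair_ltE; right; rewrite (omax_l le') (omax_l (oltW lt)).
  by split=> //; right; split=> //; exact: olt_sucx.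
move=> e f /pair_ltE h /pair_ltE; move: h; rewrite (omax_l le') (omax_l (oltW lt)).
case=> [l|[E0 h]] [l'|[E h']].
- exact: oltxx (olt_trans l l').
- by move: l; rewrite E => /oltxx.
- by move: l'; rewrite -E0 => /oltxx.
- case: h' => [l'|[e1 /olt_suc l']].
    case: h => [l|[e1 l]]; first exact: oltxx (olt_trans l l').
    by move: l'; rewrite e1 => /oltxx.
  case: h => [l|[_ l]]; first by move: l; rewrite e1 => /oltxx.
  exact: oltxx (olt_le_trans l l').
Qed.

Lemma opair_block_succ xi : opair ozero (osuc xi) = osuc (opair xi xi).
Proof.
apply: ord_ext => zeta; have [a [b ->]] := opair_surj zeta.
rewrite opair_block !olt_suc; split=> [le|].
  apply/oleNgt => /opair_lt /pair_ltE; rewrite (omax_l (olexx xi)).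
  case=> [l|[E [l|[E' l]]]]; first exact: oltxx (olt_le_trans l le).
    by apply: (@oltxx U a); apply: ole_lt_trans l; rewrite E; exact: ole_maxl.
  by apply: (@oltxx U b); apply: ole_lt_trans l; rewrite E; exact: ole_maxr.
case=> [/opair_lt /pair_ltE|/opair_inj [-> ->]]; rewrite (omax_l (olexx xi)); last exact: olexx.
by case=> [l|[-> _]]; [left|right].
Qed.

(* In the code of a tree, the limit positions that are closed under pairing and belong to [w] are
   recognized by the two bits 01 found there. *)
Lemma edge_code_cut w lam : ~ is_successor lam -> olt ozero lam ->
  (forall eta, ~ is_successor eta -> w eta -> pclosed eta) ->
  ~ edge_code w lam -> edge_code w (osuc lam) -> pclosed lam /\ w lam.
Proof.
move=> ns p wpc; have [a [b E]] := opair_surj lam; rewrite {}E in ns p *.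
rewrite edge_codeE => ne.
(* The bits 0 and 1 at [opair a b] and its successor leave only the case 0 = a < b. For b up to a,
   the position is 0, or the first bit is 1, or the second is 0; for 0 < a < b, either a = 1 and the
   position is a successor, or the first bit is 1. *)
case: (ole_or_lt b a) => [le|lt].
  case: (zero_or_pos a) => [a0|pa].
    have b0 : b = ozero by apply: ole_anti (ole0x b); rewrite -a0.
    by move: p; rewrite a0 b0 (pclosed_block (mu := ozero)) => [/oltxx //|c d /olt0].
  case: (zero_or_pos b) => [b0|pb]; first by case: ne; split=> //; left.
  case: le => [lt|ba].
    rewrite -opair_succ_r // => /edge_codeE [_ [E|[l _]]].
      by move: (olt_sucx b); rewrite E => /olt0.
    by move: l => /olt_suc /oleNgt.
  by rewrite ba -opair_block_succ => /edge_codeE [/oltxx].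
case: (zero_or_pos a) => [a0|pa]; last first.
  case: (ord_pos_cases pa) => [a1|le2].
    case: ns; rewrite a1 opair_succ_l; first exact: succ_suc.
    by rewrite -a1.
  case: ne; split=> //; right; split=> // a1; move: le2; rewrite a1 => /oleNgt; case.
  exact: one_lt_two.
have nsb : ~ is_successor b.
  move=> /is_successorE [c bE]; apply: ns; rewrite a0 bE opair_block_succ; exact: succ_suc.
have lt1 : olt one b by apply: nsucc_lt => //; rewrite -a0.
(* The second bit is that of the pair (1, b), which is [w b]; so b is closed under pairing and the
   position is b itself. *)
rewrite a0 -opair_succ_l // => /edge_codeE [_ [b0|[_ h]]].
  by move: lt; rewrite b0 => /olt0.
have wb := h erefl; have pcb := wpc _ nsb wb.
by rewrite pclosed_block.
Qed.

Lemma edge_code_cut_conv w lam : ~ is_successor lam -> olt ozero lam -> pclosed lam -> w lam ->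
  ~ edge_code w lam /\ edge_code w (osuc lam).
Proof.
move=> ns p pc wl; rewrite -{1 2}(pclosed_block pc).
have lt1 : olt one lam by exact: nsucc_lt.
rewrite -opair_succ_l // !edge_codeE; split; first by move=> [/oltxx].
by split; [exact: zero_lt_one|right].
Qed.

End Trees.

(** * The copying program *)

(* States 0 to 23 mark the cells of the output realizer. The two copies of the main loop start at states 24
   and 91, before and after the length marker of x has been read. With the state numbered from the start of
   the loop, copying index lam + m consists of: 0-1 look for the target mark (none at the start of a block,
   where the second copy tests for the cut in states 67-186); 3-5 go right to the source mark; 6-21 read
   the marker of x and the edge of u; 22-34 or 42-54 move the source mark on and go left to the
   target mark; 35-41 or 55-61 write the edge; 62-66 put the new target mark. The least state of a loop is its
   entry state, so this is the state at limit times. *)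
Definition copy_base (f : bool) : nat := if f then 91 else 24.

Definition copy_phase (f : bool) (o : nat) (c : bool) : bool * bool * nat :=
  let go o' := copy_base f + o' in
  if o == 1 then if c then (c, true, go 3) else (true, true, go (if f then 67 else 2))
  else if o == 2 then (c, true, go 6)
  else if o == 5 then if c then (false, false, go 6) else (c, true, go 3)
  else if o == 6 then (c, true, copy_base (f || c) + 7)
  else if o == 21 then (c, true, go (if c then 42 else 22))
  else if (o == 31) || (o == 51) then (true, false, go o.+1)
  else if o \in [:: 32; 33; 52; 53] then (c, false, go o.+1)
  else if (o == 34) || (o == 54) then
    if c then (false, true, go o.+1) else (c, false, go (o - 2))
  else if o == 41 then (false, true, go 62)
  else if o == 61 then (true, true, go 62)
  else if o == 66 then (true, false, go 0)
  else if o == 83 then if c then (c, false, go 132) else (c, true, go 84)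
  else if o == 107 then (c, false, go (if c then 147 else 108))
  else if (108 <= o) && (o < 146) then (c, false, go o.+1)
  else if o == 146 then (c, true, go 7)
  else if (147 <= o) && (o < 186) then (c, false, go o.+1)
  else if o == 186 then (true, true, go 187)
  else (c, true, go o.+1).

(** The offsets result from nested interleavings: 3 tracks of the tape, 4 entries of the input
    (parameter and codes of x, u and b), 2 tracks of a code. The length bit of x at index m sits at
    3(4(2m) + 1) = 24m + 3, the edge bit of u at 3(4(2m + 1) + 2) = 24m + 18. The output is a pair
    of a code and a realizer, so an edge of y goes to 3(2(2m + 1)) + 2 = 12m + 8, the length bit of
    y to cell 2 of its block, and the two bits of [nil_realizer] to cells 5 and 11. *)
Definition copy_table (s : nat) (c : bool) : bool * bool * nat :=
  if s < 12 then (c || (s == 5) || (s == 11), true, s.+1)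
  else if s < 24 then (c, false, s.+1)
  else if s < 91 then copy_phase false (s - 24) c
  else copy_phase true (s - 91) c.

Definition copy_program : program := table_program 278 copy_table.

Definition skips (dir : bool) (n s : nat) : bool :=
  all (fun i => all (fun c => copy_table (s + i) c == (c, dir, (s + i).+1)) [:: false; true]) (iota 0 n).

Lemma skipsP dir n s : skips dir n s -> forall i c, i < n -> copy_table (s + i) c = (c, dir, (s + i).+1).
Proof.
move=> /allP H i c lt; have /H /allP /(_ c) : i \in iota 0 n by rewrite mem_iota.
by case: c => /(_ isT) /eqP.
Qed.

Section CopyRuns.

Variable U : zfc_universe.
Local Notation ord := (ord U).
Implicit Types (lam : ord) (T : ord -> bool).

Local Notation reach := (reach 278 copy_table).

Lemma run_right n s1 j1 lam h q s j T s' j' T' : skips true n s -> s1 = s + n -> j1 = j + n ->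
  s + n <= 278 -> h <= j -> q <= s -> reach lam h q s1 j1 T s' j' T' -> reach lam h q s j T s' j' T'.
Proof. by move=> sk -> -> h1 h2 h3; apply: reach_right => //; exact: skipsP. Qed.

Lemma run_left n s1 j1 lam h q s j T s' j' T' : skips false n s -> s1 = s + n -> j1 = j - n ->
  s + n <= 278 -> h + n <= j.+1 -> n <= j -> q <= s ->
  reach lam h q s1 j1 T s' j' T' -> reach lam h q s j T s' j' T'.
Proof. by move=> sk -> -> h1 h2 h3 h4; apply: reach_left => //; exact: skipsP. Qed.

Lemma run_write b c m s1 j1 lam h q s j T s' j' T' : T (lam +o j) = c -> copy_table s c = (b, m, s1) ->
  j1 = (if m then j.+1 else j.-1) -> s < 278 -> h <= j -> q <= s -> m || (0 < j) ->
  reach lam h q s1 j1 (upd T (lam +o j) b) s' j' T' -> reach lam h q s j T s' j' T'.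
Proof.
move=> Tc E -> h1 h2 h3 h4 R.
by apply: (reach_write (b := b) (m := m) (s1 := s1) _ h1 h2 h3 h4 R); rewrite Tc; exact: E.
Qed.

Lemma run_read c m s1 j1 lam h q s j T s' j' T' : T (lam +o j) = c -> copy_table s c = (c, m, s1) ->
  j1 = (if m then j.+1 else j.-1) -> s < 278 -> h <= j -> q <= s -> m || (0 < j) ->
  reach lam h q s1 j1 T s' j' T' -> reach lam h q s j T s' j' T'.
Proof.
move=> Tc E -> h1 h2 h3 h4 R.
by apply: (reach_keep (m := m) (s1 := s1) _ h1 h2 h3 h4 R); rewrite Tc; exact: E.
Qed.

Lemma copy_base_cases f : copy_base f = 24 \/ copy_base f = 91.
Proof. by case: f; [right|left]. Qed.

Lemma scan_right f k p lam h q T s' j' T' :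
  (forall i, i < k -> T (lam +o (p + 3 * i + 3)) = false) -> T (lam +o (p + 3 * k + 3)) = true ->
  h <= p -> q <= copy_base f ->
  reach lam h q (copy_base f + 6) (p + 3 * k + 2) (upd T (lam +o (p + 3 * k + 3)) false) s' j' T' ->
  reach lam h q (copy_base f + 3) p.+1 T s' j' T'.
Proof.
elim: k p => [|k IH] p H0 H1 hp qf R; have [bE|bE] := copy_base_cases f.
- rewrite ?bE in qf R *; apply: (@run_right 2 (24 + 5) (p + 3)) => //; try lia.
  have e : p + 3 * 0 + 3 = p + 3 by lia.
  apply: (@run_write false true false (24 + 6) (p + 2)) => //; try lia; first by rewrite -H1 e.
  by rewrite -e (_ : p + 2 = p + 3 * 0 + 2) //; lia.
- rewrite ?bE in qf R *; apply: (@run_right 2 (91 + 5) (p + 3)) => //; try lia.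
  have e : p + 3 * 0 + 3 = p + 3 by lia.
  apply: (@run_write false true false (91 + 6) (p + 2)) => //; try lia; first by rewrite -H1 e.
  by rewrite -e (_ : p + 2 = p + 3 * 0 + 2) //; lia.
- have [e1 e2] : p + 3 * k.+1 + 2 = p + 3 + 3 * k + 2 /\ p + 3 * k.+1 + 3 = p + 3 + 3 * k + 3 by lia.
  have {}IH := IH (p + 3); rewrite bE in IH qf R *; rewrite e2 in H1; rewrite e1 e2 in R.
  apply: (@run_right 2 (24 + 5) (p + 3)) => //; try lia.
  apply: (@run_read false true (24 + 3) (p + 3).+1) => //; try lia.
    by rewrite -(H0 0) // (_ : p + 3 * 0 + 3 = p + 3) //; lia.
  apply: IH => //; try lia.
  by move=> i lt; rewrite -(H0 i.+1) //; congr (T (_ +o _)); lia.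
- have [e1 e2] : p + 3 * k.+1 + 2 = p + 3 + 3 * k + 2 /\ p + 3 * k.+1 + 3 = p + 3 + 3 * k + 3 by lia.
  have {}IH := IH (p + 3); rewrite bE in IH qf R *; rewrite e2 in H1; rewrite e1 e2 in R.
  apply: (@run_right 2 (91 + 5) (p + 3)) => //; try lia.
  apply: (@run_read false true (91 + 3) (p + 3).+1) => //; try lia.
    by rewrite -(H0 0) // (_ : p + 3 * 0 + 3 = p + 3) //; lia.
  apply: IH => //; try lia.
  by move=> i lt; rewrite -(H0 i.+1) //; congr (T (_ +o _)); lia.
Qed.

(** The bit [b] that was read is carried to the target by the choice between two copies of the
    return path. *)
Lemma scan_left f b k r lam h q T s' j' T' :
  (forall i, i < k -> T (lam +o (r + 3 * i + 3)) = false) -> T (lam +o r) = true ->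
  h <= r -> q <= copy_base f ->
  reach lam h q (copy_base f + (if b then 55 else 35)) r.+1 (upd T (lam +o r) false) s' j' T' ->
  reach lam h q (copy_base f + (if b then 52 else 32)) (r + 3 * k + 2) T s' j' T'.
Proof.
move=> H0 H1 hr qf R; elim: k H0 => [|k IH] H0.
  apply: (@run_left 2 (copy_base f + (if b then 54 else 34)) r) => //; try lia.
  - by clear; case: f; case: b.
  - by clear; case: b; lia.
  - by clear; case: f; case: b.
  - apply: (@run_write false true true (copy_base f + (if b then 55 else 35)) r.+1) => //.
    + by clear; case: f; case: b.
    + by clear; case: f; case: b.
    + by lia.
apply: (@run_left 2 (copy_base f + (if b then 54 else 34)) (r + 3 * k + 3)) => //; try lia.
- by clear; case: f; case: b.
- by clear; case: b; lia.
- by clear; case: f; case: b.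
- apply: (@run_read false false (copy_base f + (if b then 52 else 32)) (r + 3 * k + 2)) => //; try lia.
  + exact: H0.
  + by clear; case: f; case: b.
  + by clear; case: f; case: b.
  + by apply: IH => i lt; apply: H0; lia.
Qed.

Definition moved lam m b T : ord -> bool :=
  upd (upd (upd (upd T (lam +o (24 * m + 28)) true) (lam +o (12 * m + 1)) false)
    (lam +o (12 * m + 8)) b) (lam +o (12 * m + 13)) true.

Lemma transport_bit f m lam q T : q <= copy_base f -> T (lam +o (12 * m + 1)) = true ->
  (forall k, 4 * m < k -> k <= 8 * m + 8 -> T (lam +o (3 * k + 1)) = false) ->
  reach lam (12 * m) q (copy_base f + 7) (24 * m + 4) T
    (copy_base f) (12 * m + 12) (moved lam m (T (lam +o (24 * m + 18))) T).
Proof.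
move=> qf T1 Tw.
apply: (@run_right 14 (copy_base f + 21) (24 * m + 18)) => //; try lia.
- by case: f {qf}.
- by case: f {qf}.
case E: (T (lam +o (24 * m + 18))).
- apply: (@run_read true true (copy_base f + 42) (24 * m + 19)) => //; try lia; try by case: f {qf}.
  apply: (@run_right 9 (copy_base f + 51) (24 * m + 28)) => //; try lia; try by case: f {qf}.
  apply: (@run_write true (T (lam +o (24 * m + 28))) false (copy_base f + 52) (24 * m + 27)) => //;
    try lia; try by case: f {qf}.
  (* The new source mark is work cell 8m + 9 and the target mark work cell 4m; the 4m + 8 work cells
     between them are blank. *)
  rewrite (_ : 24 * m + 27 = (12 * m + 1) + 3 * (4 * m + 8) + 2); last lia.
  apply: (scan_left (f := f) (b := true)) => //; try lia.
  + move=> i lt; rewrite updE; case: eqP; first lia.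
    move=> _; rewrite -(Tw (4 * m + i + 1)); [|lia|lia].
    by congr (T (_ +o _)); lia.
  + by rewrite updE; case: eqP; lia.
  apply: (@run_right 6 (copy_base f + 61) (12 * m + 8)) => //; try lia; try by case: f {qf}.
  apply: (@run_write true (upd (upd T (lam +o (24 * m + 28)) true) (lam +o (12 * m + 1)) false (lam +o (12 * m + 8)))
    true (copy_base f + 62) (12 * m + 9)) => //; try lia; try by case: f {qf}.
  apply: (@run_right 4 (copy_base f + 66) (12 * m + 13)) => //; try lia; try by case: f {qf}.
  apply: (@run_write true _ false (copy_base f) (12 * m + 12) _ _ _ _ _ _ _ _ _ erefl) => //; try lia; try by case: f {qf}.
  exact: reach_refl.
- apply: (@run_read false true (copy_base f + 22) (24 * m + 19)) => //; try lia; try by case: f {qf}.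
  apply: (@run_right 9 (copy_base f + 31) (24 * m + 28)) => //; try lia; try by case: f {qf}.
  apply: (@run_write true (T (lam +o (24 * m + 28))) false (copy_base f + 32) (24 * m + 27)) => //;
    try lia; try by case: f {qf}.
  rewrite (_ : 24 * m + 27 = (12 * m + 1) + 3 * (4 * m + 8) + 2); last lia.
  apply: (scan_left (f := f) (b := false)) => //; try lia.
  + move=> i lt; rewrite updE; case: eqP; first lia.
    move=> _; rewrite -(Tw (4 * m + i + 1)); [|lia|lia].
    by congr (T (_ +o _)); lia.
  + by rewrite updE; case: eqP; lia.
  apply: (@run_right 6 (copy_base f + 41) (12 * m + 8)) => //; try lia; try by case: f {qf}.
  apply: (@run_write false (upd (upd T (lam +o (24 * m + 28)) true) (lam +o (12 * m + 1)) false (lam +o (12 * m + 8)))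
    true (copy_base f + 62) (12 * m + 9)) => //; try lia; try by case: f {qf}.
  apply: (@run_right 4 (copy_base f + 66) (12 * m + 13)) => //; try lia; try by case: f {qf}.
  apply: (@run_write true _ false (copy_base f) (12 * m + 12) _ _ _ _ _ _ _ _ _ erefl) => //; try lia; try by case: f {qf}.
  exact: reach_refl.
Qed.

End CopyRuns.

(** * Copying one index *)

Section CopyMachine.

Variable U : zfc_universe.
Local Notation ord := (ord U).
Implicit Types (xi eta zeta lam delta : ord) (T : ord -> bool).

Local Notation reach := (reach 278 copy_table).

Variables (E : ord -> Prop) (alpha : ord) (T0 : ord -> bool).
Hypothesis T0_marker : forall lam m, ~ is_successor lam ->
  T0 (lam +o (24 * m + 3)) <-> alpha = lam +o m.
Hypothesis T0_edge : forall lam m, ~ is_successor lam ->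
  T0 (lam +o (24 * m + 18)) <-> E (lam +o m).

(* Index [lam + m] is the next one to be copied: its source mark is at offset 24m+4 and its
   target mark at offset 12m+1, both on the work track. *)
Record tape_ok lam m T : Prop := TapeOk {
  ok_in : forall lam' k, ~ is_successor lam' -> T (lam' +o (3 * k)) = T0 (lam' +o (3 * k));
  ok_work : forall lam' k, ~ is_successor lam' -> T (lam' +o (3 * k + 1)) <->
    lam' = lam /\ 0 < m /\ (k = 4 * m \/ k = 8 * m + 1);
  ok_out : forall lam' k, ~ is_successor lam' -> T (lam' +o (3 * k + 2)) <->
    (lam' = ozero /\ (k = 1 \/ k = 3)) \/
    exists m', [/\ k = 4 * m' + 2, olt (lam' +o m') (lam +o m) & E (lam' +o m')] }.

(** The machine stores this in its state, by the choice of the copy of the loop. It only changes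
    from false to true, and [copy_base] increases with it, so the inferior limit of the states
    preserves it. *)
Definition marker_seen delta : bool := `[< olt alpha delta >].

Lemma marker_seenS lam m T : ~ is_successor lam -> tape_ok lam m T ->
  marker_seen (lam +o m.+1) = marker_seen (lam +o m) || T (lam +o (24 * m + 3)).
Proof.
move=> ns ok; have -> : 24 * m + 3 = 3 * (8 * m + 1) by lia.
rewrite (ok_in ok) // (_ : 3 * (8 * m + 1) = 24 * m + 3); last lia.
apply/asboolP/orP; last first.
  move=> [/asboolP lt|/T0_marker -> //]; first exact: olt_trans lt (olt_sucx _).
  exact: olt_sucx.
move=> /olt_suc [lt|e]; first by left; apply/asboolP.
by right; apply/T0_marker.
Qed.

Lemma nat_bool_false (b : bool) : ~ b -> b = false.
Proof. by case: b => // H; case: H. Qed.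

(** For m = 0 the block has no marks yet, and only the target mark is written; for m > 0 the source
    mark is found by scanning from the target mark. Both ways lead to the cell behind the length bit
    of x. [ncrit] excludes the two bits 01 at which the program stops. *)
Lemma start_block m lam q T s' j' T' : ~ is_successor lam -> tape_ok lam m T ->
  (m = 0 -> olt alpha lam -> E (osuc lam) -> E lam) ->
  q <= copy_base (marker_seen (lam +o m)) ->
  let T1 := if m is 0 then upd T (lam +o 1) true else upd T (lam +o (24 * m + 4)) false in
  reach lam (12 * m) q (copy_base (marker_seen (lam +o m.+1)) + 7) (24 * m + 4) T1 s' j' T' ->
  reach lam (12 * m) q (copy_base (marker_seen (lam +o m))) (12 * m) T s' j' T'.
Proof.
move=> ns ok ncrit; rewrite (marker_seenS ns ok).
case: m ok ncrit => [|m] ok ncrit; rewrite ?oadd0; last first.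
  have Tm k : T (lam +o (3 * k + 1)) <-> k = 4 * m.+1 \/ k = 8 * m.+1 + 1.
    by rewrite (ok_work ok) //; split=> [[_ [_ h]] //|h]; split.
  move: (marker_seen _) => f qf T1 R.
  have e1 : 12 * m.+1 + 1 = 3 * (4 * m.+1) + 1 by lia.
  apply: (@run_right _ 1 (copy_base f + 1) (12 * m.+1 + 1)) => //; try lia; try by clear; case: f.
  apply: (@run_read _ true true (copy_base f + 3) (12 * m.+1 + 1).+1) => //; try lia; try by clear; case: f.
    by rewrite e1; apply/Tm; left.
  apply: (@scan_right _ f (4 * m.+1)) => //; try lia.
  + move=> i lt; apply: nat_bool_false.
    rewrite (_ : 12 * m.+1 + 1 + 3 * i + 3 = 3 * (4 * m.+1 + i + 1) + 1); last lia.
    move/Tm; lia.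
  + rewrite (_ : 12 * m.+1 + 1 + 3 * (4 * m.+1) + 3 = 3 * (8 * m.+1 + 1) + 1); last lia.
    by apply/Tm; right.
  rewrite (_ : 12 * m.+1 + 1 + 3 * (4 * m.+1) + 3 = 24 * m.+1 + 4); last lia.
  rewrite (_ : 12 * m.+1 + 1 + 3 * (4 * m.+1) + 2 = 24 * m.+1 + 3); last lia.
  have E1 : upd T (lam +o (24 * m.+1 + 4)) false (lam +o (24 * m.+1 + 3)) = T (lam +o (24 * m.+1 + 3)).
    by rewrite updE; case: eqP => //; lia.
  case b: (T (lam +o (24 * m.+1 + 3))) R => R.
    rewrite orbT in R.
    apply: (@run_read _ true true (copy_base true + 7) (24 * m.+1 + 4)) => //; try lia; try by clear; case: f.
  rewrite orbF in R.
  apply: (@run_read _ false true (copy_base f + 7) (24 * m.+1 + 4)) => //; try lia; try by clear; case: f.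
have W1 : T (lam +o 1) = false.
  apply: nat_bool_false; rewrite (_ : 1 = 3 * 0 + 1) // (ok_work ok) //.
  by move=> [_ []].
have U1 j : j != 1 -> upd T (lam +o 1) true (lam +o j) = T (lam +o j).
  by rewrite updE => /negbTE ->.
move=> qf T1 R; rewrite -/T1 in U1.
have first_steps : forall s1,
    copy_table (copy_base (marker_seen lam) + 1) false = (true, true, s1) ->
    reach lam 0 q s1 2 T1 s' j' T' -> reach lam 0 q (copy_base (marker_seen lam)) 0 T s' j' T'.
  move=> s1 st R1.
  apply: (@run_right _ 1 (copy_base (marker_seen lam) + 1) 1) => //; try lia; try by clear; case: (marker_seen lam).
  apply: (@run_write _ true false true s1 2) => //; try lia; try by clear; case: (marker_seen lam).
case fE: (marker_seen lam) R qf first_steps => R qf first_steps; rewrite /= in qf; last first.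
  apply: (first_steps (24 + 2)) => //.
  apply: (@run_read _ (T1 (lam +o 2)) true (24 + 6) 3) => //; try lia.
  apply: (@run_read _ (T (lam +o 3)) true (copy_base (T (lam +o 3)) + 7) 4) => //; try lia.
  - exact: U1.
rewrite orTb in R.
have done4 : reach lam 0 q (91 + 146) 3 T1 s' j' T'.
  by apply: (@run_read _ (T1 (lam +o 3)) true (91 + 7) 4) => //; lia.
apply: (first_steps (91 + 67)) => //.
apply: (@run_right _ 16 (91 + 83) 18) => //; try lia.
case b18: (T (lam +o 18)).
  apply: (@run_read _ true false (91 + 132) 17) => //; try lia; first by rewrite U1.
  by apply: (@run_left _ 14 (91 + 146) 3) => //; try lia.
have nE : ~ E lam.
  by rewrite -(oadd0 lam) -T0_edge // (_ : 24 * 0 + 18 = 3 * 6) // -(ok_in ok) // b18.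
have nE1 : T (lam +o 42) = false.
  apply: nat_bool_false; rewrite (_ : 42 = 3 * 14) // (ok_in ok) // (_ : 3 * 14 = 24 * 1 + 18) //.
  move=> /T0_edge h; apply: nE; apply: ncrit => //; last exact: h.
  exact/asboolP.
apply: (@run_read _ false true (91 + 84) 19) => //; try lia; first by rewrite U1.
apply: (@run_right _ 23 (91 + 107) 42) => //; try lia.
apply: (@run_read _ false false (91 + 108) 41) => //; try lia; first by rewrite U1.
by apply: (@run_left _ 38 (91 + 146) 3) => //; try lia.
Qed.

Lemma moved_other lam lam' m b T j : ~ is_successor lam -> ~ is_successor lam' -> lam' <> lam ->
  moved lam m b T (lam' +o j) = T (lam' +o j).
Proof.
move=> ns ns' ne.
have ne' i : lam' +o j <> lam +o i by move=> /(oadd_uniq ns' ns) [].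
by rewrite /moved !upd_other.
Qed.

Lemma copy_step m lam T : ~ is_successor lam -> tape_ok lam m T ->
  (m = 0 -> olt alpha lam -> E (osuc lam) -> E lam) ->
  exists T', tape_ok lam m.+1 T' /\
    reach lam (12 * m) (copy_base (marker_seen (lam +o m))) (copy_base (marker_seen (lam +o m))) (12 * m) T
      (copy_base (marker_seen (lam +o m.+1))) (12 * m.+1) T'.
Proof.
move=> ns ok ncrit.
pose T1 := if m is 0 then upd T (lam +o 1) true else upd T (lam +o (24 * m + 4)) false.
have T1E j : T1 (lam +o j) =
    if (m == 0) && (j == 1) then true else if (0 < m) && (j == 24 * m + 4) then false else T (lam +o j).
  by rewrite /T1; case: (m) => [|m']; rewrite updE.
have T1o lam' j : ~ is_successor lam' -> lam' <> lam -> T1 (lam' +o j) = T (lam' +o j).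
  move=> ns' ne; have ne' i : lam' +o j <> lam +o i by move=> /(oadd_uniq ns' ns) [].
  by rewrite /T1; case: (m) => [|m']; rewrite upd_other.
have b18 : T1 (lam +o (24 * m + 18)) = T0 (lam +o (24 * m + 18)).
  rewrite T1E (_ : 24 * m + 18 = 3 * (8 * m + 6)); last lia.
  have n1 : (3 * (8 * m + 6) == 1) = false by lia.
  have n2 : (3 * (8 * m + 6) == 24 * m + 4) = false by lia.
  by rewrite -(ok_in ok) // n1 n2 !andbF.
have w1 k : T (lam +o (3 * k + 1)) = (0 < m) && ((k == 4 * m) || (k == 8 * m + 1)).
  apply/idP/idP => [/(ok_work ok) h|/andP [h1 /orP h2]].
    by case: (h ns) => _ [-> [->|->]]; rewrite eqxx ?orbT.
  by apply/(ok_work ok) => //; split=> //; split=> //; case: h2 => /eqP ->; [left|right].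
exists (moved lam m (T0 (lam +o (24 * m + 18))) T1); split; last first.
  apply: (start_block ns ok ncrit) => //; rewrite -/T1 -b18 (_ : 12 * m.+1 = 12 * m + 12); last lia.
  apply: transport_bit.
  - rewrite (marker_seenS ns ok); case: (marker_seen _) => //=; case: (T _) => //.
  - rewrite T1E (_ : 12 * m + 1 = 3 * (4 * m) + 1); last lia.
    rewrite w1; case: (posnP m) => [->|p] //.
    by rewrite eqxx /=; case: eqP => //; lia.
  - move=> k k1 k2; rewrite T1E w1; case: (posnP m) => [m0|p] /=.
      by case: eqP => //; lia.
    rewrite /=; case: eqP => // ne.
    apply/norP; split; apply/eqP; lia.
split.
- move=> lam' k ns'; have [->|ne] := EM (lam' = lam); last first.
    by rewrite moved_other // T1o // (ok_in ok).
  rewrite /moved !updE T1E -(ok_in ok) //.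
  have n1 : (3 * k == 1) = false by lia.
  have n2 : (3 * k == 24 * m + 4) = false by lia.
  by do 4!(case: eqP => [|_]; [lia|]); rewrite n1 n2 !andbF.
- move=> lam' k ns'; have [->|ne] := EM (lam' = lam); last first.
    rewrite moved_other // T1o // (ok_work ok) //; split; by move=> [].
  rewrite /moved !updE T1E w1.
  case: eqP => [h|n1]; first by split=> // _; split=> //; split=> //; left; lia.
  case: eqP => [h|n2]; first lia.
  case: eqP => [h|n3]; first by split=> // -[_ [_ h']]; lia.
  case: eqP => [h|n4]; first by split=> // _; split=> //; split=> //; right; lia.
  split; last by move=> [_ [_ h']]; lia.
  case: (posnP m) => [m0|p] /=; first by rewrite m0 /=; case: eqP => //; lia.
  rewrite /=; case: eqP => // n5 /orP [/eqP h|/eqP h]; lia.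
- move=> lam' k ns'.
  have lt' m' : lam' +o m' <> lam +o m ->
      olt (lam' +o m') (lam +o m.+1) <-> olt (lam' +o m') (lam +o m).
    by rewrite oaddS olt_suc => ne; split=> [[]|] //; left.
  have [e|ne] := EM (lam' = lam); last first.
    rewrite moved_other // T1o // (ok_out ok) //; split=> -[h|[m' [h1 h2 h3]]];
      try (by left); right; exists m'; split=> //; apply/lt' => //; move=> /(oadd_uniq ns' ns) [] //.
  rewrite e /moved !updE T1E.
  case: eqP => [h|n1]; first lia.
  case: eqP => [h|n2].
    have kE : k = 4 * m + 2 by lia.
    rewrite T0_edge //; split; first by move=> h'; right; exists m; split=> //; exact: olt_sucx.
    move=> [[_]|[m' [h1 _]]]; first lia.
    by have -> : m' = m by lia.
  case: eqP => [h|n3]; first lia.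
  case: eqP => [h|n4]; first lia.
  have n5 : (3 * k + 2 == 1) = false by lia.
  have n6 : (3 * k + 2 == 24 * m + 4) = false by lia.
  rewrite n5 n6 !andbF (ok_out ok) //; split=> -[h|[m' [h1 h2 h3]]];
    try (by left); right; exists m'; split=> //; rewrite e in lt'; apply/lt' => //;
    move=> /oadd_injl; lia.
Qed.

End CopyMachine.

Lemma cell_const (U : zfc_universe) (P : program) (c0 : config U) C (r t xi : ord U) :
  canonical_run P c0 C -> ole r t ->
  (forall s, ole r s -> olt s t -> head_pos (C s) <> xi) -> tape (C t) xi = tape (C r) xi.
Proof.
move=> [_ CS CL]; elim/(well_founded_ind (@olt_wf U)): t => t IH [rt|<- //] nv.
case: (ord_cases t) => [z|[s E]|lt].
- by move: rt; rewrite z => /olt0.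
- have rs : ole r s by apply/olt_suc; rewrite -E.
  have st : olt s t by rewrite E; exact: olt_sucx.
  have <- : tape (C s) xi = tape (C r) xi.
    by apply: IH => // s' h1 h2; apply: nv => //; exact: olt_trans h2 st.
  have [nx1 nx2] := CS s; rewrite -E in nx1 nx2.
  case: (boolP (state (C s) \in program_states P)) => [/nx1 [k [_ [_ _ _ h]]]|/nx2 -> //].
  by apply: h => e; exact: (nv s).
- have [_ _ tl] := CL t lt.
  apply: (liminf_const wo_bool rt _ (tl xi)) => s rs st.
  by apply: IH => // s' h1 h2; apply: nv => //; exact: olt_trans h2 st.
Qed.

(** * The transfinite run up to the cut *)

Section Checkpoints.

Variable U : zfc_universe.
Local Notation ord := (ord U).
Implicit Types (xi eta zeta lam delta r t : ord) (T : ord -> bool).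

Local Notation reach := (reach 278 copy_table).

Lemma interval_nat t s k : ole t s -> olt s (t +o k) -> exists2 i, i < k & s = t +o i.
Proof.
elim: k => [|k IH] ts; first by move=> /oltNge.
move=> /olt_suc [lt|->]; last by exists k.
by have [i ik ->] := IH ts lt; exists i => //; exact: ltnW.
Qed.

Variables (E : ord -> Prop) (alpha kappa : ord) (T0 : ord -> bool).
Hypothesis T0_work : forall lam k, ~ is_successor lam -> T0 (lam +o (3 * k + 1)) = false.
Hypothesis T0_out : forall lam k, ~ is_successor lam -> T0 (lam +o (3 * k + 2)) = false.
Hypothesis T0_marker : forall lam m, ~ is_successor lam ->
  T0 (lam +o (24 * m + 3)) <-> alpha = lam +o m.
Hypothesis T0_edge : forall lam m, ~ is_successor lam ->
  T0 (lam +o (24 * m + 18)) <-> E (lam +o m).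
Hypothesis kappa_ns : ~ is_successor kappa.
Hypothesis alpha_kappa : olt alpha kappa.
Hypothesis kappa_edge0 : ~ E kappa.
Hypothesis kappa_edge1 : E (osuc kappa).
Hypothesis kappa_min : forall lam, ~ is_successor lam -> olt lam kappa -> olt alpha lam ->
  E (osuc lam) -> E lam.

Variable C : ord -> config U.
Hypothesis canC : canonical_run copy_program (Config 0 ozero T0) C.

Local Notation tape_ok := (tape_ok E T0).
Local Notation flag := (marker_seen alpha).
Local Notation base delta := (copy_base (flag delta)).

Lemma prologue : exists k, exists T, C (ozero +o k) = Config 24 ozero T /\ tape_ok ozero 0 T.
Proof.
pose T1 := upd (upd T0 (ozero +o 5) true) (ozero +o 11) true.
have R : reach ozero 0 0 0 0 T0 24 0 T1.
  apply: (@run_right _ 5 5 5) => //.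
  apply: (@run_write _ true (T0 (ozero +o 5)) true 6 6) => //; first by case: (T0 _).
  apply: (@run_right _ 5 11 11) => //.
  apply: (@run_write _ true (upd T0 (ozero +o 5) true (ozero +o 11)) true 12 12) => //; first by case: (upd _ _ _ _).
  apply: (@run_left _ 12 24 0) => //.
  exact: reach_refl.
have [C0 _ _] := canC.
have [k [Ck _ _]] := reach_canonical canC R C0.
exists k, T1; split=> //.
have z0 := @ozero_nsucc U.
have other lam j : ~ is_successor lam -> lam <> ozero -> T1 (lam +o j) = T0 (lam +o j).
  move=> ns ne; rewrite /T1 !upd_other // => /(oadd_uniq ns z0) [] //.
split=> lam k' ns; (have [->|ne] := EM (lam = ozero); [|rewrite ?other ?T0_work ?T0_out //]).
- by rewrite /T1 !updE; do 2!(case: eqP => [|_]; [lia|]).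
- rewrite /T1 !updE; case: eqP => [|_]; first lia.
  case: eqP => [|_]; first lia.
  by rewrite T0_work //; split=> // -[_ []].
- by split=> // -[_ []].
- rewrite /T1 !updE; case: eqP => [h|n1]; first by split=> // _; left; split=> //; lia.
  case: eqP => [h|n2]; first by split=> // _; left; split=> //; lia.
  rewrite T0_out //; split=> // -[[_ h]|[m' [_ h _]]]; first lia.
  by move: h => /olt0.
- split=> // -[[//]|[m' [_ h _]]].
  by move: h => /olt0.
Qed.

Definition ahead delta xi := forall lam m, ~ is_successor lam -> delta = lam +o m -> ole (lam +o (12 * m)) xi.

Lemma ahead_le delta delta' xi : ole delta' delta -> ahead delta xi -> ahead delta' xi.
Proof.
move=> le ah lam' m' ns' E'; have [lam [m [ns Ed]]] := oadd_decomp delta.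
apply: ole_trans (ah lam m ns Ed).
case: le => [lt|e]; last first.
  by rewrite E' Ed in e; have [-> ->] := oadd_uniq ns' ns e; exact: olexx.
move: lt; rewrite E' Ed => /(nsucc_lt_add _ _ ns' ns) h.
left; apply/nsucc_lt_add => //; case: h => [h|[-> h]]; [by left|right].
by split=> //; lia.
Qed.

Lemma ahead_ge delta xi : ahead delta xi -> ole delta xi.
Proof.
have [lam [m [ns ->]]] := oadd_decomp delta => ah.
by apply: ole_trans (ah lam m ns erefl); apply: ole_add2l; lia.
Qed.

Lemma flag_mono delta delta' : ole delta' delta -> copy_base (flag delta') <= copy_base (flag delta).
Proof.
move=> le; rewrite /marker_seen; case: asboolP => [h|_]; last by case: asboolP.
by case: asboolP => // -[]; exact: olt_le_trans h le.
Qed.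

Definition at_checkpoint delta (c : config U) : Prop :=
  exists lam m, [/\ ~ is_successor lam, delta = lam +o m, state c = base delta,
    head_pos c = lam +o (12 * m) & tape_ok lam m (tape c)].

(** What a later limit time needs: the first clause bounds the head from below and freezes the cells
    already passed, the second bounds the state from below, and the third leaves the cells beyond a
    limit [delta] untouched. *)
Definition window (C : ord -> config U) delta' delta r t : Prop :=
  forall s, ole r s -> olt s t -> [/\ ahead delta' (head_pos (C s)), base delta' <= state (C s) &
    exists delta'' j, olt delta'' delta /\ ole (head_pos (C s)) (delta'' +o j)].

Definition good_time (theta : ord -> ord) delta t : Prop :=
  at_checkpoint delta (C t) /\
  forall delta', olt delta' delta -> olt (theta delta') t /\ window C delta' delta (theta delta') t.

Lemma good_succ theta d : olt d kappa -> good_time theta d (theta d) ->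
  exists t, good_time theta (osuc d) t.
Proof.
move=> dk [[lam [m [ns dE st hd ok]]] win].
have [|T' [ok' R]] := copy_step T0_marker T0_edge ns ok.
  move=> m0 al e1; apply: kappa_min => //; apply: ole_lt_trans dk.
  by rewrite dE; exact: ole_addr.
have Ct : C (theta d) = Config (copy_base (flag (lam +o m))) (lam +o (12 * m)) (tape (C (theta d))).
  by rewrite -hd -dE -st; case: (C (theta d)).
have [k [Ck kpos vis]] := reach_canonical canC R Ct.
have k0 : 0 < k by apply: kpos => -[_]; lia.
have visd : window C d (osuc d) (theta d) (theta d +o k).
  move=> s h1 h2; have [i ik ->] := interval_nat h1 h2.
  have [j [h hj bs]] := vis i ik; rewrite -dE in bs; split=> //.
    move=> lam' m' ns' E'; rewrite h; rewrite E' in dE.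
    by have [-> ->] := oadd_uniq ns' ns dE; exact: ole_add2l.
  exists d, j; split; first exact: olt_sucx.
  by rewrite h dE oaddA; apply: ole_add2l; lia.
exists (theta d +o k); split.
  by exists lam, m.+1; rewrite Ck dE.
have tk : olt (theta d) (theta d +o k) by apply: (olt_add2l (theta d) (m := 0)).
move=> delta' /olt_suc [lt|->]; last by split.
have [h1 h2] := win _ lt; split; first exact: olt_trans h1 tk.
move=> s h3 h4; case: (ole_or_lt (theta d) s) => h.
  have [w1 w2 w3] := visd s h h4; split=> //; first by apply: ahead_le w1; left.
  by apply: leq_trans w2; apply: flag_mono; left.
have [w1 w2 [d'' [j [w3 w4]]]] := h2 s h3 h; split=> //.
by exists d'', j; split=> //; exact: olt_trans w3 (olt_sucx d).
Qed.

Lemma good_limit theta delta : is_limit delta ->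
  (forall d, olt d delta -> good_time theta d (theta d)) -> exists t, good_time theta delta t.
Proof.
move=> [nz ns] good.
have d0 : olt ozero delta by case: (ole0x delta) => // e; case: nz; apply/is_zeroE.
have dS d : olt d delta -> olt (osuc d) delta by exact: nsucc_lt.
have [t tP] := olub_class (osetlike_image theta delta).
have tE s : olt s t <-> exists2 d, olt d delta & ole s (theta d).
  rewrite tP; split; first by move=> [eta [d dd ->] le]; exists d.
  by move=> [d dd le]; exists (theta d) => //; exists d.
have mono d d' : olt d d' -> olt d' delta -> olt (theta d) (theta d').
  by move=> lt lt'; have [_ h] := good d' lt'; case: (h d lt).
have tt d : olt d delta -> olt (theta d) t.
  by move=> lt; apply/tE; exists d => //; exact: olexx.
have win d : olt d delta -> window C d delta (theta d) t.
  move=> dd s h1 /tE [d' dd' h2].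
  pose d1 := osuc (omax d d').
  have d1d : olt d1 delta by apply: dS; apply/omax_ltr.
  have [_ /(_ d) [|_ w]] := good d1 d1d; first by apply/olt_suc; exact: ole_maxl.
  have [|w1 w2 [d'' [j [w3 w4]]]] := w s h1.
    apply: ole_lt_trans h2 _; apply: mono => //; apply/olt_suc; exact: ole_maxr.
  by split=> //; exists d'', j; split=> //; exact: olt_trans w3 d1d.
exists t; split; last by move=> d dd; split; [exact: tt|exact: win].
have tlim : is_limit t.
  split; first by move=> /is_zeroE z; move: (tt _ d0); rewrite z => /olt0.
  move=> /is_successorE [s sE].
  have /tE [d dd le] : olt s t by rewrite sE; exact: olt_sucx.
  have := tt _ (dS _ dd); rewrite sE => /olt_suc le'.
  have lt' : olt (theta d) (theta (osuc d)) by apply: mono; [exact: olt_sucx|exact: dS].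
  exact: oltxx (olt_le_trans lt' (ole_trans le' le)).
have [_ _ CL] := canC; have [sl hl tl] := CL t tlim.
have [e0 e0d e0P] : exists2 e0, olt e0 delta & forall d, ole e0 d -> olt d delta -> flag d = flag delta.
  have [h|h] := EM (olt alpha delta).
    exists (osuc alpha); first exact: dS.
    move=> d /ole_suc lt dd; rewrite /marker_seen; case: asboolP => [_|[]//].
    by case: asboolP.
  exists ozero => // d _ dd; rewrite /marker_seen; case: asboolP => [h'|_]; last by case: asboolP.
  by case: h; exact: olt_trans h' dd.
have cofinal r : olt r t -> exists d, [/\ olt d delta, ole e0 d & ole r (theta d)].
  move=> /tE [d dd le]; exists (omax e0 d); split; [exact/omax_ltr|exact: ole_maxl|].
  apply: ole_trans le _; case: (ole_maxr e0 d) => [lt|<-]; last exact: olexx.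
  by left; apply: mono => //; apply/omax_ltr.
have stE : state (C t) = base delta.
  apply: (liminf_cofinal wo_nat (tt _ e0d) _ _ sl).
    move=> s h1 h2 _; have [_ h3 _] := win _ e0d s h1 h2.
    by rewrite -(e0P e0) //; exact: olexx.
  move=> r /cofinal [d [dd ed le]]; exists (theta d); split=> //; first exact: tt.
  have [[lam [m [_ _ st _ _]]] _] := good d dd.
  by rewrite st e0P.
exists delta, 0; split=> //.
  apply: (liminf_head _ _ hl) => [r /cofinal [d [dd ed le]]|x xd].
    exists (theta d); have [[lam [m [nsl dE st hd _]]] _] := good d dd.
    split=> //; [exact: tt|by rewrite st stE e0P|].
    rewrite hd oadd0; left; apply: nsucc_add => //.
    by apply: ole_lt_trans dd; rewrite dE; exact: ole_addr.
  exists (theta (osuc x)); first by apply: tt; exact: dS.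
  move=> s h1 h2 _; have [h3 _ _] := win _ (dS _ xd) s h1 h2.
  by apply: olt_le_trans (olt_sucx x) (ahead_ge h3).
have far lam j : ~ is_successor lam -> ole delta lam ->
    tape (C t) (lam +o j) = tape (C (theta ozero)) (lam +o j).
  move=> nsl le; apply: (cell_const canC); first by left; exact: tt.
  move=> s h1 h2 e; have [_ _ [d'' [i [h3 h4]]]] := win _ d0 s h1 h2.
  have := nsucc_add i ns h3; move=> h5.
  have : olt (lam +o j) delta by rewrite -e; exact: ole_lt_trans h4 h5.
  by move=> /oltNge; apply; apply: ole_trans le (ole_addr _ _).
(* From the checkpoint of index [lam +o j.+1] on, the head stays at offset at least 12(j + 1) of the
   block or beyond it, so the cell at offset j no longer changes. *)
have near lam j : ~ is_successor lam -> olt lam delta ->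
    exists2 T, tape_ok lam j.+1 T & tape (C t) (lam +o j) = T (lam +o j).
  move=> nsl lt; have dd : olt (lam +o j.+1) delta by exact: nsucc_add.
  have [[lam' [m [ns' e _ _ ok]]] _] := good _ dd.
  have [el em] := oadd_uniq nsl ns' e; rewrite -el -em in ok.
  exists (tape (C (theta (lam +o j.+1)))) => //.
  apply: (cell_const canC); first by left; exact: tt.
  move=> s h1 h2 e'; have [h3 _ _] := win _ dd s h1 h2.
  have := h3 lam j.+1 nsl erefl; rewrite e' => /oleNgt; apply.
  by apply: olt_add2l; lia.
have [[lam0 [m0 [ns0 e00 _ _ ok0]]] _] := good _ d0.
have [el em] := oadd_uniq (@ozero_nsucc U) ns0 (e00 : ozero +o 0 = _).
rewrite -el -em in ok0.
split=> lam k nsl; case: (ole_or_lt delta lam) => h.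
- by rewrite far //; exact: (ok_in ok0).
- by have [T ok ->] := near lam (3 * k) nsl h; exact: (ok_in ok).
- by rewrite far // (ok_work ok0) //; split=> -[_ []].
- have [T ok ->] := near lam (3 * k + 1) nsl h.
  by rewrite (ok_work ok) //; split=> -[_ []] //; lia.
- rewrite far // (ok_out ok0) //; split=> -[h'|[m' [h1 h2 h3]]]; try (by left).
    by move: h2 => /olt0.
  by case: (@oltxx U lam); apply: ole_lt_trans (ole_addr lam m') (olt_le_trans h2 h).
- have [T ok ->] := near lam (3 * k + 2) nsl h.
  rewrite (ok_out ok) //; split=> -[h'|[m' [h1 h2 h3]]]; try (by left); right; exists m'; split=> //.
    exact: nsucc_add.
  by apply: olt_add2l; lia.
Qed.

Lemma reaches_kappa : exists t, at_checkpoint kappa (C t).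
Proof.
have [theta thE] := wf_recursion (fun delta th => pick_or ozero (fun t =>
  at_checkpoint delta (C t) /\ forall delta' (h : olt delta' delta),
    olt (th delta' h) t /\ window C delta' delta (th delta' h) t)) (@olt_wf U).
suff H delta : ole delta kappa -> good_time theta delta (theta delta).
  by exists (theta kappa); case: (H kappa (olexx _)).
elim/(well_founded_ind (@olt_wf U)): delta => delta IH le.
suff H : exists t, good_time theta delta t by rewrite thE; exact: pick_orP.
case: (ord_cases delta) => [z|[d dE]|lt].
- have [k [T [Ck ok]]] := prologue; exists (ozero +o k); rewrite z.
  split; last by move=> d /olt0.
  exists ozero, 0; rewrite Ck; split=> //; first exact: ozero_nsucc.
  by rewrite /marker_seen; case: asboolP => // /olt0.
- have dd : olt d delta by rewrite dE; exact: olt_sucx.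
  have dk := olt_le_trans dd le.
  by rewrite dE; apply: good_succ => //; apply: IH => //; left.
- by apply: good_limit => // d dd; apply: IH => //; left; exact: olt_le_trans dd le.
Qed.

(** Offsets 18 and 42 hold the edge bits of [kappa] and its successor, read as 0 and 1; the bit
    written at offset 2 marks the length in the output code. *)
Lemma cut_run T : tape_ok kappa 0 T ->
  reach kappa 0 0 91 0 T 278 3 (upd (upd T (kappa +o 1) true) (kappa +o 2) true).
Proof.
move=> ok; pose T1 := upd T (kappa +o 1) true.
have W1 : T (kappa +o 1) = false.
  apply: nat_bool_false; rewrite (_ : 1 = 3 * 0 + 1) // (ok_work ok) //.
  by move=> [_ []].
have U1 j : j != 1 -> T1 (kappa +o j) = T (kappa +o j).
  by rewrite /T1 updE => /negbTE ->.
have b18 : T1 (kappa +o 18) = false.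
  apply: nat_bool_false; rewrite U1 // (_ : 18 = 3 * 6) // (ok_in ok) //.
  by move/(@T0_edge kappa 0 kappa_ns).
have b42 : T1 (kappa +o 42).
  rewrite U1 // (_ : 42 = 3 * 14) // (ok_in ok) //.
  by apply/(@T0_edge kappa 1 kappa_ns).
apply: (@run_right _ 1 92 1) => //.
apply: (@run_write _ true false true (91 + 67) 2) => //.
rewrite -/T1; apply: (@run_right _ 16 (91 + 83) 18) => //.
apply: (@run_read _ false true (91 + 84) 19) => //.
apply: (@run_right _ 23 (91 + 107) 42) => //.
apply: (@run_read _ true false (91 + 147) 41) => //.
apply: (@run_left _ 39 (91 + 186) 2) => //.
apply: (@run_write _ true (T1 (kappa +o 2)) true 278 3) => //.
exact: reach_refl.
Qed.

Lemma copy_halts : exists t, state (C t) = 278 /\ forall lam k, ~ is_successor lam ->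
  tape (C t) (lam +o (3 * k + 2)) <->
  [\/ lam = ozero /\ (k = 1 \/ k = 3),
      exists m, [/\ k = 4 * m + 2, olt (lam +o m) kappa & E (lam +o m)] |
      lam = kappa /\ k = 0].
Proof.
have [t [lam0 [m0 [ns0 e0 st hd ok]]]] := reaches_kappa.
have [el em] := oadd_uniq kappa_ns ns0 (e0 : kappa +o 0 = _); rewrite -el -em in hd ok.
have fk : flag kappa = true by apply/asboolP.
have Ct : C t = Config 91 (kappa +o 0) (tape (C t)).
  by rewrite -[91]/(copy_base true) -fk -st -[kappa +o 0]hd; case: (C t).
have [k [Ck _ _]] := reach_canonical canC (cut_run ok) Ct.
move: Ck; set T' := upd (upd _ _ _) _ _ => Ck.
exists (t +o k); rewrite Ck; split=> // lam j ns /=; rewrite /T'.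
have [->|ne] := EM (lam = kappa); last first.
  have ne' i : lam +o (3 * j + 2) <> kappa +o i by move=> /(oadd_uniq ns kappa_ns) [].
  rewrite !upd_other // (ok_out ok) //; split=> [[h|h]|[h|h|[]//]];
    [exact: Or31|exact: Or32|by left|by right].
rewrite !updE; case: eqP => [h|n1]; first by split=> // _; apply: Or33; split=> //; lia.
case: eqP => [h|n2]; first lia.
rewrite (ok_out ok) //; split=> [[h|h]|[h|h|[_ h]]];
  [exact: Or31|exact: Or32|by left|by right|lia].
Qed.

End Checkpoints.

Section CopyComputes.

Variable U : zfc_universe.
Local Notation ord := (ord U).

Lemma copy_computes (E : ord -> Prop) (alpha kappa : ord) (X0 cx cu cb : oset U) :
  (forall lam m, ~ is_successor lam -> cx (lam +o (2 * m)) <-> alpha = lam +o m) ->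
  (forall lam m, ~ is_successor lam -> cu (lam +o (2 * m + 1)) <-> E (lam +o m)) ->
  ~ is_successor kappa -> olt alpha kappa -> ~ E kappa -> E (osuc kappa) ->
  (forall lam, ~ is_successor lam -> olt lam kappa -> olt alpha lam -> E (osuc lam) -> E lam) ->
  computes copy_program (interleave [:: X0; cx; cu; cb])
    (interleave [:: interleave [:: osingle kappa; fun zeta => olt zeta kappa /\ E zeta];
                    rcode (nil_realizer U)]).
Proof.
move=> cxP cuP ns ak E0 E1 kmin.
pose X := interleave [:: X0; cx; cu; cb].
pose tr := [:: X; oempty (U := U); oempty (U := U)].
have [C canC] := canonical_ex copy_program (initial_config (interleave tr)).
have [||||t [ht out]] := copy_halts _ _ _ _ ns ak E0 E1 kmin canC.
- move=> lam k nsl; apply/asboolP.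
  by rewrite (@interleave_at U tr lam k 1 nsl isT).
- move=> lam k nsl; apply/asboolP.
  by rewrite (@interleave_at U tr lam k 2 nsl isT).
- move=> lam m nsl; rewrite -cxP //.
  have e1 : interleave tr (lam +o (3 * (8 * m + 1) + 0)) <-> X (lam +o (8 * m + 1)) :=
    @interleave_at U tr lam (8 * m + 1) 0 nsl isT.
  have e2 : X (lam +o (4 * (2 * m) + 1)) <-> cx (lam +o (2 * m)) :=
    @interleave_at U [:: X0; cx; cu; cb] lam (2 * m) 1 nsl isT.
  rewrite -e2 (_ : 4 * (2 * m) + 1 = 8 * m + 1); last lia.
  rewrite -e1 (_ : 24 * m + 3 = 3 * (8 * m + 1) + 0); last lia.
  by split=> /asboolP.
- move=> lam m nsl; rewrite -cuP //.
  have e1 : interleave tr (lam +o (3 * (8 * m + 6) + 0)) <-> X (lam +o (8 * m + 6)) :=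
    @interleave_at U tr lam (8 * m + 6) 0 nsl isT.
  have e2 : X (lam +o (4 * (2 * m + 1) + 2)) <-> cu (lam +o (2 * m + 1)) :=
    @interleave_at U [:: X0; cx; cu; cb] lam (2 * m + 1) 2 nsl isT.
  rewrite -e2 (_ : 4 * (2 * m + 1) + 2 = 8 * m + 6); last lia.
  rewrite -e1 (_ : 24 * m + 18 = 3 * (8 * m + 6) + 0); last lia.
  by split=> /asboolP.
apply: (computes_intro canC (t := t)); first by rewrite ht table_states.
move=> lam n nsl; rewrite out //.
set cy := interleave [:: osingle kappa; _].
have i2 : n %% 2 < 2 by rewrite ltn_mod.
have nE : n = 2 * (n %/ 2) + n %% 2 by rewrite mulnC -divn_eq.
have -> : interleave [:: cy; rcode (nil_realizer U)] (lam +o n) <->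
    nth (oempty (U := U)) [:: cy; rcode (nil_realizer U)] (n %% 2) (lam +o (n %/ 2)).
  by rewrite {1}nE; exact: interleave_at.
have pk : pickle (val nil_program) = 0 by [].
case: (n %% 2) i2 nE => [|[|]] //= _; set a := n %/ 2 => nE; last first.
  rewrite pk nat_zero_code //; split.
    move=> [[-> h]|[m [h _ _]]|[_ h]]; [split=> //|lia|lia].
    by case: h => h; [left|right]; lia.
  by move=> [-> h]; apply: Or31; split=> //; case: h => h; [left|right]; lia.
have j2 : a %% 2 < 2 by rewrite ltn_mod.
have aE : a = 2 * (a %/ 2) + a %% 2 by rewrite mulnC -divn_eq.
have -> : cy (lam +o a) <-> nth (oempty (U := U)) [:: osingle kappa; fun zeta => olt zeta kappa /\ E zeta]
    (a %% 2) (lam +o (a %/ 2)).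
  by rewrite {1}aE; exact: interleave_at.
case: (a %% 2) j2 aE => [|[|]] //= _; set b := a %/ 2 => aE; split.
- move=> [[_ h]|[m [h _ _]]|[-> h]]; [lia|lia|].
  by rewrite /osingle (_ : b = 0) //; lia.
- move=> h; have [-> b0] := oadd_uniq nsl ns (h : _ = kappa +o 0).
  by apply: Or33; split=> //; lia.
- move=> [[_ h]|[m [h h1 h2]]|[_ h]]; [lia| |lia].
  by have -> : b = m by lia.
- by move=> [h1 h2]; apply: Or32; exists b; split=> //; lia.
Qed.

End CopyComputes.

(** * Subset collection *)

(** Being quantifier-free, it is realized whenever it is true; the content of the premise is thus
    only the computation of a y. *)
Definition escape_formula : formula := fAnd (fMem var_y var_u) (fNot (fMem var_y var_x)).

Section SubsetCollection.

Variable U : zfc_universe.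
Local Notation ord := (ord U).
Local Notation one := (osuc (@ozero U)).
Local Notation two := (osuc one).
Implicit Types (xi eta zeta lam mu nu : ord) (w : ord -> Prop) (x y z : U).

Lemma tree_setlike nu : setlike (fun y => exists2 w, w two & y = tree w nu).
Proof.
have := setlike_image (fun v => tree (fun xi => oval xi ∈ v) nu)
  (setlike_subsets (setlike_mem (oval (osuc nu)))).
move=> /setlike_sub; apply => y [w w2 ->].
have [|v vP] := @setlikeP U (fun z => exists xi, [/\ z = oval xi, ole xi nu & w xi]).
  by exists (oval (osuc nu)) => z [xi [-> le _]]; apply/olt_suc.
exists v; first by move=> z /vP [xi [-> le _]]; apply/olt_suc.
apply: tree_ext => eta le; rewrite vP; split; first by exists eta.
by move=> [xi [/oval_inj ->]].
Qed.

Lemma tree_family_ex mu : exists x, forall y, y ∈ x <->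
  exists w nu, [/\ w two, olt ozero nu, ole nu mu & y = tree w nu].
Proof.
apply: setlikeP.
have [|s sP] := @setlike_bigcup U (fun z => z ∈ oval (osuc mu))
  (fun z y => exists nu, oval nu = z /\ exists2 w, w two & y = tree w nu) (setlike_mem _).
  move=> z /ord_mem [nu <- _]; apply: (setlike_sub (tree_setlike nu)) => y.
  by move=> [nu' [/oval_inj -> h]].
exists s => y [w [nu [w2 _ le ->]]]; apply: sP; exists (oval nu); first exact/olt_suc.
by exists nu; split=> //; exists w.
Qed.

Definition tree_family mu : U := sval (cid (tree_family_ex mu)).

Lemma tree_familyP mu y : y ∈ tree_family mu <->
  exists w nu, [/\ w two, olt ozero nu, ole nu mu & y = tree w nu].
Proof. by rewrite /tree_family; case: (cid _) => x /= H; exact: H. Qed.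

(** A bound in the manner of Hartogs: if an enumeration of the transitive closure were as long as
    one of its subsets, its members would code all of these subsets. With [lam] closed under [G],
    all codes of the sets x in a are shorter than [lam]. *)
Lemma tree_family_bound : exists G : ord -> ord, forall mu alpha f,
  enumerates_tc (tree_family mu) alpha f -> olt alpha (G mu).
Proof.
suff H mu : exists g, forall alpha f, enumerates_tc (tree_family mu) alpha f -> olt alpha g.
  by have [G GP] := choice H; exists G.
have setK := tc_setlike (tree_family mu); have [x0 x0P] := setlikeP setK.
have [|gam [e [e1 e2 e3 _ _]]] := enumeration (setlike_subsets setK) (x0 := x0).
  by move=> y /x0P.
exists gam => alpha f [h1 h2 h3 _]; case: (ole_or_lt gam alpha) => // le.
case: (@cantor U (tc_with (tree_family mu)) (fun a S => exists xi, [/\ olt xi gam, f xi = a &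
  forall y, tc_with (tree_family mu) y -> (S y <-> y ∈ e xi)])).
  move=> a S S' _ [xi [l1 E1 H1]] [xi' [l2 E2 H2]] b Kb.
  have exi : xi = xi' by apply: h2; rewrite ?E1 ?E2 //; exact: olt_le_trans le.
  by rewrite H1 // H2 // exi.
move=> S; have [|z zP] := @setlikeP U (fun y => tc_with (tree_family mu) y /\ S y).
  by apply: setlike_sub setK _ => y [].
have [|xi lt E] := e3 z; first by move=> y /zP [].
exists (f xi); first by apply: h1; exact: olt_le_trans lt le.
exists xi; split=> // y Ky; rewrite E zP; tauto.
Qed.

(** If [alpha] is less than [mu], the nodes of index [mu] record every subset of [alpha], so an
    enumeration of length [alpha] cannot reach them all. *)
Lemma tree_family_length mu alpha f : ~ is_successor mu ->
  enumerates_tc (tree_family mu) alpha f -> ole mu alpha.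
Proof.
move=> ns [h1 h2 h3 _]; apply/oleNgt => lt.
have mu0 : olt ozero mu by exact: ole_lt_trans (ole0x _) lt.
apply: (@cantor ord (fun xi => olt xi alpha) (fun xi S => exists w, [/\ w two, f xi = tree w mu &
  forall eta, olt eta alpha -> (S eta <-> w (eta +o 3))])).
  move=> xi S S' _ [w [w2 E H]] [w' [w2' E' H']] eta le.
  rewrite H // H' //; apply: (tree_inj (xi := mu)) => //; first by rewrite -E -E'.
    by apply: (@ole_trans _ (eta +o 2)); [exact: (ole_addn 2 (ole0x eta))|left; exact: olt_sucx].
  by left; apply: nsucc_add => //; exact: olt_trans le lt.
(* The subset is stored from 3 on, since nodes do not record [w] at 0 and 1, and [w two] has to
   hold. *)
move=> S; pose w xi := xi = two \/ exists2 eta, xi = eta +o 3 & S eta.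
have w3 eta : w (eta +o 3) <-> S eta.
  split; last by right; exists eta.
  move=> [/osuc_inj /osuc_inj E|[eta' /oadd_inj -> //]].
  by case: (@olt0 U eta); rewrite -E; exact: olt_sucx.
have /tc_mem /(_ (_ : tree w mu ∈ _)) : tc_with (tree_family mu) (tree_family mu) by exact: tc_refl.
case/(_ _)/h3.
  by apply/tree_familyP; exists w, mu; split=> //; [left|exact: olexx].
move=> xi lx E; exists xi => //; exists w; split=> //; first by left.
by move=> eta _; rewrite w3.
Qed.

(* Data bits of [w] sit at successor ordinals; at the other ordinals [w] marks the closure points. *)
Definition marked w : Prop := w two /\ forall xi, ~ is_successor xi -> (w xi <-> pclosed xi).

(** * Realizing the premise for a branch *)

Section Premise.

Variables (lam : ord) (G : ord -> ord) (w : ord -> Prop) (e : env U).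
Hypothesis lam_ns : ~ is_successor lam.
Hypothesis lam_pc : pclosed lam.
Hypothesis GP : forall mu alpha f, enumerates_tc (tree_family mu) alpha f -> olt alpha (G mu).
Hypothesis lam_G : forall mu, olt mu lam -> olt (G mu) lam.
Hypothesis lam_cof : forall mu, olt mu lam -> exists nu,
  [/\ olt mu nu, olt nu lam, ~ is_successor nu & pclosed nu].
Hypothesis mw : marked w.
Hypothesis aP : forall y, y ∈ cset (e var_a) <->
  exists mu, [/\ olt mu lam, ~ is_successor mu & y = tree_family mu].
Hypothesis bP : forall y, y ∈ cset (e var_b) <->
  exists v nu, [/\ v two, olt ozero nu, olt nu lam & y = tree v nu].
Hypothesis uE : cset (e var_u) = tree w lam.
Hypothesis uC : ccode (e var_u) = code_of lam (tree_enum w lam).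

Lemma witness_exists (c : coded_set U) : cset c ∈ cset (e var_a) ->
  realizes (fExIn var_y var_b escape_formula) (update e var_x c) (RProg copy_program ozero).
Proof.
move=> /aP [mu [mul muns cE]].
have [w2 wns] := mw; have wl : w lam by apply/wns.
have [p [alpha [f [_ en cP]]]] := ccodeP c; rewrite cE in en.
have amu : ole mu alpha by exact: tree_family_length en.
have al : olt alpha lam by exact: olt_trans (GP en) (lam_G mul).
pose E zeta := olt zeta lam /\ edge_code w zeta.
(* The program stops at the first place beyond [alpha] that looks like a cut. There is one because
   limits closed under pairing are cofinal in [lam], and all of them are marked in [w]. *)
have [kap [kns ak k0 k1] kmin] : exists2 kap,
    [/\ ~ is_successor kap, olt alpha kap, ~ E kap & E (osuc kap)] &
    forall xi, [/\ ~ is_successor xi, olt alpha xi, ~ E xi & E (osuc xi)] -> ole kap xi.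
  apply: olt_least; have [nu [n1 n2 n3 n4]] := lam_cof al.
  have [h1 h2] := edge_code_cut_conv n3 (ole_lt_trans (ole0x _) n1) n4 (iffRL (wns _ n3) n4).
  exists nu; split=> //; first by move=> [].
  by split=> //; exact: nsucc_lt.
have kl : olt kap lam by case: k1 => h _; exact: olt_trans (olt_sucx _) h.
have kpos : olt ozero kap by exact: ole_lt_trans (ole0x _) ak.
(* Conversely, bits 01 at a limit occur only at a marked ordinal, so the copied part is the code of
   the node [tree w kap]. *)
have [kpc wk] : pclosed kap /\ w kap.
  apply: edge_code_cut => //; last by case: k1.
    by move=> eta ns /wns; apply.
  by move=> h; apply: k0.
have en_y := tree_enumerates w2 wk kpos.
have yC : code_of kap (tree_enum w kap) =
    interleave [:: osingle kap; fun zeta => olt zeta kap /\ E zeta].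
  rewrite /code_of; congr (interleave [:: _; _]).
  apply: functional_extensionality_dep => zeta; apply: propext; rewrite tree_code //.
  split=> [[h1 h2]|[h1 [_ h2]]]; split=> //; split=> //; exact: olt_trans h1 kl.
exists copy_program, ozero; split=> //.
exists (CodedSet (code_ofP en_y)), (nil_realizer U); split.
  (* In sorted order the free variables are x, u and b, which fixes the input tracks expected by
     [copy_program]. *)
  have -> : fv (fEx var_y (fAnd (fMem var_y var_b) escape_formula)) = [:: var_x; var_u; var_b] by [].
  rewrite /codes /= yC /update /= uC; apply: (copy_computes (alpha := alpha)) => //.
  - move=> l m ns; rewrite cP.
    have := @interleave_at U [:: osingle alpha; membership_code p alpha f] l m 0 ns isT.
    by rewrite addn0 /= => ->; split.
  - move=> l m ns; rewrite /E -tree_code //.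
    exact: (@interleave_at U [:: osingle lam; membership_code (@opair U) lam (tree_enum w lam)] l m 1 ns isT).
  - move=> l ns lk la h1; apply: contrapT => h0.
    by have /oleNgt := kmin l (And4 ns la h0 h1).
apply: realizes_qfree_nil => //=; rewrite /update /=; split; first by apply/bP; exists w, kap.
split; first by rewrite uE; exact: tree_mem_pos.
(* As [alpha] is at least [mu], the index [kap] is too large for [tree_family mu]. *)
rewrite cE => /tree_familyP [v [nu [v2 nu0 le yE]]].
have kn := tree_index w2 v2 kpos nu0 yE.
by move: ak; rewrite kn => /oltNge; apply; exact: ole_trans le amu.
Qed.

Lemma premise_realized :
  exists R, realizes (fAllIn var_x var_a (fExIn var_y var_b escape_formula)) e R.
Proof.
(* Three layers: a constant program for the quantifier over x outputs one for the implication, which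
   outputs [copy_program] for the existential quantifier. *)
pose PB := constant_program (pickle (val copy_program)).
exists (RProg (constant_program (pickle (val PB))) ozero).
exists (constant_program (pickle (val PB))), ozero; split=> // c.
exists (RProg PB ozero); split; first exact: constant_realizer.
exists PB, ozero; split=> // R1 /realizes_qfree h.
exists (RProg copy_program ozero); split; first exact: constant_realizer.
exact: witness_exists (h isT).
Qed.

End Premise.

Lemma conclusion_true (e : env U) R :
  realizes (fExIn var_d var_c
        (fAnd
          (fAllIn var_x var_a (fExIn var_y var_d escape_formula))
          (fAllIn var_y var_d (fExIn var_x var_a escape_formula)))) e R ->
  exists d, [/\ d ∈ cset (e var_c),
    forall x, x ∈ cset (e var_a) -> exists y, [/\ y ∈ d, y ∈ cset (e var_u) & ~ y ∈ x] &
    forall y, y ∈ d -> y ∈ cset (e var_u)].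
Proof.
move=> /realizes_exists [d [R1 /realizes_and [//|[R2 hd] [R3 /realizes_and [//|[R4 h1] [R5 h2]]]]]].
exists (cset d); split; first exact: (realizes_qfree _ hd).
  move=> x xa; have [c cE] := coded_ex x.
  have [R6 h6] := realizes_forall h1 c.
  have [||R7 /realizes_exists [y [R8 /realizes_qfree h8]]] := realizes_impl (R1 := nil_realizer U) _ h6.
  - by [].
  - by apply: realizes_qfree_nil => //=; rewrite /update /= cE.
  - have [//|k1 [k2 k3]] := h8; exists (cset y); split; [exact: k1|exact: k2|].
    by rewrite -cE; exact: k3.
move=> y yd; have [c cE] := coded_ex y.
have [R6 h6] := realizes_forall h2 c.
have [||R7 /realizes_exists [x [R8 /realizes_qfree h8]]] := realizes_impl (R1 := nil_realizer U) _ h6.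
- by [].
- by apply: realizes_qfree_nil => //=; rewrite /update /= cE.
- by have [//|k1 [k2 k3]] := h8; rewrite -cE; exact: k2.
Qed.

Lemma subset_collection_unrealizable : ~ OTM_realizable U (subset_collection escape_formula).
Proof.
move=> [R real].
have [c0 _] := coded_ex (oval (@ozero U)).
have {real} := real (fun _ => c0); rewrite /universal_closure.
have -> : fv (subset_collection escape_formula) = [::] by [].
rewrite /foldr => /realizes_all [P1 [alpha1 [_ real1]]].
have [G GP] := tree_family_bound.
have [N NP] := choice (pclosed_closure_point (@id ord)).
(* Closure under [N] makes limits closed under pairing cofinal in [lam], closure under [G] bounds
   the lengths of codes, and [alpha1] lies below [lam] so that the outer parameter is small. *)
have [lam [al lamF ns pc]] := pclosed_closure_point (fun mu => omax (G mu) (N mu)) alpha1.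
have lam0 : olt ozero lam by exact: ole_lt_trans (ole0x _) al.
have lamG mu : olt mu lam -> olt (G mu) lam by move=> /lamF /omax_ltr [].
have lam_cof mu : olt mu lam -> exists nu, [/\ olt mu nu, olt nu lam, ~ is_successor nu & pclosed nu].
  by move=> lt; exists (N mu); have [h1 _ h3 h4] := NP mu; split=> //; case/omax_ltr: (lamF _ lt).
have [|a aP] := @setlikeP U (fun y => exists mu, [/\ olt mu lam, ~ is_successor mu & y = tree_family mu]).
  have [|s sP] := @setlike_bigcup U (fun z => z ∈ oval lam)
      (fun z y => exists2 mu, oval mu = z & y = tree_family mu) (setlike_mem _).
    move=> z /ord_mem [mu <- _]; have [s sP] := setlike1 (tree_family mu).
    by exists s => y [mu' /oval_inj -> ->]; exact: sP.
  by exists s => y [mu [lt _ ->]]; apply: sP; exists (oval mu) => //; exists mu.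
have [|b bP] := @setlikeP U (fun y => exists v nu, [/\ v two, olt ozero nu, olt nu lam & y = tree v nu]).
  exists (tree_family lam) => y [v [nu [v2 p lt ->]]]; apply/tree_familyP.
  by exists v, nu; split=> //; left.
(* A node of index [nu] is named by [nu] and its position in an enumeration of the transitive
   closure of [tree_family nu], which is shorter than [lam]; pairing then enumerates all nodes by
   [lam]. *)
have small_b : small lam (fun y => y ∈ b).
  have [h hP] := choice (fun mu => enumerates_ex (tree_family mu)).
  have [f fP] := choice hP.
  have := small_image (fun c : ord * ord => f c.1 c.2) (small_pair pc (small_lt lam) (small_lt lam)).
  move=> /small_sub; apply => y /bP [v [nu [v2 p lt ->]]].
  have [_ _ surj _] := fP nu.
  have [|xi lx E] := surj (tree v nu).
    apply: tc_mem (tc_refl _) _; apply/tree_familyP; exists v, nu; split=> //; exact: olexx.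
  exists (nu, xi) => //=; split=> //; exact: olt_trans lx (olt_trans (GP _ _ _ (fP nu)) (lamG _ lt)).
have btrans y z : y ∈ b -> z ∈ y -> z ∈ b.
  move=> /bP [v [nu [v2 p lt ->]]] /treeP [eta [p' lt' _ ->]]; apply/bP.
  by exists v, eta; split=> //; exact: olt_trans lt' lt.
have atrans mu y : olt mu lam -> y ∈ tree_family mu -> y ∈ b.
  move=> ml /tree_familyP [v [nu [v2 p le ->]]]; apply/bP.
  by exists v, nu; split=> //; exact: ole_lt_trans le ml.
have [|ac acE acB] := coded_bounded lam0 ns pc (x := a).
  have sa : small lam (fun y => y ∈ a).
    have := small_image tree_family (small_lt lam); move=> /small_sub; apply => y /aP [mu [h _ ->]].
    by exists mu.
  have := small_or lam0 ns pc (small1 lam0 a) (small_or lam0 ns pc sa small_b).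
  move=> /small_sub; apply; apply: tc_sub; first by left.
  move=> y z [->|[ya|yb]] zy; right; [by left|right|right; exact: btrans yb zy].
  by move: zy; case/aP: ya => mu [ml _ ->]; exact: atrans.
have [|bc bcE bcB] := coded_bounded lam0 ns pc (x := b).
  have := small_or lam0 ns pc (small1 lam0 b) small_b.
  move=> /small_sub; apply; apply: tc_sub; first by left.
  by move=> y z [->|yb] zy; right => //; exact: btrans yb zy.
have bsingle xi : small_ord lam xi -> bounded lam (osingle xi) by exact: bounded_single.
have salpha1 : small_ord lam alpha1 by apply: small_ord_le (small_ord_lam lam0 ns pc); left.
have [R1 [cP1 /realizes_all [P2 [alpha2 [R1E real2]]]]] := real1 ac.
have salpha2 : small_ord lam alpha2.
  apply: (@rcode_prog_small _ lam P2); rewrite -R1E; apply: (computes_small lam0 ns pc _ cP1).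
  by apply: bounded_interleave => // -[|[|]] //= _; exact: bsingle.
have [R2 [cP2 /realizes_ex [P3 [alpha3 [R2E [c [R3 [cP3 real3]]]]]]]] := real2 bc.
have salpha3 : small_ord lam alpha3.
  apply: (@rcode_prog_small _ lam P3); rewrite -R2E; apply: (computes_small lam0 ns pc _ cP2).
  apply: bounded_interleave => // -[|[|[|]]] //= _; exact: bsingle.
have sc : small lam (tc_with (cset c)).
  apply: code_tc_small => //.
  have S := computes_small lam0 ns pc _ cP3.
  apply: (@interleave_small _ lam [:: ccode c; rcode R3] 0) => //; apply: S.
  by apply: bounded_interleave => // -[|[|[|]]] //= _; exact: bsingle.
pose good d w := (forall y, y ∈ d -> y ∈ tree w lam) /\
  forall mu, olt mu lam -> ~ is_successor mu -> exists2 y, y ∈ d & ~ y ∈ tree_family mu.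
have collect w : marked w -> exists2 d, d ∈ cset c & good d w.
  move=> mw; have [w2 wns] := mw; have wl : w lam by apply/wns.
  pose uc := CodedSet (code_ofP (tree_enumerates w2 wl lam0)).
  have [R4 h4] := realizes_forall real3 uc.
  have [| |R5 h5] := premise_realized (lam := lam) (G := G) (w := w)
    (e := update (update (update (update (fun _ => c0) var_a ac) var_b bc) var_c c) var_u uc)
    ns pc GP lamG lam_cof mw _ _ erefl erefl.
  - by move=> y; rewrite /update /= acE.
  - by move=> y; rewrite /update /= bcE.
  have [//|R6 /conclusion_true [d [dc d1 d2]]] := realizes_impl _ h4 h5.
  exists d => //; split=> [|mu ml mns]; first exact: d2.
  have [|y [y1 _ y3]] := d1 (tree_family mu); last by exists y.
  by rewrite /update /= acE; apply/aP; exists mu.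
have [g gP] := sc.
apply: (@cantor ord (fun xi => olt xi lam) (fun xi S => exists w, [/\ marked w, good (g xi) w &
  forall eta, olt eta lam -> (S eta <-> w (eta +o 3))])).
  (* A set that is good for both [w] and [w'] has a node of index above [eta +o 3] lying on both
     branches, and this node determines the bit there. *)
  move=> xi S S' _ [w [[w2 _] [gw1 gw2] H]] [w' [[w2' _] [gw1' _] H']] eta lt.
  have lt3 : olt (eta +o 3) lam by exact: nsucc_add.
  have [mu [m1 m2 m3 _]] := lam_cof _ lt3.
  have [y yd ny] := gw2 mu m2 m3.
  have /treeP [nu [p nl _ yE]] := gw1 y yd; have /treeP [nu' [p' _ _ yE']] := gw1' y yd.
  have nE := tree_index w2 w2' p p' (etrans (esym yE) yE').
  rewrite H // H' //; apply: (tree_inj (xi := nu)) => //; first by rewrite -yE yE' nE.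
    by apply: (@ole_trans _ (eta +o 2)); [exact: (ole_addn 2 (ole0x eta))|left; exact: olt_sucx].
  left; apply: (olt_trans m1); case: (ole_or_lt nu mu) => // le.
  by case: ny; apply/tree_familyP; exists w, nu.
(* The shift by 3 puts the bits of [S] at successors above [two], away from the marks at zero and
   limits; all other successors, [two] among them, belong to [w]. *)
move=> S; pose w xi := (~ is_successor xi -> pclosed xi) /\ forall eta, xi = eta +o 3 -> S eta.
have mw : marked w.
  split; first split; first by case; exact: succ_suc.
    move=> eta /osuc_inj /osuc_inj E.
    by case: (@olt0 U eta); rewrite E; exact: olt_sucx.
  move=> xi xns; split; first by move=> [h _]; exact: h.
  by move=> h; split=> // eta E; case: xns; rewrite E; exact: succ_suc.
have [d dc gd] := collect w mw.
have [xi lx gE] := gP d (tc_mem (tc_refl _) dc).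
exists xi => //; exists w; split=> //; first by rewrite gE.
move=> eta _; split; last by move=> [_]; apply.
move=> Se; split; first by case; exact: succ_suc.
by move=> eta' /oadd_inj <-.
Qed.

End SubsetCollection.

Theorem proposition9 :
  (forall U : zfc_universe, ~ OTM_realizable U powerset_axiom) /\
  (forall U : zfc_universe, V_eq_L U -> ~ OTM_realizable U powerset_axiom) /\
  (exists phi : formula,
     var_c \notin fv phi /\ var_d \notin fv phi /\
     forall U : zfc_universe, ~ OTM_realizable U (subset_collection phi)).
Proof.
split; first exact: powerset_unrealizable.
split; first by move=> U _; exact: powerset_unrealizable.
exists escape_formula; do 2!split=> //.
exact: subset_collection_unrealizable.
Qed.
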